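(* The syntactic category $\mathcal S_{\mathrm{CaTT}}$ of the dependent type theory CaTT is equivalent to the opposite of the full subcategory of the category of computads $\mathrm{Comp}$ consisting of the finite computads.
   Context: **The type theory CaTT.** Fix a countably infinite set of variables. Contexts are lists of pairs $(x:A)$ with $x$ a variable and $A$ a type (empty list $\emptyset$); substitutions are lists of pairs $x\mapsto t$ with $t$ a term (empty list $\langle\rangle$); types are $\ast$ or $u\to_A v$ with $A$ a type and $u,v$ terms; terms are $\mathrm{var}\,x$ with $x$ a variable, or $\mathrm{coh}_{\Gamma,A}[\gamma]$ with $\Gamma$ a context, $A$ a type and $\gamma$ a substitution (here the brackets are part of the syntax). Substitution acts by: $(\mathrm{var}\,x)[\gamma]$ is the last term associated to $x$ in $\gamma$ if it exists and $\mathrm{var}\,x$ otherwise; $\mathrm{coh}_{\Gamma,A}[\gamma][\delta]=\mathrm{coh}_{\Gamma,A}[\gamma\circ\delta]$; $\ast[\gamma]=\ast$; $(u\to_A v)[\gamma]=u[\gamma]\to_{A[\gamma]}v[\gamma]$; where $\langle\rangle\circ\delta=\langle\rangle$ and $\langle\gamma,x\mapsto t\rangle\circ\delta=\langle\gamma\circ\delta,x\mapsto t[\delta]\rangle$. Variable sets: $\mathrm{Var}(\emptyset)=\emptyset$, $\mathrm{Var}(\Gamma,x:A)=\mathrm{Var}(\Gamma)\cup\{x\}$, $\mathrm{Var}(\langle\rangle)=\emptyset$, $\mathrm{Var}(\langle\gamma,x\mapsto t\rangle)=\mathrm{Var}(\gamma)\cup\mathrm{Var}(t)$, $\mathrm{Var}(\mathrm{var}\,x)=\{x\}$,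 $\mathrm{Var}(\mathrm{coh}_{\Gamma,A}[\gamma])=\mathrm{Var}(\gamma)$, $\mathrm{Var}(\ast)=\emptyset$, $\mathrm{Var}(u\to_A v)=\mathrm{Var}(A)\cup\mathrm{Var}(u)\cup\mathrm{Var}(v)$. Dimensions: $\dim\ast=-1$, $\dim(u\to_A v)=\dim A+1$, $\dim\emptyset=-1$, $\dim(\Gamma,x:A)=\max(\dim\Gamma,\dim A+1)$. Pasting contexts are given by the judgements $\Gamma\vdash_{ps}x:A$ and $\Gamma\vdash_{ps}$ with rules: (pss) $(x:\ast)\vdash_{ps}x:\ast$; (psd) from $\Gamma\vdash_{ps}f:x\to_A y$ infer $\Gamma\vdash_{ps}y:A$; (pse) from $\Gamma\vdash_{ps}x:A$ and distinct $y,f\notin\mathrm{Var}(\Gamma)$ infer $\Gamma,y:A,f:x\to_A y\vdash_{ps}f:x\to_A y$; (ps) from $\Gamma\vdash_{ps}x:\ast$ infer $\Gamma\vdash_{ps}$. $\Gamma$ is a pasting context if $\Gamma\vdash_{ps}$; derivations are unique. For $k\in\mathbb N$, $\epsilon\in\{+,-\}$, the context $\partial^\epsilon_k\Gamma$ is defined by induction on the derivation: (pss) $\partial^\epsilon_k((x:\ast)\vdash_{ps}x:\ast)=(x:\ast)$; (psd) $\partial^\epsilon_k(\Gamma\vdash_{ps}y:A)=\partial^\epsilon_k(\Gamma\vdash_{ps}f:x\to_A y)$; (ps) $\partial^\epsilon_k(\Gamma\vdash_{ps})=\partial^\epsilon_k(\Gamma\vdash_{ps}x:\ast)$; (pse)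 writing $D^\epsilon=\partial^\epsilon_k(\Gamma\vdash_{ps}x:A)$, the value at $\Gamma,y:A,f:x\to_A y\vdash_{ps}f:x\to_A y$ is $D^\epsilon$ if $\dim A+1>k$; $(D^\epsilon,y:A,f:x\to_A y)$ if $\dim A+1\le k-1$; $D^-$ if $\dim A+1=k$, $\epsilon=-$; and $(\mathrm{rm}\,D^+,y:A)$ if $\dim A+1=k$, $\epsilon=+$, where $\mathrm{rm}$ deletes the last entry of a list. These are pasting contexts, and there are substitutions $\Gamma\vdash s^\Gamma_k:\partial_k^-\Gamma$ and $\Gamma\vdash t^\Gamma_k:\partial_k^+\Gamma$ sending each variable to the variable of the same name. Judgements $\Gamma\vdash$, $\Gamma\vdash A$, $\Gamma\vdash t:A$, $\Delta\vdash\gamma:\Gamma$ (valid context, type, term, substitution) are generated by: $\emptyset\vdash$; if $\Gamma\vdash A$ and $x\notin\mathrm{Var}(\Gamma)$ then $(\Gamma,x:A)\vdash$; if $\Gamma\vdash$ and $(x:A)\in\Gamma$ then $\Gamma\vdash\mathrm{var}\,x:A$; if $\Gamma\vdash$ then $\Gamma\vdash\langle\rangle:\emptyset$; if $\Delta\vdash\gamma:\Gamma$, $(\Gamma,x:A)\vdash$ and $\Delta\vdash t:A[\gamma]$ then $\Delta\vdash\langle\gamma,x\mapsto t\rangle:(\Gamma,x:A)$; if $\Gamma\vdash$ then $\Gamma\vdash\ast$; if $\Gamma\vdash A$, $\Gamma\vdash t:A$, $\Gamma\vdash u:A$ then $\Gamma\vdash t\to_A u$; and (coh): if $\Gamma\vdash_{ps}$,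 $\Gamma\vdash u:A$, $\Gamma\vdash v:A$ and $\Delta\vdash\gamma:\Gamma$ then $\Delta\vdash\mathrm{coh}_{\Gamma,u\to_A v}[\gamma]:(u\to_A v)[\gamma]$, provided that either $\dim\Gamma\ge1$, $\mathrm{Var}(s^\Gamma_{\dim\Gamma-1})=\mathrm{Var}(u)\cup\mathrm{Var}(A)$ and $\mathrm{Var}(t^\Gamma_{\dim\Gamma-1})=\mathrm{Var}(v)\cup\mathrm{Var}(A)$; or $\mathrm{Var}(\Gamma)=\mathrm{Var}(u)\cup\mathrm{Var}(A)=\mathrm{Var}(v)\cup\mathrm{Var}(A)$. All syntax is considered up to $\alpha$-renaming of contexts (including the contexts $\Gamma$ in $\mathrm{coh}_{\Gamma,A}$), e.g. by using De Bruijn indices. The syntactic category $\mathcal S_{\mathrm{CaTT}}$ has valid contexts as objects and substitutions $\Delta\vdash\gamma:\Gamma$ as morphisms $\Delta\to\Gamma$, with composition $\circ$. **Globular sets and Batanin trees.** A globular set $X$ is a family of sets $X_n$ ($n\in\mathbb N$) with functions $\mathrm{src},\mathrm{tgt}\colon X_{n+1}\to X_n$ with $\mathrm{src}\,\mathrm{src}=\mathrm{src}\,\mathrm{tgt}$, $\mathrm{tgt}\,\mathrm{src}=\mathrm{tgt}\,\mathrm{tgt}$; morphisms commute with $\mathrm{src},\mathrm{tgt}$; $\mathrm{gSet}$ is their category. $\mathbb D^0$ is the globular set with a single cell, of dimension $0$. Batanin trees are inductively generated by $\mathrm{br}\colon\mathrm{List}(\mathrm{Bat})\to\mathrm{Bat}$.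 $\dim\mathrm{br}[]=0$, $\dim\mathrm{br}[B_1,\dots,B_n]=\max(\dim B_1+1,\dim\mathrm{br}[B_2,\dots,B_n])$; $\partial_0B=\mathrm{br}[]$, $\partial_{k+1}\mathrm{br}[B_1,\dots,B_n]=\mathrm{br}[\partial_kB_1,\dots,\partial_kB_n]$. The globular set of positions is $\mathrm{Pos}(\mathrm{br}[B_1,\dots,B_n])=\bigvee_{i=1}^n\Sigma\mathrm{Pos}(B_i)$, where the suspension $\Sigma X$ has two $0$-cells $v_-,v_+$ (its first and second basepoints) and $(\Sigma X)_{n+1}=X_n$ with all $1$-cells going from $v_-$ to $v_+$, and $X\vee Y$ identifies the second basepoint of $X$ with the first of $Y$ (empty wedge: $\mathbb D^0$). The maps $s_k^B,t_k^B\colon\mathrm{Pos}(\partial_kB)\to\mathrm{Pos}(B)$ are: $s_0^B,t_0^B\colon\mathbb D^0\to\mathrm{Pos}(B)$ pick the first and second basepoint respectively, and $s_{k+1}^{\mathrm{br}[B_1,\dots,B_n]}=\bigvee_i\Sigma s_k^{B_i}$, $t_{k+1}^{\mathrm{br}[B_1,\dots,B_n]}=\bigvee_i\Sigma t_k^{B_i}$. **Computads.** By mutual induction on $n$ one defines the category $\mathrm{Comp}_n$ of $n$-computads, functors $\mathrm{Free}_n\colon\mathrm{gSet}\to\mathrm{Comp}_n$, $\mathrm{Cell}_n,\mathrm{Sphere}_n\colon\mathrm{Comp}_n\to\mathrm{Set}$, the truncation $\mathrm{tr}_{n-1}\colon\mathrm{Comp}_n\to\mathrm{Comp}_{n-1}$,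 a natural transformation $\mathrm{bdry}\colon\mathrm{Cell}_n\Rightarrow\mathrm{Sphere}_{n-1}\mathrm{tr}_{n-1}$, and subsets $\mathrm{Full}_n(B)\subseteq\mathrm{Sphere}_n(\mathrm{Free}_n\mathrm{Pos}(B))$. $\mathrm{Comp}_{-1}$ is terminal and $\mathrm{Sphere}_{-1}$ picks a one-element set, whose element is full. For $n\ge0$, an $n$-computad $C$ is an $(n-1)$-computad $C_{n-1}$, a set $V_n^C$ of generators and a function $\phi_n^C\colon V_n^C\to\mathrm{Sphere}_{n-1}(C_{n-1})$; a morphism $f\colon C\to D$ is a morphism $f_{n-1}\colon C_{n-1}\to D_{n-1}$ with a function $f_V\colon V_n^C\to\mathrm{Cell}_n(D)$ with $\mathrm{bdry}\circ f_V=\mathrm{Sphere}_{n-1}(f_{n-1})\circ\phi^C_n$. $\mathrm{Cell}_n(C)$ is inductively generated by $\mathrm{var}\,v$ for $v\in V_n^C$ and, when $n>0$, $\mathrm{coh}(B,A,f)$ for $B$ a Batanin tree with $\dim B\le n$, $A\in\mathrm{Full}_{n-1}(B)$ and $f\colon\mathrm{Free}_n\mathrm{Pos}(B)\to C$ a morphism; $\mathrm{bdry}(\mathrm{var}\,v)=\phi_n^C(v)$, $\mathrm{bdry}(\mathrm{coh}(B,A,f))=\mathrm{Sphere}_{n-1}(f_{n-1})(A)$. $\mathrm{Sphere}_n(C)$ is the set of pairs of $n$-cells with equal boundary. Recursively $\mathrm{Cell}_n(g)(\mathrm{var}\,v)=g_V(v)$, $\mathrm{Cell}_n(g)(\mathrm{coh}(B,A,f))=\mathrm{coh}(B,A,g\circ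 f)$, $g\circ f=(g_{n-1}\circ f_{n-1},\mathrm{Cell}_n(g)\circ f_V)$. $\mathrm{Free}_nX$ consists of $\mathrm{Free}_{n-1}X$, the set $X_n$, and $x\mapsto(\mathrm{var}\,\mathrm{src}\,x,\mathrm{var}\,\mathrm{tgt}\,x)$. The support of an $n$-cell is the set of $n$-dimensional generators given by $\mathrm{supp}_n(\mathrm{var}\,v)=\{v\}$, $\mathrm{supp}_n(\mathrm{coh}(B,A,f))=\bigcup_{p\in\mathrm{Pos}_n(B)}\mathrm{supp}_n(f_V(p))$. A sphere $(a,b)\in\mathrm{Sphere}_n(\mathrm{Free}_n\mathrm{Pos}(B))$ is full when $\mathrm{supp}_n(a)$ and $\mathrm{supp}_n(b)$ are precisely the sets of $n$-positions in the images of $s_n^B$ and $t_n^B$ respectively, and the sphere $\mathrm{bdry}(a)$ is full. $\mathrm{Comp}$ is the limit of the categories $\mathrm{Comp}_n$ along the truncations. A computad is finite if the total set of its generators $\coprod_nV_n^C$ is finite. *)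

(* Defs.v *)
From mathcomp Require Import all_boot.
From mathcomp Require Import boolp classical_sets cardinality.

Set Implicit Arguments.
Unset Strict Implicit.
Unset Printing Implicit Defensive.

Local Open Scope classical_set_scope.

Record category := Category {
  obj :> Type;
  hom : obj -> obj -> Type;
  idm : forall a, hom a a;
  cmp : forall a b c, hom b c -> hom a b -> hom a c;
  cmp1m : forall a b (f : hom a b), cmp (idm b) f = f;
  cmpm1 : forall a b (f : hom a b), cmp f (idm a) = f;
  cmpA : forall a b c d (h : hom c d) (g : hom b c) (f : hom a b),
    cmp h (cmp g f) = cmp (cmp h g) f }.

Arguments hom {_} _ _.
Arguments idm {_} _.
Arguments cmp {_ _ _ _} _ _.

Program Definition opposite (C : category) : category := {|
  obj := C;
  hom a b := @hom C b a;
  idm a := idm a;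
  cmp a b c g f := cmp f g |}.
Next Obligation. exact: cmpm1. Qed.
Next Obligation. exact: cmp1m. Qed.
Next Obligation. by rewrite cmpA. Qed.

Program Definition full_subcategory (C : category) (P : C -> Prop) : category := {|
  obj := {a : C | P a};
  hom a b := hom (sval a) (sval b);
  idm a := idm (sval a);
  cmp a b c g f := cmp g f |}.
Next Obligation. exact: cmp1m. Qed.
Next Obligation. exact: cmpm1. Qed.
Next Obligation. exact: cmpA. Qed.

Arguments full_subcategory : clear implicits.

Record functor (C D : category) := Functor {
  fobj :> C -> D;
  fmap : forall a b : C, hom a b -> hom (fobj a) (fobj b);
  fmap1 : forall a, fmap (idm a) = idm (fobj a);
  fmapM : forall a b c (g : hom b c) (f : hom a b),
    fmap (cmp g f) = cmp (fmap g) (fmap f) }.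

Definition functor_id (C : category) : functor C C :=
  @Functor C C id (fun _ _ f => f) (fun=> erefl) (fun _ _ _ _ _ => erefl).

Program Definition functor_comp (C D E : category) (G : functor D E)
  (F : functor C D) : functor C E :=
  {| fobj a := G (F a); fmap a b f := fmap G (fmap F f) |}.
Next Obligation. by rewrite !fmap1. Qed.
Next Obligation. by rewrite !fmapM. Qed.

Record natural_iso (C D : category) (F G : functor C D) := NaturalIso {
  nat_fwd : forall a, hom (F a) (G a);
  nat_bwd : forall a, hom (G a) (F a);
  nat_fwdK : forall a, cmp (nat_bwd a) (nat_fwd a) = idm (F a);
  nat_bwdK : forall a, cmp (nat_fwd a) (nat_bwd a) = idm (G a);
  nat_fwd_natural : forall a b (f : hom a b),
    cmp (nat_fwd b) (fmap F f) = cmp (fmap G f) (nat_fwd a) }.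

Definition equivalent_categories (C D : category) : Prop :=
  exists (F : functor C D) (G : functor D C),
    inhabited (natural_iso (functor_comp G F) (functor_id C)) /\
    inhabited (natural_iso (functor_comp F G) (functor_id D)).

(* Syntax up to alpha-renaming is represented with De Bruijn levels: the      *)
(* variable declared by the i-th entry of a context, counting from 0 at its   *)
(* start, is named i.  Thus the entry that extends Gamma declares the         *)
(* variable len Gamma, which is automatically fresh, and the i-th entry of a  *)
(* substitution is its value at the variable i.  Extending a context does not *)
(* rename its variables, so that no lifting is ever needed.                   *)
Inductive ctx : Type :=
  | CNil
  | CExt of ctx & ty
with ty : Type :=
  | Star
  | Arr of ty & tm & tm                 (* Arr A u v is u ->_A v *)
with tm : Type :=
  | Var of nat
  | Coh of ctx & ty & sub
with sub : Type :=
  | SNil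
  | SExt of sub & tm.

Scheme tm_mut := Induction for tm Sort Prop
with sub_mut := Induction for sub Sort Prop.
Combined Scheme tm_sub_mut from tm_mut, sub_mut.

Fixpoint len (G : ctx) : nat := if G is CExt G' _ then (len G').+1 else 0.

Fixpoint slen (g : sub) : nat := if g is SExt g' _ then (slen g').+1 else 0.

Fixpoint ctx_at (G : ctx) (x : nat) : option ty :=
  if G is CExt G' A then if x == len G' then Some A else ctx_at G' x else None.

Fixpoint sub_at (g : sub) (x : nat) : option tm :=
  if g is SExt g' t then if x == slen g' then Some t else sub_at g' x else None.

Fixpoint tm_sub (t : tm) (d : sub) : tm :=
  match t with
  | Var x => odflt (Var x) (sub_at d x)
  | Coh G A g => Coh G A (sub_comp g d)
  end
with sub_comp (g d : sub) : sub :=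
  match g with
  | SNil => SNil
  | SExt g t => SExt (sub_comp g d) (tm_sub t d)
  end.

Fixpoint ty_sub (A : ty) (d : sub) : ty :=
  match A with
  | Star => Star
  | Arr A u v => Arr (ty_sub A d) (tm_sub u d) (tm_sub v d)
  end.

Definition ctx_vars (G : ctx) : set nat := [set x | x < len G].

Fixpoint tm_vars (t : tm) : set nat :=
  match t with
  | Var x => [set x]
  | Coh _ _ g => sub_vars g
  end
with sub_vars (g : sub) : set nat :=
  match g with
  | SNil => set0
  | SExt g t => sub_vars g `|` tm_vars t
  end.

Fixpoint ty_vars (A : ty) : set nat :=
  match A with
  | Star => set0
  | Arr A u v => ty_vars A `|` tm_vars u `|` tm_vars v
  end.

(* Both dimensions are shifted by one, as they start at -1: ty_dim1 A is      *)
(* dim A + 1 and ctx_dim1 G is dim G + 1.                                     *)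
Fixpoint ty_dim1 (A : ty) : nat := if A is Arr A' _ _ then (ty_dim1 A').+1 else 0.

Fixpoint ctx_dim1 (G : ctx) : nat :=
  if G is CExt G' A then maxn (ctx_dim1 G') (ty_dim1 A).+1 else 0.

(* ps_at G x A is the type of derivations of G |-ps x : A.                    *)
Inductive ps_at : ctx -> nat -> ty -> Type :=
  | pss : ps_at (CExt CNil Star) 0 Star
  | psd G f A x y : ps_at G f (Arr A (Var x) (Var y)) -> ps_at G y A
  | pse G x A : ps_at G x A ->
      let a := Arr A (Var x) (Var (len G)) in
      ps_at (CExt (CExt G A) a) (len G).+1 a.

Inductive ps (G : ctx) : Type := Ps x of ps_at G x Star.

(* The context bd^eps_k G, whose entries keep the names they have in G, is a  *)
(* list of pairs (x, A), growing on the right; eps is true for + and false    *)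
(* for -.                                                                     *)
Fixpoint bd_at (k : nat) (eps : bool) G x A (d : ps_at G x A) : seq (nat * ty) :=
  match d with
  | pss => [:: (0, Star)]
  | psd _ _ _ _ _ d' => bd_at k eps d'
  | @pse G x A d' =>
      let D := bd_at k eps d' in
      let y := len G in
      if k < ty_dim1 A then D
      else if ty_dim1 A < k then
        rcons (rcons D (y, A)) (y.+1, Arr A (Var x) (Var y))
      else if eps then rcons (take (size D).-1 D) (y, A)
      else D
  end.

Definition bd (k : nat) (eps : bool) G (d : ps G) : seq (nat * ty) :=
  let: Ps _ d' := d in bd_at k eps d'.

(* The substitutions s_k (eps = false) and t_k (eps = true) from G to its     *)
(* boundary, mapping each variable to the variable of the same name.          *)
Definition bd_sub (k : nat) (eps : bool) G (d : ps G) : sub :=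
  foldl (fun g xA => SExt g (Var xA.1)) SNil (bd k eps d).

Definition coh_side G (d : ps G) (A : ty) (u v : tm) : Prop :=
  (exists k, [/\ ctx_dim1 G = k.+2,
     sub_vars (bd_sub k false d) = tm_vars u `|` ty_vars A &
     sub_vars (bd_sub k true d) = tm_vars v `|` ty_vars A]) \/
  (ctx_vars G = tm_vars u `|` ty_vars A /\ ctx_vars G = tm_vars v `|` ty_vars A).

Inductive ctx_ok : ctx -> Prop :=
  | ctx_ok_nil : ctx_ok CNil
  | ctx_ok_ext G A : ty_ok G A -> ctx_ok (CExt G A)
with ty_ok : ctx -> ty -> Prop :=
  | ty_ok_star G : ctx_ok G -> ty_ok G Star
  | ty_ok_arr G A t u : ty_ok G A -> tm_ok G t A -> tm_ok G u A ->
      ty_ok G (Arr A t u)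
with tm_ok : ctx -> tm -> ty -> Prop :=
  | tm_ok_var G x A : ctx_ok G -> ctx_at G x = Some A -> tm_ok G (Var x) A
  | tm_ok_coh G (d : ps G) A u v D g :
      tm_ok G u A -> tm_ok G v A -> sub_ok D g G -> coh_side d A u v ->
      tm_ok D (Coh G (Arr A u v) g) (ty_sub (Arr A u v) g)
with sub_ok : ctx -> sub -> ctx -> Prop :=    (* sub_ok D g G is D |- g : G *)
  | sub_ok_nil G : ctx_ok G -> sub_ok G SNil CNil
  | sub_ok_ext D g G A t : sub_ok D g G -> ctx_ok (CExt G A) ->
      tm_ok D t (ty_sub A g) -> sub_ok D (SExt g t) (CExt G A).

Scheme ctx_ok_mut := Minimality for ctx_ok Sort Prop
with ty_ok_mut := Minimality for ty_ok Sort Prop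
with tm_ok_mut := Minimality for tm_ok Sort Prop
with sub_ok_mut := Minimality for sub_ok Sort Prop.
Combined Scheme ok_mut from ctx_ok_mut, ty_ok_mut, tm_ok_mut, sub_ok_mut.

Fixpoint sub_id (G : ctx) : sub :=
  if G is CExt G' _ then SExt (sub_id G') (Var (len G')) else SNil.

Lemma sub_ok_len D g G : sub_ok D g G -> slen g = len G.
Proof. by elim=> //= {}D {}g {}G A t _ ->. Qed.

Lemma sub_ok_src D g G : sub_ok D g G -> ctx_ok D.
Proof. by elim. Qed.

Lemma sub_ok_tgt D g G : sub_ok D g G -> ctx_ok G.
Proof. by case=> // *; exact: ctx_ok_nil. Qed.

Lemma ctx_at_lt G x A : ctx_at G x = Some A -> x < len G.
Proof.
elim: G => //= G IH B; case: eqP => [-> //|_ /IH]; exact: leqW.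
Qed.

Lemma sub_at_lt g x : x < slen g -> exists t, sub_at g x = Some t.
Proof.
elim: g => //= g IH t; case: eqP => [_ _|/eqP nx]; first by exists t.
by rewrite ltnS leq_eqVlt (negPf nx) => /IH.
Qed.

Lemma tm_sub_vars g :
  (forall t, tm_vars t `<=` [set x | x < slen g] ->
     tm_vars (tm_sub t g) `<=` sub_vars g) /\
  (forall h, sub_vars h `<=` [set x | x < slen g] ->
     sub_vars (sub_comp h g) `<=` sub_vars g).
Proof.
apply: tm_sub_mut => //=.
- move=> x /(_ x erefl) /=; elim: g => //= g IH t.
  case: eqP => [_ _|/eqP nx] /=; first by move=> y; right.
  by rewrite ltnS leq_eqVlt (negPf nx) => /IH h y /h; left.
- by move=> _ y [].
- move=> h hh t ht hsub y [/hh|/ht]; apply=> x xv; apply: hsub.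
  + by left.
  + by right.
Qed.

Lemma ty_sub_vars g A : ty_vars A `<=` [set x | x < slen g] ->
  ty_vars (ty_sub A g) `<=` sub_vars g.
Proof.
elim: A => [_ y []|] //= A IH u v hsub y [[/IH|/((tm_sub_vars g).1 _)]|/((tm_sub_vars g).1 _)].
- by apply=> x xv; apply: hsub; left; left.
- by apply=> x xv; apply: hsub; left; right.
- by apply=> x xv; apply: hsub; right.
Qed.

Lemma vars_lt :
  (forall G, ctx_ok G ->
     forall x A, ctx_at G x = Some A -> ty_vars A `<=` ctx_vars G) /\
  (forall G A, ty_ok G A ->
     (forall x B, ctx_at G x = Some B -> ty_vars B `<=` ctx_vars G) /\
     ty_vars A `<=` ctx_vars G) /\
  (forall G t A, tm_ok G t A ->
     tm_vars t `<=` ctx_vars G /\ ty_vars A `<=` ctx_vars G) /\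
  (forall D g G, sub_ok D g G -> sub_vars g `<=` ctx_vars D).
Proof.
apply: ok_mut => //=.
- move=> G A _ [hG hA] x B; case: eqP => [_ [<-]|_ /hG hB] y.
    by move=> /hA; exact: leqW.
  by move=> /hB; exact: leqW.
- by move=> G _ hG; split=> // x [].
- move=> G A t u _ [hG hA] _ [ht _] _ [hu _]; split=> // x.
  by move=> [[/hA|/ht]|/hu].
- move=> G x A _ hG /[dup] /hG hA /ctx_at_lt hx; split=> // y ->.
  exact: hx.
- move=> G d A u v D g _ [hu hA] _ [hv _] /sub_ok_len hlen hg _; split=> //.
  apply: subset_trans hg; apply: (@ty_sub_vars g (Arr A u v)); rewrite hlen.
  by move=> x [[/hA|/hu]|/hv].
- by move=> G _ _ x [].
- by move=> D g G A t _ hg _ _ _ [ht _] x [/hg|/ht].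
Qed.

Lemma ty_ok_vars G A : ty_ok G A -> ty_vars A `<=` ctx_vars G.
Proof. by case/(vars_lt.2.1). Qed.

Lemma sub_comp_len g d : slen (sub_comp g d) = slen g.
Proof. by elim: g => //= g ->. Qed.

(* t[g][d] = t[g o d] may fail at the variables on which g is undefined.      *)
Lemma tm_sub_compE g d :
  (forall t, tm_vars t `<=` [set x | x < slen g] ->
     tm_sub (tm_sub t g) d = tm_sub t (sub_comp g d)) /\
  (forall h, sub_vars h `<=` [set x | x < slen g] ->
     sub_comp (sub_comp h g) d = sub_comp h (sub_comp g d)).
Proof.
apply: tm_sub_mut => //=.
- move=> x /(_ x erefl) /=; elim: g => //= g' IH t; rewrite sub_comp_len.
  by case: eqP => //= /eqP nx; rewrite ltnS leq_eqVlt (negPf nx); exact: IH.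
- by move=> G A h hh hsub; rewrite hh.
- move=> h hh t ht hsub; rewrite hh ?ht // => x xv; apply: hsub.
  + by right.
  + by left.
Qed.

Lemma ty_sub_compE g d A : ty_vars A `<=` [set x | x < slen g] ->
  ty_sub (ty_sub A g) d = ty_sub A (sub_comp g d).
Proof.
elim: A => //= A IH u v hsub.
rewrite IH ?(tm_sub_compE g d).1 // => x xv; apply: hsub.
- by right.
- by left; right.
- by left; left.
Qed.

Lemma ty_sub_comp G A D g d : ty_vars A `<=` ctx_vars G -> sub_ok D g G ->
  ty_sub (ty_sub A g) d = ty_sub A (sub_comp g d).
Proof.
by move=> hA /sub_ok_len hg; apply: ty_sub_compE; rewrite hg.
Qed.

Lemma tm_sub_ext g s :
  (forall t, tm_vars t `<=` [set x | x < slen g] ->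
     tm_sub t (SExt g s) = tm_sub t g) /\
  (forall h, sub_vars h `<=` [set x | x < slen g] ->
     sub_comp h (SExt g s) = sub_comp h g).
Proof.
apply: tm_sub_mut => //=.
- by move=> x /(_ x erefl) /=; case: eqP => // ->; rewrite ltnn.
- by move=> G A h hh hsub; rewrite hh.
- move=> h hh t ht hsub; rewrite hh ?ht // => x xv; apply: hsub.
  + by right.
  + by left.
Qed.

Lemma ty_sub_ext g s A : ty_vars A `<=` [set x | x < slen g] ->
  ty_sub A (SExt g s) = ty_sub A g.
Proof.
elim: A => //= A IH u v hsub.
rewrite IH ?(tm_sub_ext g s).1 // => x xv; apply: hsub.
- by right.
- by left; right.
- by left; left.
Qed.

Lemma weakening :
  (forall G, ctx_ok G -> True) /\
  (forall G A, ty_ok G A -> forall B, ty_ok G B -> ty_ok (CExt G B) A) /\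
  (forall G t A, tm_ok G t A -> forall B, ty_ok G B -> tm_ok (CExt G B) t A) /\
  (forall D g G, sub_ok D g G -> forall B, ty_ok D B -> sub_ok (CExt D B) g G).
Proof.
apply: ok_mut => //.
- by move=> G _ _ B hB; apply: ty_ok_star; apply: ctx_ok_ext.
- move=> G A t u _ hA _ ht _ hu B hB.
  by apply: ty_ok_arr; [apply: hA|apply: ht|apply: hu].
- move=> G x A _ _ hx B hB; apply: tm_ok_var; first exact: ctx_ok_ext.
  by rewrite /= hx; case: eqP (ctx_at_lt hx) => // ->; rewrite ltnn.
- move=> G d A u v D g hu _ hv _ _ hg side B hB.
  by apply: (tm_ok_coh (d := d)) => //; apply: hg.
- by move=> G _ _ B hB; apply: sub_ok_nil; apply: ctx_ok_ext.
- move=> D g G A t _ hg hG _ _ ht B hB.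
  by apply: sub_ok_ext => //; [apply: hg|apply: ht].
Qed.

Lemma ctx_ok_inv G A : ctx_ok (CExt G A) -> ty_ok G A.
Proof. by move=> h; inversion h. Qed.

Lemma ty_ok_ctx G A : ty_ok G A -> ctx_ok G.
Proof. by elim. Qed.

Lemma ctx_at_ok G x A : ctx_ok G -> ctx_at G x = Some A -> ty_ok G A.
Proof.
elim: G => //= G IH B /ctx_ok_inv hB; case: eqP => [_ [<-]|_ hx].
  exact: weakening.2.1.
by apply: weakening.2.1 => //; apply: IH => //; exact: ty_ok_ctx hB.
Qed.

Lemma sub_at_ok D g G x A : sub_ok D g G -> ctx_at G x = Some A ->
  exists2 t, sub_at g x = Some t & tm_ok D t (ty_sub A g).
Proof.
elim=> // {}D {}g {}G B t hg IH /ctx_ok_inv hB ht /=.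
have restr C : ty_ok G C -> ty_sub C (SExt g t) = ty_sub C g.
  by move=> /ty_ok_vars hC; apply: ty_sub_ext; rewrite (sub_ok_len hg).
rewrite (sub_ok_len hg); case: eqP => [_ [<-]|_ hx].
  by exists t; rewrite ?restr.
have [s hs1 hs2] := IH hx; exists s; rewrite ?restr //.
by apply: ctx_at_ok hx; exact: ty_ok_ctx hB.
Qed.

Lemma substitution :
  (forall G, ctx_ok G -> True) /\
  (forall G A, ty_ok G A -> forall D g, sub_ok D g G -> ty_ok D (ty_sub A g)) /\
  (forall G t A, tm_ok G t A -> forall D g, sub_ok D g G ->
     tm_ok D (tm_sub t g) (ty_sub A g)) /\
  (forall G h T, sub_ok G h T -> forall D g, sub_ok D g G ->
     sub_ok D (sub_comp h g) T).
Proof.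
apply: ok_mut => //.
- by move=> G _ _ D g /sub_ok_src hD; exact: ty_ok_star.
- move=> G A t u _ hA _ ht _ hu D g hg /=.
  by apply: ty_ok_arr; [apply: hA|apply: ht|apply: hu].
- by move=> G x A _ _ hx D g /sub_at_ok /(_ hx) [t /= -> ].
- move=> P p A u v G h hu _ hv _ hh IH side D g hg.
  have hA : ty_vars (Arr A u v) `<=` ctx_vars P.
    have [hu1 hA1] := vars_lt.2.2.1 _ _ _ hu.
    have [hv1 _] := vars_lt.2.2.1 _ _ _ hv.
    by move=> x [[/hA1|/hu1]|/hv1].
  rewrite (ty_sub_comp _ hA hh); apply: (tm_ok_coh (d := p)) => //; exact: IH.
- by move=> G _ _ D g /sub_ok_src hD; exact: sub_ok_nil.
- move=> G h T A t hh IH /[dup] hTA /ctx_ok_inv hA _ _ ht D g hg /=.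
  apply: sub_ok_ext => //; first exact: IH.
  by rewrite -(ty_sub_comp _ (ty_ok_vars hA) hh); exact: ht.
Qed.

Lemma sub_id_len G : slen (sub_id G) = len G.
Proof. by elim: G => //= G ->. Qed.

Lemma sub_id_at G x t : sub_at (sub_id G) x = Some t -> t = Var x.
Proof.
by elim: G => //= G IH _; rewrite sub_id_len; case: eqP => [-> [->]|].
Qed.

Lemma tm_sub_id G :
  (forall t, tm_sub t (sub_id G) = t) /\ (forall h, sub_comp h (sub_id G) = h).
Proof.
apply: tm_sub_mut => //= [x|P A g ->|g -> t ->] //.
by case E: (sub_at _ _) => [t|] //=; rewrite (sub_id_at E).
Qed.

Lemma ty_sub_id G A : ty_sub A (sub_id G) = A.
Proof. by elim: A => //= A -> u v; rewrite !(tm_sub_id G).1. Qed.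

Lemma sub_id_ok G : ctx_ok G -> sub_ok G (sub_id G) G.
Proof.
elim: G => [|G IH A] hG /=; first exact: sub_ok_nil.
have hA := ctx_ok_inv hG.
apply: sub_ok_ext => //; first by apply: weakening.2.2.2 => //; apply: IH; exact: ty_ok_ctx hA.
by rewrite ty_sub_id; apply: tm_ok_var; rewrite //= eqxx.
Qed.

Lemma sub_id_comp D g G : sub_ok D g G -> sub_comp (sub_id G) g = g.
Proof.
elim=> //= {}D {}g {}G A t hg IH _ _; rewrite (sub_ok_len hg) eqxx /=.
congr SExt; rewrite -[RHS]IH; apply: (tm_sub_ext g t).2.
have hG := sub_id_ok (sub_ok_tgt hg).
by rewrite (sub_ok_len hg); exact: (vars_lt.2.2.2 _ _ _ hG).
Qed.

Lemma sub_comp_ok D G T g h : sub_ok G h T -> sub_ok D g G ->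
  sub_ok D (sub_comp h g) T.
Proof. by move=> hh; exact: substitution.2.2.2. Qed.

Definition ok_ctx : Type := {G : ctx | ctx_ok G}.

Definition ok_sub (D G : ok_ctx) : Type := {g : sub | sub_ok (sval D) g (sval G)}.

Definition ok_sub_id (G : ok_ctx) : ok_sub G G :=
  exist _ (sub_id (sval G)) (sub_id_ok (svalP G)).

Definition ok_sub_comp (D G T : ok_ctx) (h : ok_sub G T) (g : ok_sub D G) :
    ok_sub D T :=
  exist _ (sub_comp (sval h) (sval g)) (sub_comp_ok (svalP h) (svalP g)).

Lemma ok_sub_id_comp (D G : ok_ctx) (g : ok_sub D G) :
  ok_sub_comp (ok_sub_id G) g = g.
Proof. case: g => g gg; apply: eq_exist; exact: sub_id_comp gg. Qed.

Lemma ok_sub_comp_id (D G : ok_ctx) (g : ok_sub D G) :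
  ok_sub_comp g (ok_sub_id D) = g.
Proof. case: g => g gg; apply: eq_exist; exact: (tm_sub_id _).2. Qed.

Lemma ok_sub_compA (D G T U : ok_ctx) (k : ok_sub T U) (h : ok_sub G T)
    (g : ok_sub D G) :
  ok_sub_comp k (ok_sub_comp h g) = ok_sub_comp (ok_sub_comp k h) g.
Proof.
apply: eq_exist => /=; rewrite (tm_sub_compE _ _).2 //.
by rewrite (sub_ok_len (svalP h)); exact: (vars_lt.2.2.2 _ _ _ (svalP k)).
Qed.

Definition S_CaTT : category :=
  Category ok_sub_id_comp ok_sub_comp_id ok_sub_compA.

Record gset := GSet {
  gcell :> nat -> Type;
  src : forall n, gcell n.+1 -> gcell n;
  tgt : forall n, gcell n.+1 -> gcell n;
  src_tgt : forall n (x : gcell n.+2), src (src x) = src (tgt x);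
  tgt_src : forall n (x : gcell n.+2), tgt (tgt x) = tgt (src x) }.

Arguments src {_ _} _.
Arguments tgt {_ _} _.

Record gmap (X Y : gset) := GMap {
  gfun :> forall n, X n -> Y n;
  gfun_src : forall n (x : X n.+1), gfun (src x) = src (gfun x);
  gfun_tgt : forall n (x : X n.+1), gfun (tgt x) = tgt (gfun x) }.

Definition D0_cell (n : nat) : Type := if n is _.+1 then void else unit.

Program Definition D0 : gset := {|
  gcell := D0_cell;
  src n (x : void) := of_void _ x;
  tgt n (x : void) := of_void _ x |}.

Record bgset := BGSet { bcar :> gset; fst_pt : bcar 0; snd_pt : bcar 0 }.

Record bmap (X Y : bgset) := BMap {
  bfun :> gmap X Y;
  bfun_fst : bfun 0 (fst_pt X) = fst_pt Y;
  bfun_snd : bfun 0 (snd_pt X) = snd_pt Y }.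

Definition bD0 : bgset := @BGSet D0 tt tt.

(* The wedge Sigma X \/ Y.  Its 0-cells are None, which is the point v_- of   *)
(* Sigma X, and those of Y; the point v_+ of Sigma X is identified with the   *)
(* first basepoint of Y.                                                      *)
Section SuspWedge.
Variables (X : gset) (Y : bgset).

Definition sw_cell (n : nat) : Type :=
  if n is n'.+1 then (X n' + Y n'.+1)%type else option (Y 0).

Definition sw_src (n : nat) : sw_cell n.+1 -> sw_cell n :=
  match n with
  | 0 => fun c => match c with inl _ => None | inr y => Some (src y) end
  | n'.+1 => fun c => match c with inl x => inl (src x) | inr y => inr (src y) end
  end.

Definition sw_tgt (n : nat) : sw_cell n.+1 -> sw_cell n :=
  match n with
  | 0 => fun c => match c with inl _ => Some (fst_pt Y) | inr y => Some (tgt y) end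
  | n'.+1 => fun c => match c with inl x => inl (tgt x) | inr y => inr (tgt y) end
  end.

Lemma sw_src_tgt n (c : sw_cell n.+2) : sw_src (sw_src c) = sw_src (sw_tgt c).
Proof. by case: n c => [|n] [x|y] //=; rewrite src_tgt. Qed.

Lemma sw_tgt_src n (c : sw_cell n.+2) : sw_tgt (sw_tgt c) = sw_tgt (sw_src c).
Proof. by case: n c => [|n] [x|y] //=; rewrite tgt_src. Qed.

Definition susp_wedge : bgset :=
  @BGSet (GSet sw_src_tgt sw_tgt_src) None (Some (snd_pt Y)).

End SuspWedge.

Section SuspWedgeMap.
Variables (X X' : gset) (Y Y' : bgset) (f : gmap X X') (g : bmap Y Y').

Definition sw_fun (n : nat) : susp_wedge X Y n -> susp_wedge X' Y' n :=
  match n with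
  | 0 => omap (g 0)
  | n'.+1 => fun c => match c with inl x => inl (f n' x) | inr y => inr (g n'.+1 y) end
  end.

Lemma sw_fun_src n (c : susp_wedge X Y n.+1) : sw_fun (src c) = src (sw_fun c).
Proof. by case: n c => [|n] [x|y] //=; rewrite gfun_src. Qed.

Lemma sw_fun_tgt n (c : susp_wedge X Y n.+1) : sw_fun (tgt c) = tgt (sw_fun c).
Proof. by case: n c => [|n] [x|y] //=; rewrite ?gfun_tgt ?bfun_fst. Qed.

Program Definition susp_wedge_map : bmap (susp_wedge X Y) (susp_wedge X' Y') :=
  @BMap _ _ (GMap sw_fun_src sw_fun_tgt) _ _.
Next Obligation. by rewrite bfun_snd. Qed.

End SuspWedgeMap.

Inductive bat : Type := Br of seq bat.

Fixpoint bat_dim (B : bat) : nat :=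
  let: Br Bs := B in foldr (fun B' d => maxn (bat_dim B').+1 d) 0 Bs.

Fixpoint bat_bd (k : nat) (B : bat) : bat :=
  let: Br Bs := B in if k is k'.+1 then Br (map (bat_bd k') Bs) else Br [::].

Fixpoint pos (B : bat) : bgset :=
  let: Br Bs := B in foldr (fun B' Y => susp_wedge (pos B') Y) bD0 Bs.

Program Definition pick_pt (X : gset) (x : X 0) : gmap D0 X := {|
  gfun n := match n return D0 n -> X n with
            | 0 => fun=> x
            | _.+1 => of_void _
            end |}.
Next Obligation. by case: x0. Qed.
Next Obligation. by case: x0. Qed.

Definition bD0_id : bmap bD0 bD0 :=
  @BMap bD0 bD0 (@GMap D0 D0 (fun _ => id) (fun _ _ => erefl) (fun _ _ => erefl))
    erefl erefl.

(* The maps s_k (eps = false) and t_k (eps = true) from Pos(bd_k B) to Pos(B). *)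
Fixpoint bat_inc (eps : bool) (k : nat) : forall B, gmap (pos (bat_bd k B)) (pos B) :=
  match k with
  | 0 => fun B =>
      let: Br Bs := B in pick_pt (if eps then snd_pt (pos (Br Bs)) else fst_pt (pos (Br Bs)))
  | k'.+1 => fun B =>
      let: Br Bs := B in
      (fix go Bs : bmap (pos (Br (map (bat_bd k') Bs))) (pos (Br Bs)) :=
         match Bs with
         | [::] => bD0_id
         | B' :: Bs' => susp_wedge_map (bat_inc eps k' B') (go Bs')
         end) Bs
  end.

(* The data of the mutual induction defining computads.  As levels start at   *)
(* -1, a stage of index m consists of the data at level m - 1: the category   *)
(* Comp_(m-1), the functor Sphere_(m-1), the objects Free_(m-1) X and the     *)
(* subsets Full_(m-1)(B).  The field pole X x is the sphere                   *)
(* (var (src x), var (tgt x)) of Free_(m-1) X.                                *)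
Record stage (m : nat) := Stage {
  cpt : category;
  sphere : cpt -> Type;
  sph_map : forall C D : cpt, hom C D -> sphere C -> sphere D;
  sph_map1 : forall C (s : sphere C), sph_map (idm C) s = s;
  sph_mapM : forall C D E (g : hom D E) (f : hom C D) (s : sphere C),
    sph_map (cmp g f) s = sph_map g (sph_map f s);
  free : gset -> cpt;
  pole : forall X : gset, X m -> sphere (free X);
  pole_glob : forall (X : gset) (x : X m.+1), pole (src x) = pole (tgt x);
  full : forall B : bat, sphere (free (pos B)) -> Prop }.

Arguments sphere {_ _} _.
Arguments sph_map {_ _ _ _} _ _.
Arguments free {_} _ _.
Arguments pole {_} _ {_} _.
Arguments full {_} _ {_} _.

Program Definition terminal_category : category := {|
  obj := unit;
  hom _ _ := unit;
  idm _ := tt;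
  cmp _ _ _ _ _ := tt |}.
Next Obligation. by case: f. Qed.
Next Obligation. by case: f. Qed.

Program Definition stage0 : stage 0 := {|
  cpt := terminal_category;
  sphere _ := unit;
  sph_map _ _ _ s := s;
  free _ := tt;
  pole _ _ := tt;
  full _ _ := True |}.

Section NextStage.
Variables (m : nat) (S : stage m).

(* As S is at level m - 1, the objects formed here are the m-computads.       *)
Record ncomp := NComp {
  base : cpt S;
  gen : Type;
  attach : gen -> sphere base }.

Definition nfree (X : gset) : ncomp :=
  @NComp (free S X) (X m) (fun x => pole S x).

(* Cell_m(C) and the boundary function on it are defined together.  This      *)
(* induction-recursion is encoded by first forming all the expressions, on    *)
(* which the boundary makes sense, and then carving out the cells: in         *)
(* pcoh B A f fV the pair (f, fV) is a morphism from Free_m Pos(B) to C.      *)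
Inductive precell (C : ncomp) : Type :=
  | pvar of gen C
  | pcoh (B : bat) (A : sphere (free S (pos B))) (f : hom (free S (pos B)) (base C))
      (fV : pos B m -> precell C).

Definition prebdry (C : ncomp) (c : precell C) : sphere (base C) :=
  match c with
  | pvar v => attach v
  | pcoh B A f _ => sph_map f A
  end.

Fixpoint is_cell (C : ncomp) (c : precell C) : Prop :=
  match c with
  | pvar _ => True
  | pcoh B A f fV =>
      [/\ 0 < m, bat_dim B <= m, full S A, forall p, is_cell (fV p)
        & forall p, prebdry (fV p) = sph_map f (pole S p)]
  end.

Definition cell (C : ncomp) : Type := {c : precell C | is_cell c}.

Lemma cell_eq (C : ncomp) (c d : cell C) : sval c = sval d -> c = d.
Proof. by case: c d => [c cc] [d dc] /= cd; exact: eq_exist. Qed.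

Definition bdry (C : ncomp) (c : cell C) : sphere (base C) := prebdry (sval c).

Definition cvar (C : ncomp) (v : gen C) : cell C := exist _ (pvar v) I.

Record nhom (C D : ncomp) := NHom {
  nbase : hom (base C) (base D);
  ngen : gen C -> cell D;
  ngen_bdry : forall v, bdry (ngen v) = sph_map nbase (attach v) }.

Program Definition ccoh (C : ncomp) (m_gt0 : 0 < m) (B : bat) (dimB : bat_dim B <= m)
    (A : sphere (free S (pos B))) (fullA : full S A)
    (f : nhom (nfree (pos B)) C) : cell C :=
  exist _ (pcoh A (nbase f) (fun p => sval (ngen f p))) _.
Next Obligation.
split=> // p; [exact: svalP (ngen f p)|exact: (ngen_bdry f p)].
Qed.

Lemma cell_var_coh_ind (C : ncomp) (P : cell C -> Prop) :
  (forall v, P (cvar v)) ->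
  (forall m_gt0 B dimB A fullA (f : nhom (nfree (pos B)) C),
     (forall p, P (ngen f p)) -> P (ccoh m_gt0 dimB (A := A) fullA f)) ->
  forall c, P c.
Proof.
move=> Pvar Pcoh [c]; elim: c => [v|B A f fV IH] /=.
  by case; exact: Pvar.
move=> /[dup] [[m_gt0 dimB fullA fVc fVb]] cc.
pose h : nhom (nfree (pos B)) C :=
  @NHom (nfree (pos B)) C f (fun p => exist _ (fV p) (fVc p)) fVb.
have := Pcoh m_gt0 B dimB A fullA h (fun p => IH p (fVc p)).
by congr P; apply: eq_exist.
Qed.

Fixpoint precell_map (C D : ncomp) (g : nhom C D) (c : precell C) : precell D :=
  match c with
  | pvar v => sval (ngen g v)
  | pcoh B A f fV => pcoh A (cmp (nbase g) f) (fun p => precell_map g (fV p))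
  end.

Lemma prebdry_map (C D : ncomp) (g : nhom C D) (c : precell C) :
  prebdry (precell_map g c) = sph_map (nbase g) (prebdry c).
Proof. by case: c => [v|B A f fV] /=; [exact: ngen_bdry|rewrite sph_mapM]. Qed.

Lemma is_cell_map (C D : ncomp) (g : nhom C D) (c : precell C) :
  is_cell c -> is_cell (precell_map g c).
Proof.
elim: c => [v _|B A f fV IH] /=; first exact: svalP (ngen g v).
move=> [? ? ? fVc fVb]; split=> // p; first exact: IH.
by rewrite prebdry_map fVb sph_mapM.
Qed.

Definition cell_map (C D : ncomp) (g : nhom C D) (c : cell C) : cell D :=
  exist _ (precell_map g (sval c)) (is_cell_map g (svalP c)).

Lemma bdry_map (C D : ncomp) (g : nhom C D) (c : cell C) :
  bdry (cell_map g c) = sph_map (nbase g) (bdry c).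
Proof. exact: prebdry_map. Qed.

Lemma nhom_eq (C D : ncomp) (f g : nhom C D) :
  nbase f = nbase g -> ngen f = ngen g -> f = g.
Proof.
case: f g => [f fV fb] [g gV gb] /= fg fgV; subst g gV.
by rewrite (Prop_irrelevance fb gb).
Qed.

Program Definition nhom_id (C : ncomp) : nhom C C :=
  @NHom C C (idm (base C)) (@cvar C) _.
Next Obligation. by rewrite sph_map1. Qed.

Program Definition nhom_comp (C D E : ncomp) (g : nhom D E) (f : nhom C D) :
    nhom C E :=
  @NHom C E (cmp (nbase g) (nbase f)) (fun v => cell_map g (ngen f v)) _.
Next Obligation. by rewrite bdry_map ngen_bdry sph_mapM. Qed.

Lemma cell_map1 (C : ncomp) (c : cell C) : cell_map (nhom_id C) c = c.
Proof.
case: c => c cc; apply: eq_exist => /=; elim: c {cc} => //= B A f fV IH.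
by rewrite cmp1m; congr pcoh; apply/funext.
Qed.

Lemma cell_mapM (C D E : ncomp) (g : nhom D E) (f : nhom C D) (c : cell C) :
  cell_map (nhom_comp g f) c = cell_map g (cell_map f c).
Proof.
case: c => c cc; apply: eq_exist => /=; elim: c {cc} => //= B A h hV IH.
by rewrite cmpA; congr pcoh; apply/funext.
Qed.

Program Definition ncomp_category : category := {|
  obj := ncomp;
  hom := nhom;
  idm := nhom_id;
  cmp := nhom_comp |}.
Next Obligation.
by apply: nhom_eq => /=; [exact: cmp1m|apply/funext => v; exact: cell_map1].
Qed.
Next Obligation.
by apply: nhom_eq => /=; [exact: cmpm1|apply/funext => v; exact: cell_eq].
Qed.
Next Obligation.
by apply: nhom_eq => /=; [exact: cmpA|apply/funext => v; rewrite cell_mapM].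
Qed.

Definition nsphere (C : ncomp) : Type :=
  {ab : cell C * cell C | bdry ab.1 = bdry ab.2}.

Lemma nsphere_eq (C : ncomp) (s t : nsphere C) : sval s = sval t -> s = t.
Proof. by case: s t => [s sc] [t tc] /= st; exact: eq_exist. Qed.

Program Definition nsph_map (C D : ncomp) (g : nhom C D) (s : nsphere C) :
    nsphere D :=
  exist _ (cell_map g (sval s).1, cell_map g (sval s).2) _.
Next Obligation. by rewrite !bdry_map (svalP s). Qed.

Program Definition npole (X : gset) (x : X m.+1) : nsphere (nfree X) :=
  exist _ (cvar (C := nfree X) (src x), cvar (C := nfree X) (tgt x)) _.
Next Obligation. exact: pole_glob. Qed.

Fixpoint presupp (C : ncomp) (c : precell C) : set (gen C) :=
  match c with
  | pvar v => [set v]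
  | pcoh B A f fV => \bigcup_p presupp (fV p)
  end.

Definition supp (C : ncomp) (c : cell C) : set (gen C) := presupp (sval c).

Definition nfull (B : bat) (s : nsphere (nfree (pos B))) : Prop :=
  [/\ supp (sval s).1 = range (bat_inc false m B m),
      supp (sval s).2 = range (bat_inc true m B m)
    & full S (bdry (sval s).1)].

Program Definition next_stage : stage m.+1 := {|
  cpt := ncomp_category;
  sphere := nsphere;
  sph_map := nsph_map;
  free := nfree;
  pole := npole;
  full := nfull |}.
Next Obligation.
by apply: nsphere_eq => /=; rewrite !cell_map1 -surjective_pairing.
Qed.
Next Obligation. by apply: nsphere_eq => /=; rewrite !cell_mapM. Qed.
Next Obligation. by apply: nsphere_eq; rewrite /= src_tgt tgt_src. Qed.

End NextStage.

Fixpoint level (m : nat) : stage m :=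
  if m is m'.+1 then next_stage (level m') else stage0.

(* Comp is the strict limit of the categories Comp_n along the truncations:   *)
(* its objects and morphisms are compatible families, where compatibility of  *)
(* morphisms is up to transport along that of the objects.                    *)
Record computad := Computad {
  trunc : forall m, cpt (level m);
  trunc_base : forall m, base (trunc m.+1) = trunc m }.

Definition hom_cast (C : category) (a a' b b' : C) (ea : a = a') (eb : b = b')
    (f : hom a b) : hom a' b' :=
  match ea in _ = a1, eb in _ = b1 return hom a1 b1 with erefl, erefl => f end.

Record computad_hom (C D : computad) := ComputadHom {
  hom_trunc : forall m, hom (trunc C m) (trunc D m);
  hom_trunc_base : forall m,
    hom_cast (trunc_base C m) (trunc_base D m) (nbase (hom_trunc m.+1)) = hom_trunc m }.

Lemma computad_hom_eq (C D : computad) (f g : computad_hom C D) :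
  (forall m, hom_trunc f m = hom_trunc g m) -> f = g.
Proof.
case: f g => [f fb] [g gb] /= fg.
have {}fg : f = g by apply: functional_extensionality_dep.
by subst g; rewrite (Prop_irrelevance fb gb).
Qed.

Lemma hom_cast1 (C : category) (a a' : C) (e : a = a') : hom_cast e e (idm a) = idm a'.
Proof. by case: a' / e. Qed.

Lemma hom_castM (C : category) (a a' b b' c c' : C) (ea : a = a') (eb : b = b')
    (ec : c = c') (g : hom b c) (f : hom a b) :
  hom_cast ea ec (cmp g f) = cmp (hom_cast eb ec g) (hom_cast ea eb f).
Proof. by case: a' / ea; case: b' / eb; case: c' / ec. Qed.

Program Definition computad_id (C : computad) : computad_hom C C :=
  @ComputadHom C C (fun m => idm (trunc C m)) _.
Next Obligation. exact: hom_cast1. Qed.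

Program Definition computad_comp (C D E : computad) (g : computad_hom D E)
    (f : computad_hom C D) : computad_hom C E :=
  @ComputadHom C E (fun m => cmp (hom_trunc g m) (hom_trunc f m)) _.
Next Obligation.
apply: etrans (hom_castM _ (trunc_base D m) _ _ _) _.
by rewrite !hom_trunc_base.
Qed.

Program Definition Comp : category := {|
  obj := computad;
  hom := computad_hom;
  idm := computad_id;
  cmp := computad_comp |}.
Next Obligation. by apply: computad_hom_eq => m /=; exact: cmp1m. Qed.
Next Obligation. by apply: computad_hom_eq => m /=; exact: cmpm1. Qed.
Next Obligation. by apply: computad_hom_eq => m /=; exact: cmpA. Qed.

(* trunc C n.+1 is the underlying n-computad of C.                            *)
Definition generator (C : computad) (n : nat) : Type := gen (trunc C n.+1).

Definition finite_computad (C : computad) : Prop :=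
  finite_set [set: {n : nat & generator C n}].

(* Main.v *)
From Stdlib Require Eqdep_dec PeanoNat.
From mathcomp Require Import all_boot zify.
From mathcomp Require Import boolp classical_sets cardinality.
Require Import Defs.

(* Terms of CaTT are read off the cells of a computad whose generators are    *)
(* named by the variables of a context: a generator is sent to its variable   *)
(* and coh(B, A, f) to coh over the pasting context of the tree B, with the   *)
(* values of f as substitution.  This is injective, and compatible with       *)
(* composition.  It is onto the well-typed terms because the side condition   *)
(* of the rule (coh) amounts to fullness.  In one direction, every position   *)
(* of dimension k is in the k-source, or is the target of a position of the   *)
(* boundary.  In the other, the source of a cell must avoid the targets of    *)
(* the generators of the cell; this follows from Stokes' formula, where cells *)
(* are counted with multiplicity, applied to the indicator of the positions   *)
(* that are parallel to a given one and come after it.                        *)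
(*   Homomorphisms between computads so become substitutions.  It remains to  *)
(* see that the generators of every finite computad can be listed in a        *)
(* context, by increasing dimension, and that every context comes from a      *)
(* computad, built one dimension at a time.                                   *)

Set Implicit Arguments.
Unset Strict Implicit.
Unset Printing Implicit Defensive.

Local Open Scope classical_set_scope.

(** A context presents a computad when its variables name the generators and the type of each
    variable translates the attaching sphere ([presentation]). Along such namings cells become
    terms, spheres become types, and homomorphisms become substitutions in the opposite direction.
    The translation turns the action of a homomorphism into a substitution ([translate_natural]) and
    loses nothing ([translate_inj]), since pasting contexts are exactly the contexts of trees
    ([ps_bctx]) and determine them ([bctx_inj]). By [equivalence_of_correspondence] it remains to
    reach every valid substitution and to find a partner for every object.

    Reaching the substitutions is [soundness] together with [completeness], and both rest on
    comparing fullness with the side condition of the rule (coh). In terms of positions, the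
    variables of the k-boundary are all those of dimension below k and the [extremal] ones of
    dimension k ([bd_sub_bctx]), and the extremal ones form the image of s_k or t_k ([range_inc]).
    Fullness constrains the support in every dimension of the iterated boundary, whereas the side
    condition constrains a single set of variables. From fullness to the side condition, closure of
    this set under boundaries is enough ([total_vars_full]). Conversely ([bdset_full]), an end of a
    cell must miss nothing ([total_vars_sub]) and must avoid the opposite ends of the supporting
    positions ([supp_end_disjoint]). The latter is an acyclicity statement, obtained from Stokes'
    formula ([weigh_bdry]) with a weight that jumps exactly across one class of parallel positions.

    Partners exist because a finite computad can be listed by increasing dimension ([gen_ctx_ok])
    and because the types of a context translate back to attaching spheres ([sphere_of_ty]). *)

(** * Equivalences of categories from correspondences of objects *)

(** Choosing partners gives functors both ways, and the natural isomorphisms are the images of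
    identities between two partners of one object. [P] is valued in [Type] because a correspondence
    is data on which [psi] depends. *)
Lemma equivalence_of_correspondence (A B : category) (P : A -> B -> Type)
    (psi : forall a b a' b' (p : P a b) (p' : P a' b'), hom b b' -> hom a a') :
  (forall a, exists b, inhabited (P a b)) ->
  (forall b, exists a, inhabited (P a b)) ->
  (forall a b (p : P a b), psi _ _ _ _ p p (idm b) = idm a) ->
  (forall a b a' b' a'' b'' (p : P a b) (p' : P a' b') (p'' : P a'' b'')
     (g : hom b' b'') (f : hom b b'),
     psi _ _ _ _ p p'' (cmp g f) = cmp (psi _ _ _ _ p' p'' g) (psi _ _ _ _ p p' f)) ->
  (forall a b a' b' (p : P a b) (p' : P a' b'), injective (psi _ _ _ _ p p')) ->
  (forall a b a' b' (p : P a b) (p' : P a' b') f, exists g, psi _ _ _ _ p p' g = f) ->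
  equivalent_categories A B.
Proof.
move=> exB exA psi1 psiM psi_inj psi_surj.
have psi' a b a' b' (p : P a b) (p' : P a' b') f : {g | psi _ _ _ _ p p' g = f}.
  exact: constructive_indefinite_description.
pose phi a b a' b' (p : P a b) (p' : P a' b') f := sval (psi' a b a' b' p p' f).
have psiK a b a' b' (p : P a b) (p' : P a' b') f : psi _ _ _ _ p p' (phi _ _ _ _ p p' f) = f.
  exact: svalP (psi' a b a' b' p p' f).
have phi1 a b (p : P a b) : phi _ _ _ _ p p (idm a) = idm b.
  by apply: (psi_inj _ _ _ _ p p); rewrite psiK psi1.
have phiM a b a' b' a'' b'' (p : P a b) (p' : P a' b') (p'' : P a'' b'')
     (g : hom a' a'') (f : hom a a') :
     phi _ _ _ _ p p'' (cmp g f) = cmp (phi _ _ _ _ p' p'' g) (phi _ _ _ _ p p' f).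
  by apply: (psi_inj _ _ _ _ p p''); rewrite (psiM _ _ _ _ _ _ p p' p'') !psiK.
have toB a : {b : B & P a b}.
  apply: (@inhabited_witness _).
  by have [b [p]] := exB a; constructor; exists b.
have toA b : {a : A & P a b}.
  apply: (@inhabited_witness _).
  by have [a [p]] := exA b; constructor; exists a.
pose p a := projT2 (toB a); pose q b := projT2 (toA b).
pose F : functor A B := @Functor A B (fun a => projT1 (toB a))
  (fun a a' f => phi _ _ _ _ (p a) (p a') f) (fun a => phi1 _ _ _)
  (fun a b c g f => phiM _ _ _ _ _ _ _ _ _ g f).
pose G : functor B A := @Functor B A (fun b => projT1 (toA b))
  (fun b b' f => psi _ _ _ _ (q b) (q b') f) (fun b => psi1 _ _ _)
  (fun a b c g f => psiM _ _ _ _ _ _ _ _ _ g f).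
exists F, G; split; constructor.
- apply: (@NaturalIso A A (functor_comp G F) (functor_id A)
    (fun a => psi _ _ _ _ (q (F a)) (p a) (idm (F a)))
    (fun a => psi _ _ _ _ (p a) (q (F a)) (idm (F a)))).
  + by move=> a; rewrite -psiM cmp1m psi1.
  + by move=> a; rewrite -psiM cmp1m psi1.
  + by move=> a b f /=; rewrite -psiM cmp1m -[in RHS](psiK _ _ _ _ (p a) (p b) f) -psiM cmpm1.
- apply: (@NaturalIso B B (functor_comp F G) (functor_id B)
    (fun b => phi _ _ _ _ (p (G b)) (q b) (idm (G b)))
    (fun b => phi _ _ _ _ (q b) (p (G b)) (idm (G b)))).
  + by move=> a; rewrite -phiM cmp1m phi1.
  + by move=> a; rewrite -phiM cmp1m phi1.
  + move=> a b f /=; rewrite -phiM cmp1m.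
    have -> : f = phi _ _ _ _ (q a) (q b) (psi _ _ _ _ (q a) (q b) f).
      by apply: (psi_inj _ _ _ _ (q a) (q b)); rewrite psiK.
    by rewrite -phiM cmpm1; congr phi; rewrite psiK.
Qed.

(** * Pasting contexts of trees *)

(* A tree is either empty or has a first branch B and a remainder Br Bs, *)
(* which is how Pos is computed.                                         *)
Section BatRect.
Variables (P : bat -> Type) (Pnil : P (Br [::]))
  (Pcons : forall B Bs, P B -> P (Br Bs) -> P (Br (B :: Bs))).

Fixpoint bat_rec2 (B : bat) : P B :=
  match B with
  | Br Bs =>
    (fix go Bs : P (Br Bs) :=
       match Bs with
       | [::] => Pnil
       | B' :: Bs' => Pcons (bat_rec2 B') (go Bs')
       end) Bs
  end.
End BatRect.

Arguments bat_rec2 : simpl never.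

Definition bat_ind2 (P : bat -> Prop) := @bat_rec2 P.

(* The state of a traversal of a tree that produces its pasting context: the *)
(* context built so far and the last variable of the current type A.         *)
Definition trav : bat -> ty -> ctx -> nat -> ctx * nat :=
  bat_rec2 (P := fun=> ty -> ctx -> nat -> (ctx * nat)%type)
    (fun A G x => (G, x))
    (fun B Bs tB tBs A G x =>
       let a := Arr A (Var x) (Var (len G)) in
       tBs A (tB a (CExt (CExt G A) a) (len G).+1).1 (len G)).

Lemma trav_cons B Bs A G x :
  let a := Arr A (Var x) (Var (len G)) in
  trav (Br (B :: Bs)) A G x =
  trav (Br Bs) A (trav B a (CExt (CExt G A) a) (len G).+1).1 (len G).
Proof. by []. Qed.

Definition bctx (B : bat) : ctx := (trav B Star (CExt CNil Star) 0).1.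

(** Repeats the traversal of [trav]: for each branch it adds y and f. The first basepoint of the
    branch is named f, that of the remaining branches is named y. *)
Definition trav_var : forall B : bat, ty -> ctx -> nat -> forall k, pos B k -> nat :=
  bat_rec2 (P := fun B => ty -> ctx -> nat -> forall k, pos B k -> nat)
    (fun A G x k _ => x)
    (fun B Bs nB nBs A G x =>
       let a := Arr A (Var x) (Var (len G)) in
       let G' := CExt (CExt G A) a in
       let G1 := (trav B a G' (len G).+1).1 in
       fun k => match k return pos (Br (B :: Bs)) k -> nat with
       | 0 => fun p : option (pos (Br Bs) 0) =>
           if p is Some q then nBs A G1 (len G) 0 q else x
       | k'.+1 => fun p : (pos B k' + pos (Br Bs) k'.+1)%type =>
           match p with
           | inl q => nB a G' (len G).+1 k' q
           | inr q => nBs A G1 (len G) k'.+1 q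
           end
       end).

Arguments trav_var B A G x {k} p : rename, simpl never.
Arguments trav : simpl never.

Section TravVarCons.
Variables (B : bat) (Bs : seq bat) (A : ty) (G : ctx) (x : nat).
Let a := Arr A (Var x) (Var (len G)).
Let G' := CExt (CExt G A) a.
Let G1 := (trav B a G' (len G).+1).1.

Lemma trav_var_cons :
  ((trav_var (Br (B :: Bs)) A G x (k := 0) None = x) *
  (forall q : pos (Br Bs) 0, trav_var (Br (B :: Bs)) A G x (k := 0) (Some q) =
     trav_var (Br Bs) A G1 (len G) q) *
  (forall k (q : pos B k), trav_var (Br (B :: Bs)) A G x (k := k.+1) (inl q) =
     trav_var B a G' (len G).+1 q) *
  (forall k (q : pos (Br Bs) k.+1), trav_var (Br (B :: Bs)) A G x (k := k.+1) (inr q) =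
     trav_var (Br Bs) A G1 (len G) q))%type.
Proof. by []. Qed.

End TravVarCons.

Definition pname (B : bat) : forall k, pos B k -> nat :=
  fun k => trav_var B Star (CExt CNil Star) 0.

Arguments pname B {k} p : rename.

Definition ctx_le (G H : ctx) : Prop :=
  len G <= len H /\ forall x, x < len G -> ctx_at H x = ctx_at G x.

Lemma ctx_le_trans G H K : ctx_le G H -> ctx_le H K -> ctx_le G K.
Proof.
move=> [GH aGH] [HK aHK]; split; first exact: leq_trans HK.
by move=> x xG; rewrite aHK ?aGH //; exact: leq_trans GH.
Qed.

Lemma ctx_le_ext G A : ctx_le G (CExt G A).
Proof. by split=> //= x; case: eqP => // ->; rewrite ltnn. Qed.

Lemma ctx_le_ext2 G A B : ctx_le G (CExt (CExt G A) B).
Proof. exact: ctx_le_trans (ctx_le_ext _ _) (ctx_le_ext _ _). Qed.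

Lemma trav_le B A G x : ctx_le G (trav B A G x).1.
Proof.
elim/bat_ind2: B A G x => // B Bs IHB IHBs A G x; rewrite trav_cons.
by apply: ctx_le_trans (IHBs _ _ _); apply: ctx_le_trans (IHB _ _ _); exact: ctx_le_ext2.
Qed.

Lemma trav_ps B A G x : ps_at G x A -> ps_at (trav B A G x).1 (trav B A G x).2 A.
Proof.
elim/bat_rec2: B A G x => // B Bs IHB IHBs A G x d; rewrite trav_cons.
apply: IHBs; have d' := IHB _ _ _ (pse d); exact: psd d'.
Qed.

Definition bctx_ps B : ps (bctx B) := Ps (trav_ps B pss).

Lemma trav_var_fst B A G x : trav_var B A G x (fst_pt (pos B)) = x.
Proof. by case: B => [[|B Bs]]. Qed.

(** Separates the names used by the first branch, by the remaining branches and by the start, which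
    makes the naming injective. *)
Lemma trav_var_bound B A G x k (p : pos B k) :
  trav_var B A G x p = x \/ len G <= trav_var B A G x p < len (trav B A G x).1.
Proof.
elim/bat_ind2: B A G x k p => [|B Bs IHB IHBs] A G x k p; first by left.
rewrite trav_cons; set a := Arr _ _ _; set G' := CExt _ _.
have le1 := (trav_le B a G' (len G).+1).1.
have le2 := (trav_le (Br Bs) A (trav B a G' (len G).+1).1 (len G)).1.
have le3 : (len G).+2 <= len G' by [].
case: k p => [|k] [p|]; rewrite ?trav_var_cons.
- right; case: (IHBs A (trav B a G' (len G).+1).1 (len G) 0 p) => [->|/andP[h1 h2]].
    by rewrite leqnn (leq_trans _ le2) // (leq_trans _ le1).
  rewrite h2 andbT (leq_trans _ h1) // (leq_trans _ le1) //; exact: ltnW.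
- by left.
- right; case: (IHB a G' (len G).+1 k p) => [->|/andP[h1 h2]].
    by rewrite leqnSn (leq_trans _ le2) // (leq_trans _ le1).
  rewrite (leq_trans _ le2) // andbT (leq_trans _ h1) //=; exact: ltnW.
- move=> p; rewrite trav_var_cons; right; case: (IHBs A (trav B a G' (len G).+1).1 (len G) k.+1 p) => [->|/andP[h1 h2]].
    by rewrite leqnn (leq_trans _ le2) // (leq_trans _ le1).
  rewrite h2 andbT (leq_trans _ h1) // (leq_trans _ le1) //; exact: ltnW.
Qed.

Lemma trav_var_lt B A G x k (p : pos B k) : x < len G ->
  trav_var B A G x p < len (trav B A G x).1.
Proof.
move=> xG; case: (trav_var_bound A G x p) => [->|/andP[]//].
exact: leq_trans xG (trav_le _ _ _ _).1.
Qed.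

Lemma trav_var_inj B A G x k (p : pos B k) l (q : pos B l) : x < len G ->
  trav_var B A G x p = trav_var B A G x q -> existT (pos B) k p = existT (pos B) l q.
Proof.
elim/bat_ind2: B A G x k p l q => [|B Bs IHB IHBs] A G x k p l q xG.
  by case: k p l q => [[]|k []] [[]|l []].
pose a := Arr A (Var x) (Var (len G)); pose G' := CExt (CExt G A) a; pose G1 := (trav B a G' (len G).+1).1.
have le3 : (len G).+2 <= len G' by [].
have le1 : len G' <= len G1 := (trav_le B a G' (len G).+1).1.
have yG1 : len G < len G1 by apply: leq_trans le1; exact: ltnW.
have bB j r : len G < trav_var B a G' (len G).+1 (k := j) r < len G1.
  case: (trav_var_bound a G' (len G).+1 r) => [->|/andP[h1 h2]].
    by rewrite ltnSn (leq_trans _ le1).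
  by rewrite h2 andbT; apply: leq_trans h1; exact: ltnW.
have bBs j r : trav_var (Br Bs) A G1 (len G) (k := j) r = len G \/
    len G1 <= trav_var (Br Bs) A G1 (len G) (k := j) r.
  by case: (trav_var_bound A G1 (len G) r) => [|/andP[]]; [left|right].
have xBs j r : trav_var (Br Bs) A G1 (len G) (k := j) r <> x.
  move=> E; case: (bBs j r); rewrite E => h.
    by rewrite h ltnn in xG.
  by have := leq_ltn_trans h (ltn_trans xG yG1); rewrite ltnn.
have xB j r : trav_var B a G' (len G).+1 (k := j) r <> x.
  by move=> E; have := bB j r; rewrite E => /andP[/ltnW]; rewrite leqNgt xG.
have BBs j r j' r' : trav_var B a G' (len G).+1 (k := j) r =
    trav_var (Br Bs) A G1 (len G) (k := j') r' -> False.
  move=> E; have /andP[h1 h2] := bB j r; rewrite E in h1 h2.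
  by case: (bBs j' r') => h; [rewrite h ltnn in h1|rewrite ltnNge h in h2].
have lG' : (len G).+1 < len G' by [].
pose fS (z : {k & pos (Br Bs) k}) : {k & pos (Br (B :: Bs)) k} :=
  match z with existT k p => match k return pos (Br Bs) k -> {k & pos (Br (B :: Bs)) k} with
   | 0 => fun p => existT (pos (Br (B :: Bs))) 0 (Some p)
   | k'.+1 => fun p => existT (pos (Br (B :: Bs))) k'.+1 (inr p) end p end.
pose fB (z : {k & pos B k}) : {k & pos (Br (B :: Bs)) k} :=
  match z with existT k p => existT (pos (Br (B :: Bs))) k.+1 (inl p) end.
case: k p => [|k] [p|]; case: l q => [|l] [q|]; rewrite ?trav_var_cons -/a -/G' -/G1 //.
- by move=> /(IHBs _ _ _ _ _ _ _ yG1) /(congr1 fS).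
- by move=> /xBs.
- by move=> /esym/BBs.
- by move=> q; rewrite ?trav_var_cons -/a -/G' -/G1 => /(IHBs _ _ _ _ _ _ _ yG1) /(congr1 fS).
- by move=> /esym/xBs.
- by move=> /esym/xB.
- by move=> q; rewrite ?trav_var_cons -/a -/G' -/G1 => /esym/xBs.
- by move=> /BBs.
- by move=> /xB.
- by move=> /(IHB _ _ _ _ _ _ _ lG') /(congr1 fB).
- by move=> q; rewrite ?trav_var_cons -/a -/G' -/G1 => /BBs.
- by move=> p; rewrite ?trav_var_cons -/a -/G' -/G1 => /(IHBs _ _ _ _ _ _ _ yG1) /(congr1 fS).
- by move=> p; rewrite ?trav_var_cons -/a -/G' -/G1 => /xBs.
- by move=> p; rewrite ?trav_var_cons -/a -/G' -/G1 => /esym/BBs.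
- by move=> p q; rewrite ?trav_var_cons => /(IHBs _ _ _ _ _ _ _ yG1) /(congr1 fS).
Qed.

Lemma trav_var_surj B A G x z : x < len G -> len G <= z < len (trav B A G x).1 ->
  exists k (p : pos B k), trav_var B A G x p = z.
Proof.
elim/bat_ind2: B A G x => [|B Bs IHB IHBs] A G x xG.
  by move=> /andP[h1 h2]; have := leq_ltn_trans h1 h2; rewrite ltnn.
rewrite trav_cons; set a := Arr _ _ _; set G' := CExt _ _; set G1 := (trav B a G' _).1.
have le1 : len G' <= len G1 := (trav_le B a G' (len G).+1).1.
have yG1 : len G < len G1 by apply: leq_trans le1; exact: ltnW.
move=> /andP[h1 h2].
have [hz|hz] := leqP (len G1) z.
  have [|k [p <-]] := IHBs A G1 (len G) yG1; first by rewrite hz.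
  case: k p => [|k] p; first by exists 0, (Some p).
  by exists k.+1, (inr p).
have [hz'|] := leqP (len G') z.
  have [||k [p <-]] := IHB a G' (len G).+1; [exact: ltnSn|by rewrite hz'|].
  by exists k.+1, (inl p).
rewrite /= ltnS leq_eqVlt => /predU1P[->|].
  by exists 1, (inl (fst_pt (pos B))); exact: trav_var_fst.
rewrite ltnS => h3; have {h1 h3} -> : z = len G by apply/eqP; rewrite eqn_leq h1 h3.
by exists 0, (Some (fst_pt (pos (Br Bs)))); exact: trav_var_fst.
Qed.

Fixpoint cell_ty (X : gset) (nm : forall k, X k -> nat) (A : ty) k : X k -> ty :=
  match k with
  | 0 => fun=> A
  | _.+1 => fun x => Arr (cell_ty nm A (src x)) (Var (nm _ (src x))) (Var (nm _ (tgt x)))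
  end.

Lemma trav_var_at B A G x k (p : pos B k) : x < len G -> ctx_at G x = Some A ->
  ctx_at (trav B A G x).1 (trav_var B A G x p) =
  Some (cell_ty (@trav_var B A G x) A p).
Proof.
elim/bat_ind2: B A G x k p => [|B Bs IHB IHBs] A G x k p xG GxA.
  by case: k p => [|k] [].
rewrite trav_cons; set a := Arr _ _ _; set G' := CExt _ _; set G1 := (trav B a G' _).1.
have leB : ctx_le G' G1 := trav_le B a G' (len G).+1.
have yG1 : len G < len G1 by apply: leq_trans leB.1; exact: ltnW.
have leBs := trav_le (Br Bs) A G1 (len G).
have ayG' : ctx_at G' (len G) = Some A by rewrite /= ltn_eqF // eqxx.
have ayG1 : ctx_at G1 (len G) = Some A by rewrite leB.2 //=; exact: ltnW.
have eS : forall k (q : pos (Br Bs) k),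
    cell_ty (@trav_var (Br Bs) A G1 (len G)) A q =
    cell_ty (@trav_var (Br (B :: Bs)) A G x) A
     (match k return pos (Br Bs) k -> pos (Br (B :: Bs)) k with
      | 0 => fun q => Some q | k'.+1 => fun q => inr q end q).
  by elim=> //= j IH q; rewrite IH; case: j q {IH}.
(* Suspension shifts the dimension: a 0-position of [B] is a 1-cell from v_- to v_+, and [a] is its
   type. *)
have eB : forall k (q : pos B k),
    cell_ty (@trav_var B a G' (len G).+1) a q =
    cell_ty (@trav_var (Br (B :: Bs)) A G x) A (inl q : pos (Br (B :: Bs)) k.+1).
  elim=> [|j IH] q; last by rewrite /= in IH *; rewrite IH.
  by rewrite /= !trav_var_cons -/a -/G' -/G1 trav_var_fst.
have hS j (q : pos (Br Bs) j) := IHBs A G1 (len G) j q yG1 ayG1.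
have hB j (q : pos B j) : ctx_at (trav (Br Bs) A G1 (len G)).1
    (trav_var B a G' (len G).+1 q) = Some (cell_ty (@trav_var B a G' (len G).+1) a q).
  have lG' : (len G).+1 < len G' by [].
  rewrite leBs.2; last exact: trav_var_lt.
  by apply: IHB => //=; rewrite eqxx.
case: k p => [|k] [p|]; rewrite ?trav_var_cons -/a -/G' -/G1.
- by rewrite (hS 0 p).
- rewrite leBs.2; last exact: ltn_trans yG1.
  rewrite leB.2; last by rewrite ltnW // ltnW.
  by rewrite (ctx_le_ext2 _ _ _).2.
- by rewrite (hB _ p) eB.
- by move=> p; rewrite trav_var_cons -/a -/G' -/G1 (hS _ p) eS.
Qed.

Lemma pname_lt B k (p : pos B k) : pname B p < len (bctx B).
Proof. exact: trav_var_lt. Qed.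

Lemma pname_inj B k (p : pos B k) l (q : pos B l) :
  pname B p = pname B q -> existT (pos B) k p = existT (pos B) l q.
Proof. exact: trav_var_inj. Qed.

Lemma existT_pos_inj B k (p q : pos B k) :
  existT (pos B) k p = existT (pos B) k q -> p = q.
Proof. by move=> E; exact: (Eqdep_dec.inj_pair2_eq_dec _ PeanoNat.Nat.eq_dec _ _ _ _ E). Qed.

Lemma pname_inj_dim B k (p q : pos B k) : pname B p = pname B q -> p = q.
Proof. by move/pname_inj/existT_pos_inj. Qed.

Lemma pname_surj B z : z < len (bctx B) -> exists k (p : pos B k), pname B p = z.
Proof.
case: z => [_|z zB].
  by exists 0, (fst_pt (pos B)); exact: trav_var_fst.
by apply: trav_var_surj => //; rewrite zB.
Qed.

Lemma pname_at B k (p : pos B k) :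
  ctx_at (bctx B) (pname B p) = Some (cell_ty (@pname B) Star p).
Proof. exact: trav_var_at. Qed.

Lemma cell_ty_dim (X : gset) nm k (p : X k) : ty_dim1 (cell_ty nm Star p) = k.
Proof. by elim: k p => //= k IH p; rewrite IH. Qed.

Lemma ps_at_ok G x A : ps_at G x A -> ctx_ok G /\ ctx_at G x = Some A.
Proof.
elim=> {G x A} [|G f A x y _ [hG hf]|G x A _ [hG hx]].
- split=> //; apply: ctx_ok_ext; apply: ty_ok_star; exact: ctx_ok_nil.
- split=> //; have hA := ctx_at_ok hG hf; inversion hA; subst.
  by match goal with h : tm_ok _ (Var y) _ |- _ => inversion h; subst end.
- have hA := ctx_at_ok hG hx.
  split; last by rewrite /= eqxx.
  apply: ctx_ok_ext; apply: ty_ok_arr.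
  + exact: weakening.2.1.
  + by apply: weakening.2.2.1 => //; exact: tm_ok_var.
  + by apply: tm_ok_var; [exact: ctx_ok_ext|rewrite /= eqxx].
Qed.

Lemma bctx_ok B : ctx_ok (bctx B).
Proof. by case: (bctx_ps B) => x /ps_at_ok []. Qed.

(* A partial derivation of a pasting context is a zipper of trees: at each   *)
(* depth below the current variable, the branches completed so far.          *)
Inductive ps_zip : ctx -> nat -> ty -> Prop :=
  | ps_zip0 Bs : let r := trav (Br Bs) Star (CExt CNil Star) 0 in ps_zip r.1 r.2 Star
  | ps_zip1 G x A Bs : ps_zip G x A ->
      let a := Arr A (Var x) (Var (len G)) in
      let r := trav (Br Bs) a (CExt (CExt G A) a) (len G).+1 in ps_zip r.1 r.2 a.

(** Trees are consumed from the left, whereas a derivation completes branches on the right. *)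
Lemma trav_rcons B Bs A G x :
  trav (Br (rcons Bs B)) A G x =
  let r := trav (Br Bs) A G x in
  let a := Arr A (Var r.2) (Var (len r.1)) in
  ((trav B a (CExt (CExt r.1 A) a) (len r.1).+1).1, len r.1).
Proof. by elim: Bs G x => //= B' Bs IH G x; rewrite !trav_cons IH. Qed.

(** The rule [pse] opens an empty tree over the current variable; [psd] closes the innermost tree,
    which becomes the last branch one level below. *)
Lemma ps_at_zip G x A : ps_at G x A -> ps_zip G x A.
Proof.
elim=> {G x A} [|G f A x y _ IH|G x A _ IH].
- exact: (ps_zip0 [::]).
- have eqa : Arr A (Var x) (Var y) = Arr A (Var x) (Var y) by [].
  inversion IH as [|G' x' A' Bs z E1 E2 [E3 E4 E5]]; subst => {IH eqa}.
  inversion z; subst.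
    have := ps_zip0 (rcons Bs0 (Br Bs)).
    by cbv zeta; rewrite trav_rcons.
  have := ps_zip1 (rcons Bs0 (Br Bs)) H.
  by cbv zeta; rewrite trav_rcons.
- exact: (ps_zip1 [::] IH).
Qed.

Lemma ps_bctx G : ps G -> exists B, G = bctx B.
Proof.
case=> x /ps_at_zip h; inversion h; exists (Br Bs); reflexivity.
Qed.

Fixpoint ctx_dims (G : ctx) : seq nat :=
  if G is CExt G' A then rcons (ctx_dims G') (ty_dim1 A) else [::].

Definition bat_dims : bat -> nat -> seq nat :=
  bat_rec2 (P := fun=> nat -> seq nat) (fun=> [::])
    (fun B Bs dB dBs d => d :: d.+1 :: dB d.+1 ++ dBs d).

Lemma bat_dims_cons B Bs d :
  bat_dims (Br (B :: Bs)) d = d :: d.+1 :: bat_dims B d.+1 ++ bat_dims (Br Bs) d.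
Proof. by []. Qed.

Lemma ctx_dims_trav B A G x :
  ctx_dims (trav B A G x).1 = ctx_dims G ++ bat_dims B (ty_dim1 A).
Proof.
elim/bat_ind2: B A G x => [|B Bs IHB IHBs] A G x; first by rewrite cats0.
by rewrite trav_cons bat_dims_cons IHBs IHB /= -!cats1 -!catA /=.
Qed.

(** A nonempty tree at depth [d] starts with the entry [d], so a suffix that is empty or starts
    below [d] marks where the tree ends. *)
Lemma bat_dims_inj B B' d s s' : all [pred x | x < d] (take 1 s) ->
  all [pred x | x < d] (take 1 s') ->
  bat_dims B d ++ s = bat_dims B' d ++ s' -> B = B' /\ s = s'.
Proof.
elim/bat_ind2: B B' d s s' => [|B Bs IHB IHBs] [[|B' Bs']] d s s'; rewrite ?bat_dims_cons //=.
- by case: s => //= x s; rewrite take0 andbT => xd _ [E]; rewrite E ltnn in xd.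
- by case: s' => //= x s' _; rewrite take0 andbT => xd [E]; rewrite -E ltnn in xd.
- move=> hs hs' [] E; rewrite -!catA in E.
  have hd C t : all [pred x | x < d] (take 1 t) ->
      all [pred x | x < d.+1] (take 1 (bat_dims C d ++ t)).
    case: C => [[|C Cs]]; rewrite ?bat_dims_cons /=; last by rewrite ltnSn ?take0.
    by case: t => //= y t; rewrite ?take0 /= !andbT; exact: leqW.
  have [-> E'] := IHB _ _ _ _ (hd (Br Bs) _ hs) (hd (Br Bs') _ hs') E.
  by have [[->] ->] := IHBs _ _ _ _ hs hs' E'.
Qed.

Lemma bctx_inj B B' : bctx B = bctx B' -> B = B'.
Proof.
move=> /(congr1 ctx_dims); rewrite /bctx !ctx_dims_trav /= => [[]] E.
by have [] // := @bat_dims_inj B B' 0 [::] [::]; rewrite ?cats0.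
Qed.

Lemma pos_dim_le B k : pos B k -> k <= bat_dim B.
Proof.
elim/bat_ind2: B k => [|B Bs IHB IHBs] k; first by case: k.
rewrite [bat_dim _]/(maxn (bat_dim B).+1 (bat_dim (Br Bs))) leq_max.
case: k => [|k] // [p|p]; first by rewrite ltnS IHB.
by rewrite (IHBs _ p) orbT.
Qed.

Lemma pos_dim_max B : exists p : pos B (bat_dim B), True.
Proof.
elim/bat_ind2: B => [|B Bs [p _] [q _]]; first by exists tt.
rewrite [bat_dim (Br _)]/(maxn (bat_dim B).+1 (bat_dim (Br Bs))).
have [h|h] := leqP (bat_dim (Br Bs)) (bat_dim B).+1.
  by exists (inl p).
by case: (bat_dim (Br Bs)) q h => // n q _; exists (inr q).
Qed.

Lemma ctx_at_dim G x A : ctx_at G x = Some A -> ty_dim1 A < ctx_dim1 G.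
Proof.
by elim: G => //= G IH B; case: eqP => [_ [->]|_ /IH h]; rewrite leq_max ?leqnn ?h ?orbT.
Qed.

Lemma ctx_dim_at G d : ctx_dim1 G = d.+1 ->
  exists x A, ctx_at G x = Some A /\ ty_dim1 A = d.
Proof.
elim: G => //= G IH B; rewrite /maxn; case: ifP => _ => [[<-]|/IH [x [A [hx hA]]]].
  by exists (len G), B; rewrite eqxx.
exists x, A; case: eqP => // E; by have := ctx_at_lt hx; rewrite E ltnn.
Qed.

Lemma ctx_dim_bctx B : ctx_dim1 (bctx B) = (bat_dim B).+1.
Proof.
have [p _] := pos_dim_max B.
have := ctx_at_dim (pname_at p); rewrite cell_ty_dim.
case E : (ctx_dim1 _) => [|d] // h; congr S.
have [x [A [hx hA]]] := ctx_dim_at E.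
have [k [q eq]] := pname_surj (ctx_at_lt hx).
move: hx; rewrite -eq pname_at => -[hqA]; rewrite -hqA cell_ty_dim in hA.
apply/eqP; rewrite eqn_leq; apply/andP; split=> //; by rewrite -hA pos_dim_le.
Qed.

(** * Boundaries of pasting diagrams *)

Definition bdp (eps : bool) (X : gset) n (p : X n.+1) : X n :=
  if eps then tgt p else src p.

(** An intrinsic description of the positions on the [eps]-boundary in their own dimension; the
    agreement with the inclusions is [range_inc]. *)
Definition extremal (eps : bool) (X : gset) n (p : X n) : Prop :=
  forall q : X n.+1, p <> bdp (~~ eps) q.

Lemma bdp_glob eps eps' (X : gset) n (p : X n.+2) : bdp eps (bdp eps' p) = bdp eps (bdp (~~ eps') p).
Proof. by case: eps; case: eps'; rewrite /bdp /= ?src_tgt ?tgt_src. Qed.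

Section BdpSuspWedge.
Variables (eps : bool) (X : gset) (Y : bgset).

Lemma bdp_inl n (q : X n.+1) :
  bdp eps (inl q : susp_wedge X Y n.+2) = inl (bdp eps q).
Proof. by case: eps. Qed.

Lemma bdp_inr n (q : Y n.+2) :
  bdp eps (inr q : susp_wedge X Y n.+2) = inr (bdp eps q).
Proof. by case: eps. Qed.

Lemma bdp_inr0 (q : Y 1) : bdp eps (inr q : susp_wedge X Y 1) = Some (bdp eps q).
Proof. by case: eps. Qed.

End BdpSuspWedge.

Lemma range_inc_subset eps k B p : extremal eps (bat_inc eps k B k p).
Proof.
elim: k B p => [|k IH].
  elim/bat_ind2 => [|B Bs _ IHBs] p q; first by case: q.
  case: p => /=; case: eps IHBs q => /= IHBs; case=> //= q; try by [].
  by move=> [E]; exact: (IHBs tt q E).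
elim/bat_ind2 => [|B Bs _ IHBs] p q; first by case: q.
case: p => p; case: q => q; rewrite ?bdp_inl ?bdp_inr => // -[].
- exact: IH.
- exact: IHBs.
Qed.

Lemma range_inc_superset eps k B p : extremal eps p -> exists p', bat_inc eps k B k p' = p.
Proof.
elim: k B p => [|k IH].
  elim/bat_ind2 => [|B Bs _ IHBs] p hp; first by exists tt; case: p {hp}; case: eps.
  exists tt; case: eps IHBs hp => /= IHBs; case: p => [p|] hp //.
  - have [|[] /= ->] := IHBs p => //; move=> q E; apply: (hp (inr q)); by rewrite bdp_inr0 E.
  - by case: (hp (inl (fst_pt (pos B)))).
  - have [|[] /= E] := IHBs p; first by move=> q E; apply: (hp (inr q)); rewrite E.
    by case: (hp (inl (fst_pt (pos B)))); rewrite -E.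
elim/bat_ind2 => [|B Bs _ IHBs] p hp; first by case: p {hp}.
case: p hp => p hp.
- have [|p' <-] := IH B p; last by exists (inl p').
  by move=> q E; apply: (hp (inl q)); rewrite ?bdp_inl ?bdp_inr -E.
- have [|p' <-] := IHBs p; last by exists (inr p').
  by move=> q E; apply: (hp (inr q)); rewrite ?bdp_inl ?bdp_inr -E.
Qed.

Lemma range_inc eps k B : range (bat_inc eps k B k) = [set p | extremal eps p].
Proof.
apply/seteqP; split=> p /=; first by move=> [p' _ <-]; exact: range_inc_subset.
by move=> /range_inc_superset[p' <-]; exists p'.
Qed.

(** Acyclicity: in a wedge of suspensions the 1-cells all go from left to right, and higher cells
    stay inside one summand. *)
Lemma pos_rank eps B k : exists r : pos B k -> nat,
  forall p : pos B k.+1, r (bdp eps p) < r (bdp (~~ eps) p).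
Proof.
elim/bat_ind2: B k => [|B Bs IHB IHBs] [|k]; try by exists (fun=> 0); case.
- have [r hr] := IHBs 0; case: (eps) hr => hr.
  + exists (fun q : option (pos (Br Bs) 0) => if q is Some q then r q else (r (fst_pt (pos (Br Bs)))).+1).
    by case=> [p|p] //=; exact: hr.
  + exists (fun q : option (pos (Br Bs) 0) => if q is Some q then (r q).+1 else 0).
    by case=> [p|p] //=; exact: hr.
- have [r hr] := IHB k; have [s hs] := IHBs k.+1.
  exists (fun q : (pos B k + pos (Br Bs) k.+1)%type => match q with inl q => r q | inr q => s q end).
  case=> p; [have := hr p|have := hs p]; by case: (eps).
Qed.

(** Induction on the rank: a position that is not extremal is the far end of some [q] whose near end
    has smaller rank. *)
Lemma pos_descent eps B k (P : pos B k -> Prop) :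
  (forall p, extremal eps p -> P p) ->
  (forall q : pos B k.+1, P (bdp eps q) -> P (bdp (~~ eps) q)) -> forall p, P p.
Proof.
move=> Pext Pstep p; have [r hr] := pos_rank eps B k.
have [n] := ubnP (r p); elim: n p => // n IH p hp.
case: (pselect (exists q : pos B k.+1, p = bdp (~~ eps) q)) => [[q E]|nE].
  by rewrite E; apply: Pstep; apply: IH; apply: leq_trans (hr q) _; rewrite -E.
by apply: Pext => q E; apply: nE; exists q.
Qed.

(** Passing from one end of a higher cell to the other preserves the boundary, so [pos_descent]
    applies. *)
Lemma extremal_parallel eps eps' B k (p : pos B k.+1) :
  exists q : pos B k.+1, extremal eps q /\ bdp eps' q = bdp eps' p.
Proof.
elim/(@pos_descent eps): p => [p hp|q [q' [hq' E]]]; first by exists p.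
by exists q'; split=> //; rewrite E bdp_glob.
Qed.

(** By acyclicity, moving back from [p] through consecutive cells must stop at an end that is
    extremal. *)
Lemma extremal_source eps B k (p : pos B k.+1) :
  exists q : pos B k.+1, extremal eps (bdp eps q).
Proof.
suff h : forall x : pos B k, (exists q : pos B k.+1, x = bdp eps q) ->
    exists q : pos B k.+1, extremal eps (bdp eps q) by apply: (h (bdp eps p)); exists p.
elim/(@pos_descent eps) => [x hx [q E]|q IH _]; first by exists q; rewrite -E.
by apply: IH; exists q.
Qed.

Definition parallel (X : gset) n : X n -> X n -> Prop :=
  match n with
  | 0 => fun _ _ => True
  | _.+1 => fun p q => src p = src q /\ tgt p = tgt q
  end.

(* The weight w is the indicator of the cells parallel to and after tgt z. *)
Lemma upset_weight B k (z : pos B k.+1) : exists w : pos B k -> nat,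
  [/\ forall q, w q <= `[< parallel q (tgt z) >], w (tgt z) = 1 &
      forall z', w (tgt z') = w (src z') + `[< parallel z' z >]].
Proof.
(* The added clause, vanishing at the first basepoint in dimension 0, allows extension by 0 to the
   point that a wedge adds on the left. *)
suff : exists w : pos B k -> nat,
  [/\ forall q, w q <= `[< parallel q (tgt z) >], w (tgt z) = 1,
      forall z', w (tgt z') = w (src z') + `[< parallel z' z >] &
      match k return (pos B k -> nat) -> Prop with 0 => fun w => w (fst_pt (pos B)) = 0 | _ => fun=> True end w].
  by move=> [w []]; exists w.
elim/bat_ind2: B k z => [|B Bs IHB IHBs] [|k]; try by case.
- case=> z.
  + exists (fun q : option (pos (Br Bs) 0) => if q is Some _ then 1 else 0); split=> //.
      by move=> [q|] /=; rewrite asboolT.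
    move=> [z'|z'] /=; first by rewrite asboolT.
    by rewrite asboolF // => -[].
  + have [w [w1 w2 w3 w4]] := IHBs 0 z.
    exists (fun q : option (pos (Br Bs) 0) => if q is Some q then w q else 0); split=> //.
      by move=> [q|] //=; exact: w1.
    move=> [z'|z'] /=; first by rewrite asboolF ?addn0 // => -[].
    rewrite w3; congr (_ + nat_of_bool _); apply: asbool_equiv_eq.
    by split=> -[h1 h2]; split; [congr Some|congr Some|case: h1|case: h2].
- case=> z.
  + have [w [w1 w2 w3 w4]] := IHB k z.
    exists (fun q : (pos B k + pos (Br Bs) k.+1)%type => if q is inl q then w q else 0); split=> //.
      move=> [q|q] //=; apply: leq_trans (w1 _) _.
      case: asboolP => // h; rewrite asboolT //.
      by case: k q z {w w1 w2 w3 w4} h => [|k] q z //= [-> ->].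
    move=> [z'|z'] /=; last first.
      by rewrite asboolF // => -[]; case: k z' z {w w1 w2 w3 w4}.
    rewrite w3; congr (_ + nat_of_bool _); apply: asbool_equiv_eq => /=.
    by split=> -[h1 h2]; split; [congr inl|congr inl|case: h1|case: h2].
  + have [w [w1 w2 w3 w4]] := IHBs k.+1 z.
    exists (fun q : (pos B k + pos (Br Bs) k.+1)%type => if q is inr q then w q else 0); split=> //.
      move=> [q|q] //=; apply: leq_trans (w1 _) _.
      case: asboolP => // h; rewrite asboolT //.
      by case: k q z {w w1 w2 w3 w4} h => [|k] q z //= [-> ->].
    move=> [z'|z'] /=; first by rewrite asboolF // => -[].
    rewrite w3; congr (_ + nat_of_bool _); apply: asbool_equiv_eq => /=.
    by split=> -[h1 h2]; split; [congr inr|congr inr|case: h1|case: h2].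
Qed.

(** * Weighted sums over positions *)

Definition psum : forall B k, (pos B k -> nat) -> nat :=
  bat_rec2 (P := fun B => forall k, (pos B k -> nat) -> nat)
    (fun k => match k return (pos (Br [::]) k -> nat) -> nat with
              | 0 => fun g => g tt | _.+1 => fun=> 0 end)
    (fun B Bs sB sBs k => match k return (pos (Br (B :: Bs)) k -> nat) -> nat with
       | 0 => fun g => g None + sBs 0 (fun y => g (Some y))
       | k'.+1 => fun g => sB k' (fun x => g (inl x)) + sBs k'.+1 (fun y => g (inr y))
       end).

Arguments psum : clear implicits.
Arguments psum : simpl never.

Lemma psum_cons0 B Bs (g : pos (Br (B :: Bs)) 0 -> nat) :
  psum (Br (B :: Bs)) 0 g = g None + psum (Br Bs) 0 (fun y => g (Some y)).
Proof. by []. Qed.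

Lemma psum_consS B Bs k (g : pos (Br (B :: Bs)) k.+1 -> nat) :
  psum (Br (B :: Bs)) k.+1 g =
  psum B k (fun x => g (inl x)) + psum (Br Bs) k.+1 (fun y => g (inr y)).
Proof. by []. Qed.

Lemma eq_psum B k g h : g =1 h -> psum B k g = psum B k h.
Proof. by move=> gh; congr psum; apply/funext. Qed.

Lemma psumD B k g h : psum B k (fun p => g p + h p) = psum B k g + psum B k h.
Proof.
elim/bat_ind2: B k g h => [|B Bs IHB IHBs] [|k] g h //.
- by rewrite !psum_cons0 IHBs; lia.
by rewrite !psum_consS IHBs IHB; lia.
Qed.

Lemma psum_gt0 B k g p : 0 < g p -> 0 < psum B k g.
Proof.
elim/bat_ind2: B k g p => [|B Bs IHB IHBs] [|k] g; [by case|by case|case=> [p|]|case=> p].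
- by rewrite psum_cons0 addn_gt0 => gp; rewrite (IHBs 0 (fun y => g (Some y)) p) ?orbT.
- by rewrite psum_cons0 addn_gt0 => ->.
- by rewrite psum_consS addn_gt0 => gp; rewrite (IHB k (fun y => g (inl y)) p).
- by rewrite psum_consS addn_gt0 => gp; rewrite (IHBs k.+1 (fun y => g (inr y)) p) ?orbT.
Qed.

Definition bdsum (eps : bool) B k (g : pos B k -> nat) : nat :=
  psum (bat_bd k B) k (fun p => g (bat_inc eps k B k p)).

Lemma bdsum0 eps B (g : pos B 0 -> nat) :
  bdsum eps g = g (if eps then snd_pt (pos B) else fst_pt (pos B)).
Proof. by case: B g. Qed.

Lemma bdsum_nilS eps k (g : pos (Br [::]) k.+1 -> nat) : bdsum eps g = 0.
Proof. by []. Qed.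

Lemma bdsum_cons eps k B Bs (g : pos (Br (B :: Bs)) k.+1 -> nat) :
  bdsum eps g = bdsum eps (fun x : pos B k => g (inl x)) +
    bdsum eps (fun y : pos (Br Bs) k.+1 => g (inr y)).
Proof. by []. Qed.

(** The inner ends of the cells on the (k+1)-boundary cancel, leaving the k-target minus the
    k-source; terms are moved across to stay in [nat]. *)
Lemma bdsum_telescope eps B k (w : pos B k -> nat) :
  bdsum eps (fun p : pos B k.+1 => w (tgt p)) + bdsum false w =
  bdsum eps (fun p : pos B k.+1 => w (src p)) + bdsum true w.
Proof.
elim: k B w => [|k IH] B w.
  elim/bat_ind2: B w => [|B Bs _ IHBs] w; first by rewrite !bdsum_nilS !bdsum0.
  have := IHBs (fun q => w (Some q)).
  rewrite !bdsum_cons !bdsum0 /=; lia.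
elim/bat_ind2: B w => [|B Bs _ IHBs] w; first by rewrite !bdsum_nilS.
have add4 (a b c d a' b' c' d' : nat) : a + b = c + d -> a' + b' = c' + d' ->
  a + a' + (b + b') = c + c' + (d + d') by lia.
rewrite !bdsum_cons; exact: add4 (IH B (fun q => w (inl q))) (IHBs (fun q => w (inr q))).
Qed.

Lemma psum_bdsum eps B k (g : pos B k -> nat) : bat_dim B <= k -> psum B k g = bdsum eps g.
Proof.
elim: k B g => [|k IH] B g.
  case: B g => [[|B Bs]] g; last by rewrite [bat_dim _]/(maxn (bat_dim B).+1 (bat_dim (Br Bs))) geq_max.
  by rewrite bdsum0; case: eps.
elim/bat_ind2: B g => [|B Bs _ IHBs] g; first by rewrite bdsum_nilS.
rewrite [bat_dim _]/(maxn (bat_dim B).+1 (bat_dim (Br Bs))) geq_max => /andP[h1 h2].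
by rewrite bdsum_cons psum_consS IHBs // IH.
Qed.

(** The extremal positions form chains, along which [w] is a partial sum of [W]. An arbitrary weight
    thus becomes a difference between ends, the form that Stokes' formula handles. *)
Lemma potential eps B k (W : pos B k.+1 -> nat) : exists w : pos B k -> nat,
  forall p : pos B k.+1, extremal eps p -> w (tgt p) = W p + w (src p).
Proof.
suff : exists w : pos B k -> nat,
  (forall p : pos B k.+1, extremal eps p -> w (tgt p) = W p + w (src p)) /\
  match k return (pos B k -> nat) -> Prop with 0 => fun w => w (fst_pt (pos B)) = 0 | _ => fun=> True end w.
  by move=> [w []]; exists w.
elim/bat_ind2: B k W => [|B Bs IHB IHBs] [|k] W; try by exists (fun=> 0); split=> //; case.
- have [w [w1 w2]] := IHBs 0 (fun q => W (inr q)).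
  pose e := bat_inc eps 0 B 0 (fst_pt (pos (bat_bd 0 B))).
  have eE p : extremal eps p -> p = e.
    move=> /range_inc_superset[p' <-]; rewrite /e; congr (bat_inc _ _ _ _ _).
    by case: (B) p' => Cs [].
  (* The first branch has the single extremal 1-position [e]; the sum starts at 0 at the first
     basepoint and adds [W] at [e] to everything after it. *)
  exists (fun q : option (pos (Br Bs) 0) => if q is Some q then W (inl e) + w q else 0); split=> //.
  move=> [p|p] hp /=.
    rewrite w2; congr (W (inl _) + 0); apply/esym/eE => q E.
    by apply: (hp (inl q)); rewrite bdp_inl E.
  by rewrite w1; [exact: addnCA|move=> q E; apply: (hp (inr q)); rewrite bdp_inr E].
- have [w [w1 _]] := IHB k (fun q => W (inl q)).
  have [v [v1 _]] := IHBs k.+1 (fun q => W (inr q)).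
  exists (fun q : (pos B k + pos (Br Bs) k.+1)%type => match q with inl q => w q | inr q => v q end).
  split=> // -[p|p] hp /=.
    by apply: w1 => q E; apply: (hp (inl q)); rewrite bdp_inl E.
  by apply: v1 => q E; apply: (hp (inr q)); rewrite bdp_inr E.
Qed.

(** * Variables of the boundary contexts *)

(** The variables barred from the [eps]-boundary in their own dimension: sources for +, targets for
    -. In [bctx B] they are the names of positions that are not [extremal]. *)
Definition is_end (eps : bool) (G : ctx) (z : nat) : Prop :=
  exists w A u v, ctx_at G w = Some (Arr A u v) /\ (if eps then u else v) = Var z.

Lemma is_end_lt eps G z : ctx_ok G -> is_end eps G z -> z < len G.
Proof.
move=> hG [w [A [u [v [hw E]]]]]; apply: (vars_lt.1 _ hG _ _ hw) => /=.
by case: eps E => ->; [left; right|right].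
Qed.

Lemma is_end_pse eps G x A z : ctx_at G x = Some A ->
  is_end eps (CExt (CExt G A) (Arr A (Var x) (Var (len G)))) z <->
  is_end eps G z \/ z = if eps then x else len G.
Proof.
move=> hx; split.
  move=> [w [B [u [v []]]]] /=; case: eqP => [_ [_ <- <-]|_].
    by case: eps => -[->]; right.
  case: eqP => [_ [E]|_ hw] ee; last by left; exists w, B, u, v.
  by left; exists x, B, u, v; rewrite -E.
case=> [[w [B [u [v [hw E]]]]]|->].
  exists w, B, u, v; split=> //.
  by rewrite (ctx_le_ext2 _ _ _).2 // (ctx_at_lt hw).
exists (len G).+1, A, (Var x), (Var (len G)); rewrite /= eqxx; split=> //.
by case: eps.
Qed.

(* Level-k iterated target of a variable x of type A, or x itself. *)
Fixpoint last_at (k x : nat) (A : ty) : nat :=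
  if ty_dim1 A == k then x else if A is Arr A' _ (Var y) then last_at k y A' else 0.

Lemma last_at_top k x A : ty_dim1 A = k -> last_at k x A = x.
Proof. by case: A => [|A u v] /= ->; rewrite eqxx. Qed.

Lemma last_at_tgt k A u y f : k <= ty_dim1 A ->
  last_at k f (Arr A u (Var y)) = last_at k y A.
Proof. by move=> kA /=; rewrite gtn_eqF. Qed.

Lemma last_at_below k x y A : k < ty_dim1 A -> last_at k x A = last_at k y A.
Proof. by case: A => //= A u v hk; rewrite gtn_eqF. Qed.

(** The last clause is carried along to know which entry [rm] deletes in the case of [pse] with dim
    y = k: it is [x]. *)
Lemma bd_at_vars k eps G x A (d : ps_at G x A) :
  let s := map fst (bd_at k eps d) in
  [/\ uniq s,
      forall z, z \in s <-> exists C, ctx_at G z = Some C /\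
        (ty_dim1 C < k \/ (ty_dim1 C = k /\ ~ is_end eps G z)) &
      eps -> k <= ty_dim1 A -> exists s', s = rcons s' (last_at k x A)].
Proof.
elim: d => {G x A} [|G f A x y d [IHu IHm IHl]|G x A d [IHu IHm IHl]]; cbv zeta.
- rewrite /=; split=> //.
  + move=> z; rewrite inE; split.
      move=> /eqP ->; exists Star; split=> //=.
      case: (k) => [|k']; [right|by left]; split=> // -[w [A [u [v []]]]] /=.
      by case: ifP.
    by move=> [C [/= ]]; case: ifP.
  + by exists [::]; case: (k).
- rewrite /=; split=> // heps hk; have [|s' ->] := IHl heps; first exact: leq_trans hk _.
  by exists s'; rewrite last_at_tgt.
have [hG hx] := ps_at_ok d; set a := Arr _ _ _; set G' := CExt (CExt G A) a.
have hE z : is_end eps G' z <-> is_end eps G z \/ z = if eps then x else len G.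
  exact: is_end_pse.
have atG z : z < len G -> ctx_at G' z = ctx_at G z by exact: (ctx_le_ext2 _ _ _).2.
have aty : ctx_at G' (len G) = Some A by rewrite /= eqxx ltn_eqF.
have atf : ctx_at G' (len G).+1 = Some a by rewrite /= eqxx.
have xG := ctx_at_lt hx.
have sG z : z \in map fst (bd_at k eps d) -> z < len G.
  by move=> /IHm [C [/ctx_at_lt]].
have cases z C : ctx_at G' z = Some C -> [\/ ctx_at G z = Some C /\ z < len G,
    z = len G /\ C = A | z = (len G).+1 /\ C = a].
  rewrite /=; case: eqP => [-> [<-]|_]; first by constructor 3.
  case: eqP => [-> [<-]|_]; first by constructor 2.
  by move=> /[dup] /ctx_at_lt; constructor 1.
rewrite [bd_at _ _ _]/=; case: (ltngtP k (ty_dim1 A)) => hk.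
- split=> //; last first.
    by move=> heps _; have [|s' ->] := IHl heps; [exact: ltnW|exists s'; rewrite /a last_at_tgt ?(ltnW hk) // (last_at_below _ x hk)].
  move=> z; split.
    move=> /[dup] /sG zG /IHm [C [hz hC]]; exists C; rewrite atG //; split=> //.
    case: hC => [|[Ck zE]]; [by left|right; split=> // /hE [//|]].
    case: (eps) => Ez; last by rewrite Ez ltnn in zG.
    by move: hk; rewrite -Ck; rewrite Ez hx in hz; case: hz => ->; rewrite ltnn.
  move=> [C [/cases[[hz zG]|[-> ->]|[-> ->]]]] hC.
  + apply/IHm; exists C; split=> //; case: hC => [|[-> hz']]; [by left|right; split=> // hz2].
    by apply: hz'; apply/hE; left.
  + by case: hC => [|[]] h; move: hk; [rewrite ltnNge ltnW|rewrite h ltnn].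
  + by case: hC => /= [|[]] h; [move: (ltn_trans h hk)|move: hk; rewrite -h]; rewrite ltnNge leqnSn.
- rewrite !map_rcons ![fst _]/=; split.
  + rewrite !rcons_uniq IHu mem_rcons inE.
    rewrite andbT; apply/andP; split.
      by apply/negP => /orP[/eqP E|/sG]; [have := ltnSn (len G); rewrite -{1}E ltnn|rewrite ltnNge leqnSn].
    by apply/negP => /sG; rewrite ltnn.
  + move=> z; rewrite mem_rcons inE mem_rcons inE; split.
      move=> /orP[/eqP->|/orP[/eqP->|]].
      * exists a; split=> //=; move: hk; rewrite leq_eqVlt => /predU1P[E|]; [right|by left].
        split=> // /hE [/(is_end_lt hG)|]; first by rewrite ltnNge leqnSn.
        case: (eps) => E'; first by move: xG; rewrite -E' ltnNge leqnSn.
        by have := ltnSn (len G); rewrite -{1}E' ltnn.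
      * by exists A; split=> //; left.
      * move=> /[dup] /sG zG /IHm [C [hz hC]]; exists C; rewrite atG //; split=> //.
        case: hC => [|[Ck zE]]; [by left|right; split=> // /hE [//|]].
        case: (eps) => Ez; last by rewrite Ez ltnn in zG.
        by move: hk; rewrite -Ck; rewrite Ez hx in hz; case: hz => ->; rewrite ltnn.
    move=> [C [/cases[[hz zG]|[-> ->]|[-> ->]]]] hC; rewrite ?eqxx ?orbT //.
    apply/orP; right; apply/orP; right.
    apply/IHm; exists C; split=> //; case: hC => [|[-> hz']]; [by left|right; split=> // hz2].
    by apply: hz'; apply/hE; left.
  + move=> heps hk'; exists (rcons (map fst (bd_at k eps d)) (len G)); rewrite last_at_top //.
    by apply/eqP; rewrite eqn_leq hk' andbT.
(* Here y has dimension k. On the + side y replaces [x], which has become a source; on the - side y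
   is a target and f is too high, so nothing changes. *)
- have key z : (exists C, ctx_at G' z = Some C /\ (ty_dim1 C < k \/ ty_dim1 C = k /\ ~ is_end eps G' z)) <->
     (eps /\ z = len G) \/ (z \in map fst (bd_at k eps d) /\ ~ (eps /\ z = x)).
    split.
      move=> [C [/cases[[hz zG]|[-> ->]|[-> ->]]]] hC.
      * right; split.
          apply/IHm; exists C; split=> //; case: hC => [|[-> hz']]; [by left|right; split=> // hz2].
          by apply: hz'; apply/hE; left.
        move=> [ee Ezx]; rewrite Ezx hx in hz; case: hz hC => <-; rewrite hk ltnn => -[//|[_]]; apply.
        by apply/hE; right; rewrite Ezx ee.
      * case: hC; rewrite -hk ?ltnn // => -[_ hE']; left.
        by split=> //; apply: contrapT => ne; apply: hE'; apply/hE; right; case: (eps) ne.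
      * by case: hC => /=; rewrite -hk; [rewrite ltnNge leqnSn|case=> /eqP; rewrite eqn_leq ltnn].
    case=> [[ee ->]|[/[dup] /sG zG /IHm [C [hz hC]] nx]].
      exists A; split=> //; right; split=> // /hE[/(is_end_lt hG)|]; first by rewrite ltnn.
      by rewrite ee => Ex; rewrite -Ex ltnn in xG.
    exists C; rewrite atG //; split=> //; case: hC => [|[Ck zE]]; [by left|right; split=> // /hE [//|]].
    move: nx; case: (eps) => nx Ez; last by rewrite Ez ltnn in zG.
    by apply: nx.
  case E : eps; last first.
    rewrite E in IHm sG key hE IHu.
    by split=> // z; split=> [h|/key [[]//|[]//]]; apply/key; right; split=> // -[].
  rewrite E in IHm sG key hE IHu IHl.
  have [|s' Es] := IHl erefl; first by rewrite hk.
  rewrite last_at_top // in Es.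
  have Et : map fst (take (size (bd_at k true d)).-1 (bd_at k true d)) = s'.
    have Esz : size (bd_at k true d) = (size s').+1 by rewrite -(size_map fst) Es size_rcons.
    by rewrite map_take Es Esz /= -cats1 take_size_cat.
  rewrite map_rcons Et /=.
  have us' : x \notin s' /\ uniq s' by move: IHu; rewrite Es rcons_uniq => /andP[].
  split.
  + rewrite rcons_uniq us'.2 andbT; apply/negP => h.
    by have := sG (len G); rewrite Es mem_rcons inE h orbT ltnn => /(_ isT).
  + move=> z; rewrite mem_rcons inE; split.
      move=> /orP[/eqP zy|zs']; apply/key; [by left|right].
      rewrite Es mem_rcons inE zs' orbT; split=> // -[_ Ezx].
      by move: us'.1; rewrite -Ezx zs'.
    move=> /key [[_ ->]|[]]; first by rewrite eqxx.
    rewrite Es mem_rcons inE => /orP[/eqP -> h|->]; last by rewrite orbT.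
    by case: h.
  + by move=> _ _; exists s'; rewrite -hk gtn_eqF //= last_at_top.
Qed.

Lemma bd_sub_vars k eps G (d : ps G) :
  sub_vars (bd_sub k eps d) = [set z | z \in map fst (bd k eps d)].
Proof.
rewrite /bd_sub; set s := bd _ _ _; suff h g : sub_vars (foldl (fun g xA => SExt g (Var xA.1)) g s) =
    sub_vars g `|` [set z | z \in map fst s] by rewrite h set0U.
elim: s g => [|xA s IH] g /=; first by apply/seteqP; split=> z /=; [left|case].
rewrite IH /=; apply/seteqP; split=> z /=; rewrite inE.
  by move=> [[|->]|->]; [left|right; rewrite eqxx|right; rewrite orbT].
by case=> [|/orP[/eqP->|]]; [left; left|left; right|right].
Qed.

Definition bdset (eps : bool) (k : nat) (B : bat) : set nat :=
  [set z | exists j (p : pos B j), z = pname B p /\ (j < k \/ j = k /\ extremal eps p)].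

Lemma is_end_bctx eps B k (p : pos B k) : is_end eps (bctx B) (pname B p) <-> ~ extremal eps p.
Proof.
split.
  move=> [w [A [u [v [hw E]]]]] hp.
  have [j [q Eq]] := pname_surj (ctx_at_lt hw).
  move: hw; rewrite -Eq pname_at => -[]; case: j q {Eq} => //= j q [EA Eu Ev].
  have : pname B p = pname B (bdp (~~ eps) q).
    by move: E; rewrite -Eu -Ev /bdp; case: (eps) => -[].
  move=> /pname_inj Epq; have Ej : k = j := congr1 (@projT1 _ _) Epq; subst j.
  by apply: (hp q); exact: existT_pos_inj.
move=> hp; have [q ->] : exists q : pos B k.+1, p = bdp (~~ eps) q.
  by apply: contrapT => h; apply: hp => q Eq; apply: h; exists q.
exists (pname B q), (cell_ty (@pname B) Star (src q)), (Var (pname B (src q))), (Var (pname B (tgt q))).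
by rewrite pname_at; split=> //; case: (eps).
Qed.

Lemma bd_sub_bctx k eps B (d : ps (bctx B)) : sub_vars (bd_sub k eps d) = bdset eps k B.
Proof.
rewrite bd_sub_vars; case: d => x d; have [_ h _] := bd_at_vars k eps d.
apply/seteqP; split=> z /=.
  move=> /h [C [hz hC]]; have [j [p Ez]] := pname_surj (ctx_at_lt hz).
  move: hz hC; rewrite -Ez pname_at => -[<-]; rewrite cell_ty_dim => hC.
  exists j, p; split=> //; case: hC => [|[jk hE]]; [by left|right; split=> //].
  by apply: contrapT => ne; apply: hE; apply/is_end_bctx.
move=> [j [p [-> hp]]]; apply/h; exists (cell_ty (@pname B) Star p); rewrite pname_at cell_ty_dim.
split=> //; case: hp => [|[jk hE]]; [by left|right; split=> //].
by move=> /is_end_bctx.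
Qed.

Lemma ctx_vars_bctx B : ctx_vars (bctx B) = [set z | exists j (p : pos B j), z = pname B p].
Proof.
apply/seteqP; split=> z /=; first by move=> /pname_surj [j [p <-]]; exists j, p.
by move=> [j [p ->]]; exact: pname_lt.
Qed.

(** * Cells as terms *)

Section Assemble.
Variables (T : Type) (nu : T -> nat).

(* The default is a raw closed term, so that it is fixed by substitutions. *)
Definition lookup (h : T -> tm) (i : nat) : tm :=
  if pselect (exists g, nu g = i) is left e then h (projT1 (cid e))
  else Coh CNil Star SNil.

Fixpoint assemble (h : T -> tm) (N : nat) : sub :=
  if N is N'.+1 then SExt (assemble h N') (lookup h N') else SNil.

Lemma slen_assemble h N : slen (assemble h N) = N.
Proof. by elim: N => //= N ->. Qed.

Lemma sub_at_assemble h N i : i < N -> sub_at (assemble h N) i = Some (lookup h i).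
Proof.
elim: N => //= N IH; rewrite slen_assemble ltnS leq_eqVlt; case: eqP => [->//|_] /= /IH //.
Qed.

Lemma sub_comp_assemble h N d :
  sub_comp (assemble h N) d = assemble (fun g => tm_sub (h g) d) N.
Proof. by elim: N => //= N ->; rewrite /lookup; case: pselect. Qed.

Lemma assemble_vars h N x : x \in sub_vars (assemble h N) ->
  exists g, nu g < N /\ tm_vars (h g) x.
Proof.
elim: N => [|N IH] /=; first by rewrite inE.
rewrite in_setE => -[/mem_set/IH [g [gN gx]]|]; first by exists g; split=> //; exact: ltnW.
rewrite /lookup; case: pselect => //= e hx; exists (projT1 (cid e)).
by rewrite (projT2 (cid e)) ltnSn.
Qed.

Hypothesis nu_inj : injective nu.

Lemma lookup_inj h g : lookup h (nu g) = h g.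
Proof.
rewrite /lookup; case: pselect => [e|[]]; last by exists g.
by congr h; apply: nu_inj; exact: projT2 (cid e).
Qed.

Lemma sub_at_assemble_inj h N g : nu g < N -> sub_at (assemble h N) (nu g) = Some (h g).
Proof. by move=> gN; rewrite sub_at_assemble // lookup_inj. Qed.

Lemma assemble_inj h h' N : (forall g, nu g < N) ->
  assemble h N = assemble h' N -> h =1 h'.
Proof.
move=> nuN E g; have := sub_at_assemble_inj h (nuN g).
by rewrite E sub_at_assemble_inj // => -[].
Qed.

Lemma vars_assemble h N g x : nu g < N -> tm_vars (h g) x -> sub_vars (assemble h N) x.
Proof.
elim: N => //= N IH; rewrite ltnS leq_eqVlt => /predU1P[<-|gN] gx; last by left; exact: IH.
by right; rewrite lookup_inj.
Qed.

End Assemble.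

Lemma sub_eq g h : slen g = slen h ->
  (forall i, i < slen g -> sub_at g i = sub_at h i) -> g = h.
Proof.
elim: g h => [|g IH t] [|h u] //= [E] gh.
have [<-] : Some t = Some u by have := gh (slen g) (ltnSn _); rewrite eqxx E eqxx.
congr SExt; apply: IH => // i ig; have := gh i (ltnW ig).
by rewrite -E ltn_eqF.
Qed.

(** Stage m is at level m - 1, so these are the generators of all dimensions below m. *)
Fixpoint gens m : cpt (level m) -> Type :=
  match m with
  | 0 => fun=> void
  | m'.+1 => fun C => (gens (base C) + gen C)%type
  end.

Fixpoint pos_var B m : gens (free (level m) (pos B)) -> nat :=
  match m with
  | 0 => of_void _
  | m'.+1 => fun g => match g with inl g => pos_var g | inr p => pname B p end
  end.

Arguments pos_var B m g : clear implicits.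

(** The data passed from one level to the next. Cells are absent because their terms are computed
    from the spheres and homomorphisms one level below. *)
Record translation m := Translation {
  sphere_ty_of : forall C : cpt (level m), (gens C -> nat) -> sphere C -> ty;
  hom_tm_of : forall C D : cpt (level m), hom C D -> (gens D -> nat) -> gens C -> tm }.

Section CellTerm.
Variables (m : nat) (T : translation m) (C : ncomp (level m)) (nu : gens (base C) + gen C -> nat).

Fixpoint cell_tm_of (c : precell C) : tm :=
  match c with
  | pvar v => Var (nu (inr v))
  | pcoh B A f fV =>
      Coh (bctx B) (sphere_ty_of T (pos_var B m) A)
        (assemble (pos_var B m.+1)
           (fun g => match g with
                     | inl g => hom_tm_of T f (fun g => nu (inl g)) g
                     | inr p => cell_tm_of (fV p)
                     end) (len (bctx B)))
  end.

End CellTerm.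

Fixpoint translate m : translation m :=
  match m with
  | 0 => @Translation 0 (fun _ _ _ => Star) (fun _ _ _ _ => of_void _)
  | m'.+1 => let T := translate m' in
     @Translation m'.+1
       (fun C nu s =>
          Arr (sphere_ty_of T (fun g => nu (inl g)) (bdry (sval s).1))
            (cell_tm_of T nu (sval (sval s).1)) (cell_tm_of T nu (sval (sval s).2)))
       (fun C D f nu g =>
          match g with
          | inl g => hom_tm_of T (nbase f) (fun g => nu (inl g)) g
          | inr v => cell_tm_of T nu (sval (ngen f v))
          end)
  end.

Definition sphere_ty m (C : cpt (level m)) nu (s : sphere C) : ty :=
  sphere_ty_of (translate m) nu s.

Definition hom_tm m (C D : cpt (level m)) (f : hom C D) nu (g : gens C) : tm :=
  hom_tm_of (translate m) f nu g.

Definition cell_tm m (C : cpt (level m.+1)) (nu : gens C -> nat) (c : precell C) : tm :=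
  cell_tm_of (translate m) nu c.

Arguments sphere_ty m {C} nu s : simpl never.
Arguments hom_tm m {C D} f nu g : simpl never.
Arguments cell_tm m {C} nu c : simpl never.

Section TranslateE.
Variable m : nat.
Implicit Types C D : cpt (level m.+1).

Lemma sphere_tyS C nu (s : sphere C) : sphere_ty m.+1 nu s =
  Arr (sphere_ty m (fun g => nu (inl g)) (bdry (sval s).1))
    (cell_tm m nu (sval (sval s).1)) (cell_tm m nu (sval (sval s).2)).
Proof. by []. Qed.

Lemma hom_tm_inl C D (f : hom C D) nu g :
  hom_tm m.+1 f nu (inl g) = hom_tm m (nbase f) (fun g => nu (inl g)) g.
Proof. by []. Qed.

Lemma cell_tm_var C (nu : gens C -> nat) v : cell_tm m nu (pvar v) = Var (nu (inr v)).
Proof. by []. Qed.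

Definition coh_entry C (nu : gens C -> nat) B (f : hom (free (level m) (pos B)) (base C))
    (fV : pos B m -> precell C) (g : gens (free (level m.+1) (pos B))) : tm :=
  match g with
  | inl g => hom_tm m f (fun g => nu (inl g)) g
  | inr p => cell_tm m nu (fV p)
  end.

Lemma cell_tm_coh C (nu : gens C -> nat) B A f fV :
  cell_tm m nu (@pcoh m (level m) C B A f fV) =
  Coh (bctx B) (sphere_ty m (pos_var B m) A)
    (assemble (pos_var B m.+1) (coh_entry nu f fV) (len (bctx B))).
Proof. by []. Qed.

End TranslateE.

Lemma pos_var_pname B m (g : gens (free (level m) (pos B))) :
  exists k (p : pos B k), k < m /\ pos_var B m g = pname B p.
Proof.
elim: m g => [|m IH] /=; first by case.
case=> [g|p]; last by exists m, p.
by have [k [p [km E]]] := IH g; exists k, p; split=> //; exact: leqW.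
Qed.

Lemma pname_pos_var B m k (p : pos B k) : k < m ->
  exists g : gens (free (level m) (pos B)), pos_var B m g = pname B p.
Proof.
elim: m => [|m IH] //; rewrite ltnS leq_eqVlt => /predU1P[E|/IH [g E]].
  by subst k; exists (inr p).
by exists (inl g).
Qed.

Lemma pos_var_lt B m g : pos_var B m g < len (bctx B).
Proof. by have [k [p [_ ->]]] := pos_var_pname g; exact: pname_lt. Qed.

Lemma pos_var_inj B m : injective (pos_var B m).
Proof.
elim: m => [|m IH] /=; first by case.
have neq g (p : pos B m) : pos_var B m g <> pname B p.
  have [k [q [km ->]]] := pos_var_pname g.
  by move=> /pname_inj /(congr1 (@projT1 _ _)) E; move: km; rewrite (E : k = m) ltnn.
move=> [g|p] [g'|p'].
- by move=> /IH ->.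
- by move=> /neq.
- by move=> /esym/neq.
- by move=> /pname_inj_dim ->.
Qed.

Lemma cell_tm_inj m (C : cpt (level m.+1)) nu :
  (forall B, injective (@sphere_ty m (free (level m) (pos B)) (pos_var B m))) ->
  (forall B (f f' : hom (free (level m) (pos B)) (base C)),
     hom_tm m f (fun g => nu (inl g)) =1 hom_tm m f' (fun g => nu (inl g)) -> f = f') ->
  injective nu -> injective (@cell_tm m C nu).
Proof.
move=> injS injH nu_inj; elim=> [v|B A f fV IH] [v'|B' A' f' fV'] //.
  by rewrite !cell_tm_var => -[/nu_inj [->]].
rewrite !cell_tm_coh => -[/bctx_inj EB]; subst B' => /injS -> {A}.
move=> /(assemble_inj (@pos_var_inj B m.+1) (@pos_var_lt B m.+1)) E.
have -> : f = f' by apply: injH => g; exact: (E (inl g)).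
by congr pcoh; apply/funext => p; apply: IH; exact: (E (inr p)).
Qed.

Lemma translate_inj m :
  (forall (C : cpt (level m)) nu, injective nu -> injective (@sphere_ty m C nu)) /\
  (forall (C D : cpt (level m)) nu, injective nu -> forall f f' : hom C D,
     hom_tm m f nu =1 hom_tm m f' nu -> f = f').
Proof.
elim: m => [|m [IHs IHh]].
  by split=> [C nu _ [] []|C D nu _ [] []].
have inl_inj (C : cpt (level m.+1)) (nu : gens C -> nat) : injective nu ->
    injective (fun g => nu (inl g)) by move=> nu_inj g g' /nu_inj [].
have tm_inj (C : cpt (level m.+1)) (nu : gens C -> nat) : injective nu ->
    injective (@cell_tm m C nu).
  move=> nu_inj; apply: cell_tm_inj => //; first by move=> B; apply: IHs; exact: pos_var_inj.
  by move=> B f f'; apply: IHh; exact: inl_inj.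
split=> [C nu nu_inj s s'|C D nu nu_inj f f' E].
  rewrite !sphere_tyS => -[_ /(tm_inj _ _ nu_inj) E1 /(tm_inj _ _ nu_inj) E2].
  apply: nsphere_eq; rewrite [LHS]surjective_pairing [RHS]surjective_pairing.
  by congr pair; apply: cell_eq.
apply: nhom_eq; first by apply: (IHh _ _ _ (inl_inj _ _ nu_inj)) => g; exact: (E (inl g)).
apply/funext => v; apply: cell_eq; apply: (tm_inj _ _ nu_inj); exact: (E (inr v)).
Qed.

(** On coherences both actions leave the tree and the sphere alone and only compose the morphism,
    respectively the substitution, so induction on cells applies. *)
Lemma translate_natural m (C D : cpt (level m)) (f : hom C D) nu mu d :
  (forall g, sub_at d (nu g) = Some (hom_tm m f mu g)) ->
  (forall s, sphere_ty m mu (sph_map f s) = ty_sub (sphere_ty m nu s) d) /\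
  (forall E (e : hom E C) g, hom_tm m (cmp f e) mu g = tm_sub (hom_tm m e nu g) d).
Proof.
elim: m C D f nu mu d => [|m IH] C D f nu mu d hd; first by split=> // E e [].
have {}IH := IH _ _ (nbase f) (fun g => nu (inl g)) (fun g => mu (inl g)) d (fun g => hd (inl g)).
have cellN c : cell_tm m mu (precell_map f c) = tm_sub (cell_tm m nu c) d.
  elim: c => [v|B A h hV IHc]; first by rewrite cell_tm_var /= (hd (inr v)).
  rewrite [precell_map _ _]/= !cell_tm_coh /= sub_comp_assemble; congr (Coh _ _ (assemble _ _ _)).
  by apply/funext => -[g|p]; [exact: IH.2|exact: IHc].
split=> [s|E e [g|v]].
- by rewrite !sphere_tyS /= !cellN -IH.1 -(bdry_map f).
- exact: IH.2.
- exact: cellN.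
Qed.

Lemma cell_tm_natural m (C D : cpt (level m.+1)) (f : hom C D) nu mu d :
  (forall g, sub_at d (nu g) = Some (hom_tm m.+1 f mu g)) ->
  forall c, cell_tm m mu (precell_map f c) = tm_sub (cell_tm m nu c) d.
Proof.
move=> hd c; have IH := translate_natural (fun g => hd (inl g)).
elim: c => [v|B A h hV IHc]; first by rewrite cell_tm_var /= (hd (inr v)).
rewrite [precell_map _ _]/= !cell_tm_coh /= sub_comp_assemble; congr (Coh _ _ (assemble _ _ _)).
by apply/funext => -[g|p]; [exact: IH.2|exact: IHc].
Qed.

Lemma hom_tm_id m (C : cpt (level m)) nu g : hom_tm m (idm C) nu g = Var (nu g).
Proof.
elim: m C nu g => [|m IH] C nu; first by case.
by case=> [g|v] //; rewrite hom_tm_inl IH.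
Qed.

Lemma sphere_ty_dim m (C : cpt (level m)) nu (s : sphere C) : ty_dim1 (sphere_ty m nu s) = m.
Proof. by elim: m C nu s => // m IH C nu s; rewrite sphere_tyS /= IH. Qed.

Lemma translate_vars m :
  (forall (C : cpt (level m)) nu s x, ty_vars (sphere_ty m (C := C) nu s) x -> exists g, x = nu g) /\
  (forall (C D : cpt (level m)) (f : hom C D) nu g x, tm_vars (hom_tm m f nu g) x ->
     exists g', x = nu g').
Proof.
elim: m => [|m [IHs IHh]]; first by split=> // C D f nu [].
have IHc (C : cpt (level m.+1)) (nu : gens C -> nat) (c : precell C) x :
    tm_vars (cell_tm m nu c) x -> exists g, x = nu g.
  elim: c => [v|B A f fV IH]; first by rewrite cell_tm_var => ->; exists (inr v).
  rewrite cell_tm_coh /= => /mem_set/assemble_vars [[g|p] [_]]; last exact: IH.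
  by move=> /IHh [g' ->]; exists (inl g').
split=> [C nu s x|C D f nu [g|v] x].
- by rewrite sphere_tyS => -[[/IHs [g ->]|/IHc]|/IHc] //; exists (inl g).
- by move=> /IHh [g' ->]; exists (inl g').
- exact: IHc.
Qed.

Lemma cell_tm_vars m (C : cpt (level m.+1)) (nu : gens C -> nat) (c : precell C) x :
  tm_vars (cell_tm m nu c) x ->
  (exists g, x = nu (inl g)) \/ exists2 v, presupp c v & x = nu (inr v).
Proof.
elim: c => [v|B A f fV IH]; first by rewrite cell_tm_var => ->; right; exists v.
rewrite cell_tm_coh /= => /mem_set/assemble_vars [[g|p] [_]].
  by move=> /(translate_vars m).2 [g' ->]; left; exists g'.
by move=> /IH [|[v hv ->]]; [left|right; exists v => //; exists p].
Qed.

Lemma presupp_vars m (C : cpt (level m.+1)) (nu : gens C -> nat) (c : precell C) v :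
  presupp c v -> tm_vars (cell_tm m nu c) (nu (inr v)).
Proof.
elim: c => [w ->|B A f fV IH [p _ /IH hp]] //; rewrite cell_tm_coh /=.
by apply: (vars_assemble (@pos_var_inj B m.+1) (g := inr p)) => //; exact: (@pos_var_lt B m.+1).
Qed.

Fixpoint gen_ty m : forall C : cpt (level m), (gens C -> nat) -> gens C -> ty :=
  match m with
  | 0 => fun _ _ => of_void _
  | m'.+1 => fun C nu g =>
      match g with
      | inl g => gen_ty (fun g => nu (inl g)) g
      | inr v => sphere_ty m' (fun g => nu (inl g)) (attach v)
      end
  end.

Arguments gen_ty m {C} nu g.

Lemma gen_ty_dim m (C : cpt (level m)) nu g : ty_dim1 (gen_ty m (C := C) nu g) < m.
Proof.
elim: m C nu g => [|m IH] C nu; first by case.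
by case=> [g|v] /=; [exact/leqW/IH|rewrite sphere_ty_dim].
Qed.

Lemma sphere_ty_pole B m (p : pos B m) :
  sphere_ty m (pos_var B m) (pole (level m) p) = cell_ty (@pname B) Star p.
Proof. by elim: m p => // m IH p; rewrite sphere_tyS /= -IH. Qed.

Lemma gen_ty_pos B m (g : gens (free (level m) (pos B))) :
  exists k (p : pos B k), [/\ k < m, pos_var B m g = pname B p &
    gen_ty m (pos_var B m) g = cell_ty (@pname B) Star p].
Proof.
elim: m g => [|m IH]; first by case.
case=> [g|p]; last by exists m, p; split=> //; exact: sphere_ty_pole.
by have [k [p [km E1 E2]]] := IH g; exists k, p; split=> //; exact: leqW.
Qed.

(** Only variables of dimension below m have to be named, so that one context can present every
    truncation of a computad. *)
Definition presents m (C : cpt (level m)) (nu : gens C -> nat) (G : ctx) : Prop :=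
  [/\ injective nu,
      forall g, ctx_at G (nu g) = Some (gen_ty m nu g) &
      forall x A, ctx_at G x = Some A -> ty_dim1 A < m -> exists g, nu g = x].

Lemma presents_base m (C : cpt (level m.+1)) nu G :
  @presents m.+1 C nu G -> presents (fun g : gens (base C) => nu (inl g)) G.
Proof.
move=> [nu_inj nu_at nu_surj]; split.
- by move=> g g' /nu_inj [].
- by move=> g; rewrite nu_at.
- move=> x A hx hA; have [[g|v] E] := nu_surj x A hx (ltnW hA); first by exists g.
  by move: hx hA; rewrite -E nu_at => -[<-] /=; rewrite sphere_ty_dim ltnn.
Qed.

Lemma presents_bctx B m : presents (pos_var B m) (bctx B).
Proof.
split; first exact: pos_var_inj.
  by move=> g; have [k [p [_ -> ->]]] := gen_ty_pos g; exact: pname_at.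
move=> x A hx hA; have [k [p Ex]] := pname_surj (ctx_at_lt hx).
rewrite -Ex; apply: pname_pos_var; move: hx hA; rewrite -Ex pname_at => -[<-].
by rewrite cell_ty_dim.
Qed.

Lemma presents_lt m (C : cpt (level m)) (nu : gens C -> nat) G g :
  presents nu G -> nu g < len G.
Proof. by move=> [_ nu_at _]; exact: ctx_at_lt (nu_at g). Qed.

(** * Well-typedness of the terms of cells *)

Lemma tm_ok_ty G t A : tm_ok G t A -> ty_ok G A.
Proof.
elim=> {G t A} [G x A hG hx|G d A u v D g hu hA hv _ hg _].
  exact: ctx_at_ok hx.
by apply: substitution.2.1 hg; exact: ty_ok_arr.
Qed.

Lemma tm_ok_uniq G t A A' : tm_ok G t A -> tm_ok G t A' -> A = A'.
Proof.
move=> h h'; inversion h; subst; inversion h'; subst => //.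
by congruence.
Qed.

Lemma ty_ok_arr_inv G A u v : ty_ok G (Arr A u v) -> [/\ ty_ok G A, tm_ok G u A & tm_ok G v A].
Proof. by move=> h; inversion h. Qed.

Lemma sub_ok_intro D g G : ctx_ok G -> ctx_ok D -> slen g = len G ->
  (forall x A, ctx_at G x = Some A ->
     exists2 t, sub_at g x = Some t & tm_ok D t (ty_sub A g)) ->
  sub_ok D g G.
Proof.
move=> hG hD; elim: G g hG => [|G IH A] [|g t] //= hG; first by move=> _ _; exact: sub_ok_nil.
move=> [E] h; have hA := ctx_ok_inv hG; have hG' := ty_ok_ctx hA.
have restr C : ty_ok G C -> ty_sub C (SExt g t) = ty_sub C g.
  by move=> /ty_ok_vars hC; apply: ty_sub_ext; rewrite E.
apply: sub_ok_ext => //.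
  apply: IH => // x B hx; have [|s] := h x B.
    by case: eqP (ctx_at_lt hx) => // ->; rewrite ltnn.
  rewrite E ltn_eqF ?(ctx_at_lt hx) // restr; last exact: ctx_at_ok hx.
  by exists s.
have [|s] := h (len G) A; first by rewrite eqxx.
by rewrite E eqxx restr // => -[->].
Qed.

Definition vars_closed (G : ctx) (S : set nat) : Prop :=
  forall x A, S x -> ctx_at G x = Some A -> ty_vars A `<=` S.

(** A variable does not mention its own boundary, hence the union with its type; for a coherence the
    variables of the type already occur in the substitution. *)
Lemma ok_vars_closed :
  (forall G, ctx_ok G -> forall x A, ctx_at G x = Some A -> vars_closed G (ty_vars A)) /\
  (forall G A, ty_ok G A ->
     (forall x B, ctx_at G x = Some B -> vars_closed G (ty_vars B)) /\
     vars_closed G (ty_vars A)) /\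
  (forall G t A, tm_ok G t A -> vars_closed G (tm_vars t `|` ty_vars A)) /\
  (forall D g G, sub_ok D g G -> vars_closed D (sub_vars g)).
Proof.
apply: ok_mut => //.
- move=> G A hA [hG cA] x B hx y C yB.
  have {}hG : vars_closed G (ty_vars B).
    by move: hx => /=; case: eqP => [_ [<-]|_ /hG].
  have yG : y < len G.
    move: hx => /=; case: eqP => [_ [E]|_ hx]; first by rewrite -E in yB; exact: (ty_ok_vars hA yB).
    exact: (vars_lt.1 _ (ty_ok_ctx hA) _ _ hx _ yB).
  by rewrite (ctx_le_ext _ _).2 //; exact: hG.
- by move=> G _ hG; split.
- move=> G A t u _ [hG hA] _ ht _ hu; split=> // x B /= [[xA|xt]|xu] hx y yB.
  + by left; left; exact: hA hx _ yB.
  + by left; case: (ht x B _ hx _ yB); [left|right|left].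
  + by case: (hu x B _ hx _ yB); [left|right|left; left].
- move=> G x A _ hG hx y B [->|yA] hy z zB.
    by right; move: hy; rewrite /= hx => -[->].
  by right; exact: (hG _ _ hx _ _ yA hy _ zB).
- move=> P p A u v D g hu _ hv _ hg cg _ x B hx hB y yB; left.
  apply: cg hB _ yB; case: hx => // hx; apply: ty_sub_vars hx.
  rewrite (sub_ok_len hg).
  have [hu1 hA1] := vars_lt.2.2.1 _ _ _ hu.
  have [hv1 _] := vars_lt.2.2.1 _ _ _ hv.
  by move=> z [[/hA1|/hu1]|/hv1].
- by move=> G _ _ x A [].
- move=> D g G A t hg cg /ctx_ok_inv hA _ _ ct x B /= [xg|xt] hx y yB.
    by left; exact: cg hx _ yB.
  case: (ct x B _ hx _ yB); [by left|by right|].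
  by move=> yA; left; apply: ty_sub_vars yA; rewrite (sub_ok_len hg); exact: ty_ok_vars hA.
Qed.

(** The set Var(t) together with Var(A) that the side condition of (coh) compares with a
    boundary. *)
Definition total_vars m B (c : cell (nfree (level m) (pos B))) : set nat :=
  tm_vars (cell_tm m (pos_var B m.+1) (sval c)) `|`
  ty_vars (sphere_ty m (pos_var B m) (bdry c)).

Definition cell_ok m B (c : cell (nfree (level m) (pos B))) : Prop :=
  tm_ok (bctx B) (cell_tm m (pos_var B m.+1) (sval c))
    (sphere_ty m (pos_var B m) (bdry c)).

Lemma total_vars_closed m B (c : cell (nfree (level m) (pos B))) :
  cell_ok c -> forall k (p : pos B k.+1) eps,
    total_vars c (pname B p) -> total_vars c (pname B (bdp eps p)).
Proof.
move=> /ok_vars_closed.2.2.1 h k p eps hp; apply: (h _ _ hp (pname_at p)) => /=.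
by case: eps; [right|left; right].
Qed.

Lemma total_vars_base m B (c : cell (nfree (level m) (pos B))) x : total_vars c x ->
  (exists k (p : pos B k), k < m /\ x = pname B p) \/ exists2 p, supp c p & x = pname B p.
Proof.
case=> [/cell_tm_vars [[g ->]|]|/(translate_vars m).1 [g ->]]; last 1 first.
- by left; have [k [p [km E]]] := pos_var_pname g; exists k, p.
- by left; have [k [p [km E]]] := pos_var_pname g; exists k, p.
- by right.
Qed.

Lemma supp_total_vars m B (c : cell (nfree (level m) (pos B))) p :
  supp c p <-> total_vars c (pname B p).
Proof.
split; first by move=> h; left; exact: (presupp_vars (pos_var B m.+1) h).
move=> /total_vars_base [[k [q [km E]]]|[q hq /pname_inj_dim ->]] //.
have Ek : m = k := congr1 (@projT1 _ _) (pname_inj E).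
by rewrite Ek ltnn in km.
Qed.

Lemma total_vars_bdry m B (c : cell (nfree (level m.+1) (pos B))) eps :
  let s := sval (bdry c) in
  total_vars (if eps then s.2 else s.1) `<=` total_vars c.
Proof.
have E := svalP (bdry c); case: eps => /= x hx; right; rewrite sphere_tyS.
  by case: hx => hx; [right|left; left; move: hx; rewrite -E].
by case: hx => hx; [left; right|left; left].
Qed.

Lemma cell_ok_bdry m B (c : cell (nfree (level m.+1) (pos B))) eps :
  cell_ok c -> let s := sval (bdry c) in cell_ok (if eps then s.2 else s.1).
Proof.
move=> /tm_ok_ty; rewrite sphere_tyS => /ty_ok_arr_inv [_ h1 h2].
by case: eps => //; rewrite /cell_ok -(svalP (bdry c)).
Qed.

(** In codimension one, a position that is not a target lies in the source of [c] by induction. A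
    target is also the target of an extremal position, which is in the support, and closure under
    boundaries brings it in. *)
Lemma total_vars_full m B eps (c : cell (nfree (level m) (pos B))) :
  cell_ok c -> supp c = [set p | extremal eps p] -> full (level m) (bdry c) ->
  total_vars c = bdset eps m B.
Proof.
elim: m eps c => [|m IH] eps c hc hs hf.
  apply/seteqP; split=> x /=.
    by move=> /total_vars_base [[k [p []]]|[p]] //; rewrite hs => hp ->; exists 0, p; split=> //; right.
  move=> [k [p [-> [//|[E hp]]]]]; subst k.
  by apply/supp_total_vars; rewrite hs.
have [hf1 hf2 hf3] := hf; rewrite !range_inc in hf1 hf2.
have hm := IH false _ (cell_ok_bdry false hc) hf1 hf3.
apply/seteqP; split=> x /=.
  move=> /total_vars_base [[k [p [km ->]]]|[p]]; first by exists k, p; split=> //; left.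
  by rewrite hs => hp ->; exists m.+1, p; split=> //; right.
move=> [k [p [-> []]]]; last first.
  by move=> [E hp]; subst k; apply/supp_total_vars; rewrite hs.
rewrite ltnS leq_eqVlt => /predU1P[E|km]; last first.
  apply: (total_vars_bdry (eps := false)).
  by rewrite hm; exists k, p; split=> //; left.
subst k; have [hp|hp] := pselect (extremal false p).
  apply: (total_vars_bdry (eps := false)).
  by rewrite hm; exists m, p; split=> //; right.
have [q ->] : exists q : pos B m.+1, p = bdp true q.
  by apply: contrapT => h; apply: hp => q Eq; apply: h; exists q.
have [q' [hq' <-]] := extremal_parallel eps true q.
by apply: total_vars_closed => //; apply/supp_total_vars; rewrite hs.
Qed.

Lemma bdset_all eps m B : bat_dim B <= m -> bdset eps m B = ctx_vars (bctx B).
Proof.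
move=> hB; rewrite ctx_vars_bctx; apply/seteqP; split=> x [k [p]]; first by move=> [-> _]; exists k, p.
move=> ->; exists k, p; split=> //.
have := leq_trans (pos_dim_le p) hB; rewrite leq_eqVlt => /predU1P[E|]; [right|by left].
by subst k; split=> // q; have := leq_trans (pos_dim_le q) hB; rewrite ltnn.
Qed.

(** The first alternative of the side condition arises when dim B = m + 1, the second when dim B is
    at most m. *)
Lemma full_coh_side m B (s : sphere (free (level m.+1) (pos B))) (d : ps (bctx B)) :
  ty_ok (bctx B) (sphere_ty m.+1 (pos_var B m.+1) s) ->
  full (level m.+1) s -> bat_dim B <= m.+1 ->
  coh_side d (sphere_ty m (pos_var B m) (bdry (sval s).1))
    (cell_tm m (pos_var B m.+1) (sval (sval s).1))
    (cell_tm m (pos_var B m.+1) (sval (sval s).2)).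
Proof.
rewrite sphere_tyS => /ty_ok_arr_inv [_ h1 h2] [f1 f2 f3] hB.
have E := svalP s; rewrite !range_inc in f1 f2.
have v1 : total_vars (sval s).1 = bdset false m B by exact: total_vars_full.
have v2 : total_vars (sval s).2 = bdset true m B.
  by apply: total_vars_full => //; rewrite /cell_ok -E.
rewrite /total_vars -E in v2; rewrite /total_vars in v1.
move: hB; rewrite leq_eqVlt ltnS => /predU1P[EB|hB]; [left|right].
  by exists m; rewrite ctx_dim_bctx EB !bd_sub_bctx; split.
by split; [rewrite -(bdset_all false hB)|rewrite -(bdset_all true hB)].
Qed.

(** A coherence needs its sphere and its morphism to be well typed at the same level; these in turn
    need the cells one level below. *)
Lemma soundness m :
  (forall (C : cpt (level m)) (nu : gens C -> nat) G, ctx_ok G -> presents nu G ->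
     forall s, ty_ok G (sphere_ty m nu s)) /\
  (forall (C D : cpt (level m)) (f : hom C D) (nu : gens C -> nat) mu G H d,
     ctx_ok H -> presents nu G -> presents mu H ->
     (forall g, sub_at d (nu g) = Some (hom_tm m f mu g)) ->
     forall g, tm_ok H (hom_tm m f mu g) (ty_sub (gen_ty m nu g) d)) /\
  (forall (C : cpt (level m.+1)) (nu : gens C -> nat) G, ctx_ok G -> presents nu G ->
     forall c : cell C, tm_ok G (cell_tm m nu (sval c))
       (sphere_ty m (fun g => nu (inl g)) (bdry c))).
Proof.
have cells n : (forall (C : cpt (level n)) (nu : gens C -> nat) G, ctx_ok G -> presents nu G ->
     forall s, ty_ok G (sphere_ty n nu s)) ->
  (forall (C D : cpt (level n)) (f : hom C D) (nu : gens C -> nat) mu G H d,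
     ctx_ok H -> presents nu G -> presents mu H ->
     (forall g, sub_at d (nu g) = Some (hom_tm n f mu g)) ->
     forall g, tm_ok H (hom_tm n f mu g) (ty_sub (gen_ty n nu g) d)) ->
  forall (C : cpt (level n.+1)) (nu : gens C -> nat) G, ctx_ok G -> presents nu G ->
     forall c : precell C, is_cell c -> tm_ok G (cell_tm n nu c)
       (sphere_ty n (fun g => nu (inl g)) (prebdry c)).
  move=> hS hH C nu G hG pG; elim=> [v _|B A f fV IH].
    by have [_ h _] := pG; apply: tm_ok_var => //; rewrite (h (inr v)).
  move=> /= [n_gt0 dimB fullA fVc fVb].
  rewrite cell_tm_coh; set d := assemble _ _ _.
  have hd g : sub_at d (pos_var B n.+1 g) = Some (coh_entry nu f fV g).
    by apply: sub_at_assemble_inj; [exact: pos_var_inj|exact: pos_var_lt].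
  have natS := @translate_natural n _ _ f (pos_var B n) (fun g => nu (inl g)) d (fun g => hd (inl g)).
  have tyA : ty_ok (bctx B) (sphere_ty n (pos_var B n) A).
    by apply: hS; [exact: bctx_ok|exact: presents_bctx].
  have okd : sub_ok G d (bctx B).
    apply: sub_ok_intro => //; [exact: bctx_ok|exact: slen_assemble|].
    have [_ at_pos surj_pos] := presents_bctx B n.+1.
    (* As dim B is at most n, every variable of [bctx B] is the name of a generator available at
       this level. *)
    move=> x T hx; have [|g Eg] := surj_pos x T hx.
      have [k [p Ex]] := pname_surj (ctx_at_lt hx).
      move: hx; rewrite -Ex pname_at => -[<-]; rewrite cell_ty_dim ltnS.
      exact: leq_trans (pos_dim_le p) dimB.
    exists (coh_entry nu f fV g); first by rewrite -Eg hd.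
    move: hx; rewrite -Eg at_pos => -[<-]; case: g {Eg} => [g|p].
      apply: (hH _ _ f (pos_var B n) (fun g => nu (inl g)) (bctx B)) => //.
      - exact: presents_bctx.
      - exact: presents_base pG.
      - by move=> g'; exact: (hd (inl g')).
    have E := natS.1 (pole (level n) p); have := IH p (fVc p); rewrite fVb E; exact.
  rewrite natS.1.
  case: n {hS hH} C nu pG A f fV IH n_gt0 dimB fullA fVc fVb d hd natS tyA okd => // n
    C nu pG A f fV IH _ dimB fullA fVc fVb d hd natS tyA okd.
  have side := full_coh_side (bctx_ps B) tyA fullA dimB.
  rewrite sphere_tyS; move: tyA; rewrite sphere_tyS => /ty_ok_arr_inv [_ hu hv].
  exact: tm_ok_coh side.
elim: m => [|m [IHs [IHh IHc]]].
  have h1 : forall (C : cpt (level 0)) (nu : gens C -> nat) G, ctx_ok G -> presents nu G ->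
     forall s, ty_ok G (sphere_ty 0 nu s) by move=> C nu G hG _ s; exact: ty_ok_star.
  have h2 : (forall (C D : cpt (level 0)) (f : hom C D) (nu : gens C -> nat) mu G H d,
     ctx_ok H -> presents nu G -> presents mu H ->
     (forall g, sub_at d (nu g) = Some (hom_tm 0 f mu g)) ->
     forall g, tm_ok H (hom_tm 0 f mu g) (ty_sub (gen_ty 0 nu g) d)).
    by move=> C D f nu mu G H d _ _ _ _ [].
  by split=> //; split=> // C nu G hG pG c; exact: cells (svalP c).
have h1 : forall (C : cpt (level m.+1)) (nu : gens C -> nat) G, ctx_ok G -> presents nu G ->
     forall s, ty_ok G (sphere_ty m.+1 nu s).
  move=> C nu G hG pG s; rewrite sphere_tyS; apply: ty_ok_arr.
  - by apply: IHs => //; exact: presents_base pG.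
  - exact: IHc.
  - by rewrite (svalP s); exact: IHc.
have h2 : (forall (C D : cpt (level m.+1)) (f : hom C D) (nu : gens C -> nat) mu G H d,
     ctx_ok H -> presents nu G -> presents mu H ->
     (forall g, sub_at d (nu g) = Some (hom_tm m.+1 f mu g)) ->
     forall g, tm_ok H (hom_tm m.+1 f mu g) (ty_sub (gen_ty m.+1 nu g) d)).
  move=> C D f nu mu G H d hH pG pH hd [g|v].
    apply: (IHh _ _ (nbase f) (fun g => nu (inl g)) (fun g => mu (inl g)) G) => //.
    - exact: presents_base pG.
    - exact: presents_base pH.
  have E := (@translate_natural m _ _ (nbase f) _ _ d (fun g => hd (inl g))).1 (attach v).
  have := IHc _ _ _ hH pH (ngen f v); rewrite ngen_bdry E; exact.
by split=> //; split=> // C nu G hG pG c; exact: cells (svalP c).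
Qed.

(** * Stokes' formula and acyclicity *)

Lemma psum_le B k g h : (forall p, g p <= h p) -> psum B k g <= psum B k h.
Proof.
move=> gh; have -> : h = fun p => g p + (h p - g p) by apply/funext => p; rewrite subnKC.
by rewrite psumD leq_addr.
Qed.

Section Weigh.
Variables (m : nat) (S : stage m).

(** The additive extension of [w] to cells: the m-dimensional generators of a cell are counted with
    multiplicity. *)
Fixpoint weigh (X : gset) (w : X m -> nat) (c : precell (nfree S X)) : nat :=
  match c with
  | pvar v => w v
  | pcoh B A f fV => psum B m (fun p => weigh w (fV p))
  end.

Lemma weigh_map (X Y : gset) (g : nhom (nfree S X) (nfree S Y)) (w : Y m -> nat) c :
  weigh w (precell_map g c) = weigh (fun v : X m => weigh w (sval (ngen g v))) c.
Proof. by elim: c => //= B A f fV IH; apply: eq_psum. Qed.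

Lemma eq_weigh (X : gset) (w w' : X m -> nat) (c : precell (nfree S X)) :
  (forall v, presupp c v -> w v = w' v) -> weigh w c = weigh w' c.
Proof.
elim: c => /= [v|B A f fV IH] ww'; first exact: ww'.
by apply: eq_psum => p; apply: IH => v hv; apply: ww'; exists p.
Qed.

Lemma weighD (X : gset) (w w' : X m -> nat) (c : precell (nfree S X)) :
  weigh (fun v => w v + w' v) c = weigh w c + weigh w' c.
Proof. by elim: c => //= B A f fV IH; rewrite -psumD; apply: eq_psum. Qed.

Lemma weigh_gt0 (X : gset) (w : X m -> nat) (c : precell (nfree S X)) v :
  presupp c v -> 0 < w v -> 0 < weigh w c.
Proof.
move=> + wv; elim: c => /= [u <-|B A f fV IH [p _ /IH hp]] //.
exact: psum_gt0 hp.
Qed.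

Lemma weigh_le (X : gset) (w w' : X m -> nat) (c : precell (nfree S X)) :
  (forall v, w v <= w' v) -> weigh w c <= weigh w' c.
Proof. by move=> ww'; elim: c => /= [v|B A f fV IH] //; apply: psum_le. Qed.

End Weigh.

Definition cell_end m (X : gset) (eps : bool) (c : cell (nfree (level m.+1) X)) :
    cell (nfree (level m) X) :=
  let s := sval (bdry c) in if eps then s.2 else s.1.

Lemma eq_bdsum eps B k (g h : pos B k -> nat) :
  (forall p, extremal eps p -> g p = h p) -> bdsum eps g = bdsum eps h.
Proof. by move=> gh; apply: eq_psum => p; apply: gh; exact: range_inc_subset. Qed.

(** Fullness speaks of supports only; this says that each position of the support occurs exactly
    once. *)
Definition full_weights m : Prop :=
  forall B eps (c : cell (nfree (level m) (pos B))),
    supp c = [set p | extremal eps p] -> full (level m) (bdry c) ->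
    forall W, weigh W (sval c) = bdsum eps W.

(* Stokes' formula, with terms moved so that no subtraction occurs. *)
Lemma weigh_bdry m : full_weights m -> forall (X : gset) (w : X m -> nat)
    (c : cell (nfree (level m.+1) X)),
  weigh (fun v : X m.+1 => w (tgt v)) (sval c) + weigh w (sval (cell_end false c)) =
  weigh (fun v : X m.+1 => w (src v)) (sval c) + weigh w (sval (cell_end true c)).
Proof.
move=> hM X w; elim/cell_var_coh_ind => [v|m_gt0 B dimB A fullA f IH].
  by rewrite /cell_end /=; exact: addnC.
rewrite /cell_end /= !weigh_map.
(* The ends of the coherence are images of the ends of [A]. As [A] is full, they weigh the sums of
   [W] over the source and the target of [B]. *)
pose W q := weigh w (sval (ngen (nbase f) q)).
have [f1 f2 f3] := fullA; rewrite !range_inc in f1 f2.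
have -> : weigh (fun v => weigh w (sval (ngen (nbase f) v))) (sval (sval A).1) = bdsum false W.
  exact: hM.
have -> : weigh (fun v => weigh w (sval (ngen (nbase f) v))) (sval (sval A).2) = bdsum true W.
  by apply: hM => //; rewrite -(svalP A).
have {}IH p : weigh (fun v : X m.+1 => w (tgt v)) (sval (ngen f p)) + W (src p) =
    weigh (fun v : X m.+1 => w (src v)) (sval (ngen f p)) + W (tgt p).
  by have := IH p; rewrite /cell_end ngen_bdry.
(* Sum the formula for the values of [f] over all (m+1)-positions; they all lie on the boundary
   because of [dimB], so the sum of differences telescopes. *)
have := congr1 (psum B m.+1) (funext IH); rewrite !psumD.
have := bdsum_telescope false W; rewrite -!(psum_bdsum _ _ dimB).
set t1 := psum _ _ _; set t2 := psum _ _ _; set t3 := psum _ _ _; set t4 := psum _ _ _.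
lia.
Qed.

(** Induction alternating with Stokes' formula. A [potential] of [W] moves its weight to the ends of
    [c], where the multiplicities are known, and [bdsum_telescope] brings the sum back to [W]. *)
Lemma full_weightsP m : full_weights m.
Proof.
elim: m => [|m IH] B eps c hs hf W.
  case: c hs {hf} => -[v|B' A f fV] cc hs; last by case: (cc).
  have Ev : bat_inc eps 0 B 0 (fst_pt (pos (bat_bd 0 B))) = v.
    have : [set p | extremal eps p] (bat_inc eps 0 B 0 (fst_pt (pos (bat_bd 0 B)))).
      exact: range_inc_subset.
    by rewrite -hs.
  by rewrite /= -Ev /bdsum; case: (B) W {Ev hs} => Bs.
have [w hw] := potential eps W.
have [f1 f2 f3] := hf; rewrite !range_inc in f1 f2.
have := weigh_bdry IH w c.
rewrite (IH _ false) // (IH _ true) //; last by rewrite -(svalP (bdry c)).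
have -> : weigh (fun v : pos B m.+1 => w (tgt v)) (sval c) =
   weigh W (sval c) + weigh (fun v : pos B m.+1 => w (src v)) (sval c).
  rewrite -weighD; apply: eq_weigh => v hv; apply: hw.
  by rewrite -[extremal _ _]/([set p | extremal eps p] v) -hs.
have := bdsum_telescope eps w.
have -> : bdsum eps (fun p => w (tgt p)) = bdsum eps W + bdsum eps (fun p => w (src p)).
  by rewrite /bdsum -psumD; apply: (@eq_bdsum eps B m.+1 (fun p => w (tgt p)) (fun p => W p + w (src p))).
lia.
Qed.

Lemma weigh_upset m B (z : pos B m.+1) : exists w : pos B m -> nat,
  [/\ forall q, w q <= `[< parallel q (tgt z) >], w (tgt z) = 1, w (src z) = 0 &
   forall c : cell (nfree (level m.+1) (pos B)),
     weigh (fun q : pos B m.+1 => `[< parallel q z >] : nat) (sval c) +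
       weigh w (sval (cell_end false c)) =
     weigh w (sval (cell_end true c))].
Proof.
have [w [w1 w2 w3]] := upset_weight z; exists w; split=> //.
  by move: w2; rewrite w3 asboolT // addn1 => -[].
move=> c; have := weigh_bdry (@full_weightsP m) w c.
have -> : weigh (fun v : pos B m.+1 => w (tgt v)) (sval c) =
   weigh (fun v : pos B m.+1 => w (src v)) (sval c) +
   weigh (fun q : pos B m.+1 => `[< parallel q z >] : nat) (sval c).
  by rewrite -weighD; apply: eq_weigh => v _; exact: w3.
by rewrite -addnA => /addnI.
Qed.

(** By [weigh_upset], the class of [z] weighs in [c] at most what the class of [tgt z] weighs in the
    target of [c]. In dimension 0 a cell is a single generator. *)
Lemma weigh_parallel m B (z : pos B m) (c : cell (nfree (level m) (pos B))) :
  weigh (fun q : pos B m => `[< parallel q z >] : nat) (sval c) <= 1.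
Proof.
elim: m z c => [|m IH] z c.
  by case: c => -[v|B' A f fV] cc /=; [exact: leq_b1|case: cc].
have [w [w1 _ _ w3]] := weigh_upset z.
apply: leq_trans (IH (tgt z) (cell_end true c)).
apply: leq_trans (weigh_le _ w1).
by rewrite -w3 leq_addr.
Qed.

(* If tgt p were in the source, then by Stokes' formula for the weight w at p  *)
(* the target would meet the class of positions parallel to tgt p twice.      *)
Lemma supp_end_disjoint m B eps (c : cell (nfree (level m.+1) (pos B))) p :
  supp c p -> ~ supp (cell_end eps c) (bdp (~~ eps) p).
Proof.
move=> hp; have [w [w1 wt ws w3]] := weigh_upset p; have {w3} := w3 c.
have wc : 0 < weigh (fun q : pos B m.+1 => `[< parallel q p >] : nat) (sval c).
  by apply: weigh_gt0 hp _; rewrite asboolT.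
have wb := weigh_parallel (tgt p) (cell_end true c).
case: eps => E hb.
  (* Now [src p] lies in the target. It is parallel to [tgt p] but has weight 0 under [w], while
     Stokes' formula already gives the target positive weight under [w]: again the class weighs at
     least two. *)
  have : 0 < weigh (fun q : pos B m => `[< parallel q (tgt p) >] - w q)
      (sval (cell_end true c)).
    apply: weigh_gt0 hb _; rewrite ws asboolT //.
    by case: (m) p {c hp w w1 wt ws wc wb E} => // k p; rewrite /= src_tgt tgt_src.
  move=> w2; move: wb.
  rewrite (_ : (fun q : pos B m => _) = fun q : pos B m =>
    w q + (`[< parallel q (tgt p) >] - w q)); last by apply/funext => q; rewrite subnKC.
  rewrite weighD; lia.
have wa : 0 < weigh w (sval (cell_end false c)) by apply: weigh_gt0 hb _; rewrite wt.
have := leq_trans (weigh_le (sval (cell_end true c)) w1) wb.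
lia.
Qed.

Lemma sub_tm_vars d :
  (forall t x, tm_vars (tm_sub t d) x <->
     exists2 z, tm_vars t z & tm_vars (tm_sub (Var z) d) x) /\
  (forall g x, sub_vars (sub_comp g d) x <->
     exists2 z, sub_vars g z & tm_vars (tm_sub (Var z) d) x).
Proof.
apply: tm_sub_mut => [z|G A g IH|//|g IHg t IHt] x.
- by split=> [|[y ->]] //; exists z.
- exact: IH.
- by split=> // -[].
- split=> [[/IHg|/IHt] [z hz hx]|[z [hz|hz] hx]].
  + by exists z => //; left.
  + by exists z => //; right.
  + by left; apply/IHg; exists z.
  + by right; apply/IHt; exists z.
Qed.

Lemma sub_ty_vars d A x : ty_vars (ty_sub A d) x <->
  exists2 z, ty_vars A z & tm_vars (tm_sub (Var z) d) x.
Proof.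
elim: A => [|A IH u v] /=; first by split=> // -[].
split=> [[[/IH|/(sub_tm_vars d).1]|/(sub_tm_vars d).1] [z hz hx]|[z [[hz|hz]|hz] hx]].
- by exists z => //; left; left.
- by exists z => //; left; right.
- by exists z => //; right.
- by left; left; apply/IH; exists z.
- by left; right; apply/(sub_tm_vars d).1; exists z.
- by right; apply/(sub_tm_vars d).1; exists z.
Qed.

Lemma total_vars_map m B B' (h : nhom (nfree (level m) (pos B)) (nfree (level m) (pos B'))) d :
  (forall g, sub_at d (pos_var B m.+1 g) = Some (hom_tm m.+1 (C := nfree (level m) (pos B)) (D := nfree (level m) (pos B')) h (pos_var B' m.+1) g)) ->
  forall c x, total_vars (cell_map h c) x <->
    exists2 z, total_vars c z & tm_vars (tm_sub (Var z) d) x.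
Proof.
move=> hd c x; rewrite /total_vars.
have -> : cell_tm m (pos_var B' m.+1) (sval (cell_map h c)) =
    tm_sub (cell_tm m (pos_var B m.+1) (sval c)) d by exact: cell_tm_natural hd _.
have -> : sphere_ty m (pos_var B' m) (bdry (cell_map h c)) =
    ty_sub (sphere_ty m (pos_var B m) (bdry c)) d.
  rewrite bdry_map.
  exact: (@translate_natural m _ _ (nbase h) (pos_var B m) (pos_var B' m) d (fun g => hd (inl g))).1.
split=> [[/(sub_tm_vars d).1|/sub_ty_vars] [z hz hx]|[z [hz|hz] hx]].
- by exists z => //; left.
- by exists z => //; right.
- by left; apply/(sub_tm_vars d).1; exists z.
- by right; apply/sub_ty_vars; exists z.
Qed.

(** * The side condition implies fullness *)

Lemma cell_okP m B (c : cell (nfree (level m) (pos B))) : cell_ok c.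
Proof.
have [_ [_ h]] := soundness m.
exact: (h (nfree (level m) (pos B)) _ _ (bctx_ok B) (presents_bctx B m.+1) c).
Qed.

Lemma total_vars_var m B (p : pos B m) x :
  total_vars (cvar (C := nfree (level m) (pos B)) p) x <->
  x = pname B p \/ ty_vars (cell_ty (@pname B) Star p) x.
Proof. by rewrite /total_vars /bdry /= sphere_ty_pole. Qed.

Lemma cell_end_var m B eps (p : pos B m.+1) :
  cell_end eps (cvar (C := nfree (level m.+1) (pos B)) p) = cvar (C := nfree (level m) (pos B)) (bdp eps p).
Proof. by rewrite /cell_end; case: eps. Qed.

Lemma cell_end_ccoh m B B' (m_gt0 : 0 < m.+1) (dimB : bat_dim B <= m.+1) A fullA
   (f : nhom (nfree (level m.+1) (pos B)) (nfree (level m.+1) (pos B'))) eps :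
  cell_end eps (ccoh m_gt0 dimB (A := A) fullA f) =
  cell_map (nbase f) (if eps then (sval A).2 else (sval A).1).
Proof. by rewrite /cell_end; case: eps. Qed.

Lemma total_vars_end m B eps (c : cell (nfree (level m.+1) (pos B))) :
  total_vars (cell_end eps c) `<=` total_vars c.
Proof. exact: total_vars_bdry. Qed.

(** For a coherence over B', variables on the [eps]-boundary of B' map into the [eps]-end. The
    remaining positions of dimension m are reached from there by [pos_descent], crossing one value
    of [f] at a time. *)
Lemma total_vars_sub m B eps (c : cell (nfree (level m.+1) (pos B))) x :
  total_vars c x -> total_vars (cell_end eps c) x \/
    exists2 p, supp c p & x = pname B p \/ x = pname B (bdp (~~ eps) p).
Proof.
elim/cell_var_coh_ind: c x => [v|m_gt0 B' dimB A fullA f IH] x.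
  rewrite cell_end_var => /total_vars_var [->|]; first by right; exists v => //; left.
  have hb b : ty_vars (cell_ty (@pname B) Star (bdp b v)) = ty_vars (cell_ty (@pname B) Star (bdp (~~ b) v)).
    case: (m) v => // k v; rewrite /= (bdp_glob false b v : src (bdp b v) = src (bdp (~~ b) v)).
    by rewrite (bdp_glob true b v : tgt (bdp b v) = tgt (bdp (~~ b) v)).
  case=> [[]|] hx.
  - left; apply/total_vars_var; right; move: hx; case: (eps) => //.
    by rewrite (hb true).
  - case: eps; last by left; apply/total_vars_var; left.
    by right; exists v => //; right.
  - case: eps; first by left; apply/total_vars_var; left.
    by right; exists v => //; right.
pose d := assemble (pos_var B' m.+2) (fun g => hom_tm m.+2
   (C := nfree (level m.+1) (pos B')) (D := nfree (level m.+1) (pos B)) f (pos_var B m.+2) g) (len (bctx B')).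
have hd (g : gens (free (level m.+2) (pos B'))) : sub_at d (pos_var B' m.+2 g) = Some (hom_tm m.+2
   (C := nfree (level m.+1) (pos B')) (D := nfree (level m.+1) (pos B)) f (pos_var B m.+2) g).
  by apply: sub_at_assemble_inj; [exact: pos_var_inj|exact: pos_var_lt].
have mapf := total_vars_map hd.
have hdb (g : gens (free (level m.+1) (pos B'))) : sub_at d (pos_var B' m.+1 g) = Some (hom_tm m.+1
   (C := nfree (level m) (pos B')) (D := nfree (level m) (pos B)) (nbase f) (pos_var B m.+1) g).
  exact: (hd (inl g)).
have mapb := total_vars_map hdb.
pose U z := tm_vars (tm_sub (Var z) d).
set c := ccoh _ _ _ _.
pose good x := total_vars (cell_end eps c) x \/
    exists2 p, supp c p & x = pname B p \/ x = pname B (bdp (~~ eps) p).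
have [f1 f2 f3] := fullA; rewrite !range_inc in f1 f2.
have vA : total_vars (if eps then (sval A).2 else (sval A).1) = bdset eps m B'.
  case: (eps); apply: total_vars_full => //; try exact: cell_okP.
  by rewrite -(svalP A).
have goodA z : bdset eps m B' z -> U z `<=` good.
  move=> hz y hy; left; rewrite cell_end_ccoh; apply/mapb; exists z => //.
  by rewrite vA.
have Utop (p : pos B' m.+1) : U (pname B' p) `<=` total_vars (ngen f p).
  move=> y hy; left; move: hy; rewrite /U /= -[pname B' p]/(pos_var B' m.+2 (inr p)).
  by rewrite hd.
(* The induction hypothesis for the value of [f] at [p]; its [eps]-end is the image of [bdp eps p],
   up to variables of lower positions, which are good. *)
have step (p : pos B' m.+1) : total_vars (ngen f p) `<=` U (pname B' (bdp eps p)) `|` good.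
  move=> y /IH [|[q hq Eq]]; last by right; right; exists q => //; exists p.
  rewrite /cell_end ngen_bdry.
  have -> : (if eps then (sval (sph_map (nbase f) (attach (n := nfree (level m.+1) (pos B')) p))).2
    else (sval (sph_map (nbase f) (attach (n := nfree (level m.+1) (pos B')) p))).1) =
    cell_map (nbase f) (cvar (C := nfree (level m) (pos B')) (bdp eps p)) by case: (eps).
  move=> /mapb [z /total_vars_var [-> //|hz] hy]; first by left.
  right; apply: (goodA z) hy.
  case: (m) (bdp eps p) hz => // k q hz.
  have {hz} : exists j (r : pos B' j), j < k.+1 /\ z = pname B' r.
    move: hz; rewrite -sphere_ty_pole => /(translate_vars k.+1).1 [g ->].
    by have [j [r [jk E]]] := pos_var_pname g; exists j, r.
  by move=> [j [r [jk ->]]]; exists j, r; split=> //; left.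
have base k (q : pos B' k) : k <= m -> U (pname B' q) `<=` good.
  rewrite leq_eqVlt => /predU1P[E|km]; last first.
    by apply: goodA; exists k, q; split=> //; left.
  subst k; elim/(@pos_descent eps): q => [q hq|p hp].
    by apply: goodA; exists m, q; split=> //; right.
  move=> y hy; have : total_vars (ngen f p) y.
    apply: (total_vars_end (eps := ~~ eps)); rewrite /cell_end ngen_bdry.
    have -> : (if ~~ eps then (sval (sph_map (nbase f) (attach (n := nfree (level m.+1) (pos B')) p))).2
      else (sval (sph_map (nbase f) (attach (n := nfree (level m.+1) (pos B')) p))).1) =
      cell_map (nbase f) (cvar (C := nfree (level m) (pos B')) (bdp (~~ eps) p)) by case: (~~ eps).
    by apply/mapb; exists (pname B' (bdp (~~ eps) p)) => //; apply/total_vars_var; left.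
  by move=> /step [/hp|].
have all_good k (q : pos B' k) : U (pname B' q) `<=` good.
  have := leq_trans (pos_dim_le q) dimB; rewrite leq_eqVlt => /predU1P[E|km]; last exact: base.
  by subst k => y /Utop/step [/base|]; last by []; apply.
suff : sub_vars d x -> good x.
  move=> h hx; apply: h; case: hx => [|hx]; first by [].
  apply: (@ty_sub_vars d (sphere_ty m.+1 (pos_var B' m.+1) A)).
    move=> y /(translate_vars m.+1).1 [g ->]; rewrite /mkset slen_assemble; exact: pos_var_lt.
  have E := (@translate_natural m.+1 _ _ (nbase f) (pos_var B' m.+1) (pos_var B m.+1) d hdb).1 A.
  by rewrite -E.
move=> /mem_set/assemble_vars [g [_ hx]].
have [k [p [_ Ep]]] := pos_var_pname g.
by apply: (all_good k p); rewrite /U -Ep /= hd.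
Qed.

Lemma bdset_dim eps m B k (p : pos B k) :
  bdset eps m B (pname B p) <-> k < m \/ k = m /\ extremal eps p.
Proof.
split=> [[j [q [/pname_inj E h]]]|h]; last by exists k, p.
have Ek : k = j := congr1 (@projT1 _ _) E; subst j.
by rewrite (existT_pos_inj E).
Qed.

Lemma total_vars_pname m B (c : cell (nfree (level m) (pos B))) k (p : pos B k) :
  total_vars c (pname B p) -> k <= m.
Proof.
move=> /total_vars_base [[j [q [jm /pname_inj E]]]|[q _ /pname_inj E]].
  by rewrite (congr1 (@projT1 _ _) E : k = j) ltnW.
by rewrite (congr1 (@projT1 _ _) E : k = m).
Qed.

(** By induction it suffices that both ends of [c] have the right variables. An excess position in
    an end would be the opposite end of a supporting one, against [supp_end_disjoint]; none is
    missing by [total_vars_sub]. *)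
Lemma bdset_full m B eps (c : cell (nfree (level m) (pos B))) :
  total_vars c = bdset eps m B ->
  supp c = [set p | extremal eps p] /\ full (level m) (bdry c).
Proof.
elim: m eps c => [|m IH] eps c hc.
  split=> //; apply/seteqP; split=> p /=.
    by move=> /supp_total_vars; rewrite hc => /bdset_dim [//|[]].
  by move=> hp; apply/supp_total_vars; rewrite hc; apply/bdset_dim; right.
have sc : supp c = [set p | extremal eps p].
  apply/seteqP; split=> p /=.
    by move=> /supp_total_vars; rewrite hc => /bdset_dim [|[]//]; rewrite ltnn.
  by move=> hp; apply/supp_total_vars; rewrite hc; apply/bdset_dim; right.
split=> //.
have he e : total_vars (cell_end e c) = bdset e m B.
  apply/seteqP; split=> x.
    move=> /total_vars_base [[k [p [km ->]]]|[p hp ->]]; apply/bdset_dim; [by left|right; split=> //].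
    move=> q E; have [q' [hq' Eq']] := extremal_parallel eps (~~ e) q.
    have : supp c q' by rewrite sc.
    by move=> /(supp_end_disjoint (eps := e)); apply; rewrite Eq' -E.
  move=> [k [p [-> hp]]].
  have : total_vars c (pname B p).
    by rewrite hc; apply/bdset_dim; left; case: hp => [/leqW|[/eq_leq]].
  move=> /(total_vars_sub e) [//|[q _ [] /pname_inj E]].
    have Ek : k = m.+1 := congr1 (@projT1 _ _) E.
    exfalso; have {hp} : k <= m by case: hp => [/ltnW|[/eq_leq]].
    by rewrite Ek ltnn.
  have Ek : k = m := congr1 (@projT1 _ _) E; subst k.
  case: hp => [|[_ hp]]; first by rewrite ltnn.
  by case: (hp q); exact: existT_pos_inj.
have [s1 f1] := IH false _ (he false); have [s2 f2] := IH true _ (he true).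
by split=> //; rewrite range_inc.
Qed.

(** The side condition mentions the dimension of the context but not that of the cells, so the main
    point is to compare the two. *)
Lemma coh_side_full m B (s : sphere (free (level m.+1) (pos B))) (d : ps (bctx B)) :
  coh_side d (sphere_ty m (pos_var B m) (bdry (sval s).1))
    (cell_tm m (pos_var B m.+1) (sval (sval s).1))
    (cell_tm m (pos_var B m.+1) (sval (sval s).2)) ->
  full (level m.+1) s /\ bat_dim B <= m.+1.
Proof.
have E := svalP s.
have E2 : tm_vars (cell_tm m (pos_var B m.+1) (sval (sval s).2)) `|`
  ty_vars (sphere_ty m (pos_var B m) (bdry (sval s).1)) = total_vars (sval s).2 by rewrite E.
have fullP : total_vars (sval s).1 = bdset false m B ->
  total_vars (sval s).2 = bdset true m B -> full (level m.+1) s.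
  move=> /bdset_full [h1 h3] /bdset_full [h2 _].
  by split=> //; rewrite range_inc.
case=> [[k []]|[]]; rewrite E2; last first.
  move=> v1 v2; have hB : bat_dim B <= m.
    have [p _] := pos_dim_max B.
    by apply: (@total_vars_pname m B (sval s).1 _ p); rewrite -[total_vars _]v1; exact: pname_lt.
  split; last exact: leqW.
  by apply: fullP; rewrite bdset_all.
rewrite ctx_dim_bctx => -[dimB]; rewrite !bd_sub_bctx => v1 v2.
(* A top position [q] whose source is extremal: its source belongs to the k-source but not to the
   k-target, and detects k. *)
have [p0 _] := pos_dim_max B; rewrite dimB in p0.
have [q hq] := extremal_source false p0.
have q1 : total_vars (sval s).1 (pname B (bdp false q)).
  by rewrite -[total_vars _]v1; apply/bdset_dim; right.
have km := total_vars_pname q1.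
move: km; rewrite leq_eqVlt => /predU1P[Ek|km].
  by subst k; split; [apply: fullP|rewrite dimB].
(* If k < m, neither cell has a variable in its top dimension, so their common boundary contains all
   the variables of both. The target would then contain the source of [q]. *)
exfalso; case: m s E E2 fullP v1 v2 q1 km => // m s E E2 fullP v1 v2 q1 km.
have sub (c c' : cell (nfree (level m.+1) (pos B))) b : bdry c = bdry c' ->
    total_vars c = bdset b k B -> total_vars c `<=` total_vars c'.
  move=> Ec hc x /(total_vars_sub false) [|[p /supp_total_vars]].
    by have h := @total_vars_end _ _ false c'; rewrite /cell_end Ec => /h.
  rewrite hc => /bdset_dim [h|[h]]; last by rewrite h ltnn in km.
  by have := ltn_trans h km; rewrite ltnn.
have : total_vars (sval s).2 (pname B (bdp false q)) := sub _ _ false E (esym v1) _ q1.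
by rewrite -v2 => /bdset_dim [|[_ /(_ q)]] //; rewrite ltnn.
Qed.

(** * Every well-typed term comes from a cell *)

Lemma ty_sub_dim A d : ty_dim1 (ty_sub A d) = ty_dim1 A.
Proof. by elim: A => //= A ->. Qed.

(** Quantified over all computads presented by [G], so that in [completeness] the hypotheses for the
    ends of a coherence apply to the free computad on a tree. *)
Definition denotable (G : ctx) (t : tm) (k : nat) : Prop :=
  forall (C : cpt (level k.+1)) (nu : gens C -> nat), presents nu G ->
    exists c : cell C, cell_tm k nu (sval c) = t.

(** The values have the required boundary because types are unique and the translation of spheres is
    injective. *)
Lemma hom_of_sub m (E C : cpt (level m)) (mu : gens E -> nat) (nu : gens C -> nat) H G g :
  ctx_ok G -> presents mu H -> presents nu G -> sub_ok G g H ->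
  (forall x A t, ctx_at H x = Some A -> sub_at g x = Some t -> denotable G t (ty_dim1 A)) ->
  exists f : hom E C, forall v, sub_at g (mu v) = Some (hom_tm m f nu v).
Proof.
move=> hG + + hg den; elim: m E C mu nu => [|m IH] E C mu nu pH pG; first by exists tt; case.
have [f hf] := IH (base E) (base C) _ _ (presents_base pH) (presents_base pG).
have [_ atH _] := pH.
have ex (v : gen E) : exists c : cell C, sub_at g (mu (inr v)) = Some (cell_tm m nu (sval c)).
  have [t ht _] := sub_at_ok hg (atH (inr v)).
  have := den _ _ _ (atH (inr v)) ht; rewrite /= sphere_ty_dim => /(_ C nu pG) [c hc].
  by exists c; rewrite hc.
pose c v := projT1 (cid (ex v)).
have hc v : sub_at g (mu (inr v)) = Some (cell_tm m nu (sval (c v))) := projT2 (cid (ex v)).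
have hb v : bdry (c v) = sph_map f (attach v).
  apply: (translate_inj m).1; first by have [nu_inj _ _] := presents_base pG; exact: nu_inj.
  rewrite (translate_natural hf).1.
  have [t] := sub_at_ok hg (atH (inr v)); rewrite hc => -[<-] ht.
  exact: tm_ok_uniq ((soundness m).2.2 _ _ _ hG pG (c v)) ht.
exists (NHom hb) => -[v|v]; first exact: hf.
exact: hc.
Qed.

Lemma completeness :
  (forall G, ctx_ok G -> True) /\ (forall G A, ty_ok G A -> True) /\
  (forall G t A, tm_ok G t A -> denotable G t (ty_dim1 A)) /\
  (forall D g G, sub_ok D g G -> forall x A t, ctx_at G x = Some A ->
     sub_at g x = Some t -> denotable D t (ty_dim1 A)).
Proof.
apply: ok_mut => //.
- move=> G x A _ _ hx C nu [_ nu_at nu_surj].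
  have [[g|v] Ev] := nu_surj x A hx (ltnSn _); last by exists (cvar v); rewrite cell_tm_var Ev.
  have := nu_at (inl g); rewrite Ev hx => -[EA].
  by have := gen_ty_dim (fun g => nu (inl g)) g; rewrite -EA ltnn.
- move=> G d A u v D g hu IHu hv IHv hg IHg side.
  rewrite ty_sub_dim => C nu pD.
  have [B EB] := ps_bctx d; subst G; set m := ty_dim1 A in IHu IHv C nu pD *.
  have [cu hcu] := IHu (free (level m.+1) (pos B)) _ (presents_bctx B m.+1).
  have [cv hcv] := IHv (free (level m.+1) (pos B)) _ (presents_bctx B m.+1).
  have tyu : sphere_ty m (pos_var B m) (bdry cu) = A.
    by apply: tm_ok_uniq hu; rewrite -hcu; exact: cell_okP.
  have tyv : sphere_ty m (pos_var B m) (bdry cv) = A.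
    by apply: tm_ok_uniq hv; rewrite -hcv; exact: cell_okP.
  have Eb : bdry cu = bdry cv.
    by apply: ((translate_inj m).1 _ _ (@pos_var_inj B m)); rewrite tyu tyv.
  pose s : sphere (free (level m.+1) (pos B)) := exist _ (cu, cv) Eb.
  have [fs dimB] : full (level m.+1) s /\ bat_dim B <= m.+1.
    by apply: (@coh_side_full m B s d); rewrite /= tyu hcu hcv.
  have hD := sub_ok_src hg.
  have [f hf] := hom_of_sub hD (presents_bctx B m.+2) pD hg IHg.
  exists (ccoh (C := C) isT dimB fs f).
  rewrite cell_tm_coh sphere_tyS [sval s]/= hcu hcv tyu; congr Coh.
  apply: sub_eq; first by rewrite slen_assemble (sub_ok_len hg).
  move=> i; rewrite slen_assemble => hi.
  have [k [p Ei]] := pname_surj hi; subst i.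
  have [|w Ew] := @pname_pos_var B m.+2 k p.
    by rewrite ltnS; exact: leq_trans (pos_dim_le p) dimB.
  rewrite -Ew hf (sub_at_assemble_inj (@pos_var_inj B m.+2)); last exact: pos_var_lt.
  by case: w {Ew}.
- move=> D g G A t hg IHg _ _ ht IHt x B s /=.
  rewrite (sub_ok_len hg); case: eqP => [_ [<-] [<-]|_]; first by rewrite -(ty_sub_dim A g).
  exact: IHg.
Qed.

Lemma sphere_of_ty G A : ty_ok G A ->
  forall (C : cpt (level (ty_dim1 A))) (nu : gens C -> nat), presents nu G ->
    exists s : sphere C, sphere_ty (ty_dim1 A) nu s = A.
Proof.
case: A => [|A u v] hA C nu pG; first by exists tt.
have [_ hu hv] := ty_ok_arr_inv hA; have hG := ty_ok_ctx hA.
have [cu hcu] := completeness.2.2.1 _ _ _ hu C nu pG.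
have [cv hcv] := completeness.2.2.1 _ _ _ hv C nu pG.
have tyu := tm_ok_uniq ((soundness _).2.2 _ _ _ hG pG cu).
have tyv := tm_ok_uniq ((soundness _).2.2 _ _ _ hG pG cv).
rewrite hcu in tyu; rewrite hcv in tyv.
have Eb : bdry cu = bdry cv.
  apply: (translate_inj _).1; first by have [nu_inj _ _] := presents_base pG; exact: nu_inj.
  by rewrite (tyu _ hu) (tyv _ hv).
exists (exist _ (cu, cv) Eb).
by rewrite [ty_dim1 _]/= sphere_tyS /= hcu hcv (tyu _ hu).
Qed.

(** * Homomorphisms as substitutions *)

Section GensCast.
Variables (m : nat).
Implicit Types a b : cpt (level m).

(** Truncations of a computad agree by an equality of objects, along which generators must be
    transported. *)
Definition gens_cast a a' (e : a = a') (g : gens a) : gens a' :=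
  match e in _ = a1 return gens a1 with erefl => g end.

Lemma gens_cast_inj a a' (e : a = a') : injective (gens_cast e).
Proof. by case: a' / e => ? ?. Qed.

Lemma gens_cast_surj a a' (e : a = a') g : exists g0, gens_cast e g0 = g.
Proof. by case: a' / e g => g; exists g. Qed.

Lemma gen_ty_cast a a' (e : a = a') nu g :
  gen_ty m (fun g => nu (gens_cast e g)) g = gen_ty m nu (gens_cast e g).
Proof. by case: a' / e nu. Qed.

Lemma presents_cast a a' (e : a = a') (nu : gens a' -> nat) G :
  presents nu G -> presents (fun g => nu (gens_cast e g)) G.
Proof. by case: a' / e nu. Qed.

Lemma hom_tm_cast a a' b b' (ea : a = a') (eb : b = b') (f : hom a b) nu g :
  hom_tm m (hom_cast ea eb f) nu (gens_cast ea g) =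
  hom_tm m f (fun g => nu (gens_cast eb g)) g.
Proof. by case: a' / ea; case: b' / eb nu. Qed.

End GensCast.

Definition all_gens (C : computad) : Type := {n & generator C n}.

Fixpoint gens_total (C : computad) m : gens (trunc C m) -> all_gens C :=
  match m with
  | 0 => of_void _
  | m'.+1 => fun g =>
      match g with
      | inl g => gens_total (gens_cast (trunc_base C m') g)
      | inr v => existT _ m' v
      end
  end.

Arguments gens_total C m g : clear implicits.

Lemma gens_total_dim C m g : projT1 (gens_total C m g) < m.
Proof. by elim: m g => [|m IH] [] //= g; exact/leqW/IH. Qed.

Lemma gens_total_inj C m : injective (gens_total C m).
Proof.
elim: m => [|m IH]; first by case.
have neq g v : gens_total C m g <> existT _ m v.
  by move=> E; have := gens_total_dim g; rewrite E /= ltnn.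
move=> [g|v] [g'|v'] /=.
- by move=> /IH /gens_cast_inj ->.
- by move=> /neq.
- by move=> /esym/neq.
- by move=> E; rewrite (Eqdep_dec.inj_pair2_eq_dec _ PeanoNat.Nat.eq_dec _ _ _ _ E).
Qed.

Lemma gens_total_surj C m v : projT1 v < m -> exists g, gens_total C m g = v.
Proof.
elim: m => // m IH; rewrite ltnS leq_eqVlt => /predU1P[|/IH [g <-]].
  by case: v {IH} => n v /= E; subst n; exists (inr v).
by have [g0 <-] := gens_cast_surj (trunc_base C m) g; exists (inl g0).
Qed.

Section TotalNaming.
Variables (C : computad) (nu : all_gens C -> nat).

Definition level_naming m : gens (trunc C m) -> nat := fun g => nu (gens_total C m g).

Definition total_ty (v : all_gens C) : ty :=
  gen_ty (projT1 v).+1 (@level_naming (projT1 v).+1) (inr (projT2 v)).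

Lemma gen_ty_total m g : gen_ty m (@level_naming m) g = total_ty (gens_total C m g).
Proof.
elim: m g => [|m IH]; first by case.
by case=> [g|v] //; rewrite [gens_total _ _ _]/= -IH -gen_ty_cast.
Qed.

Lemma total_ty_dim v : ty_dim1 (total_ty v) = projT1 v.
Proof. by rewrite /total_ty /= sphere_ty_dim. Qed.

End TotalNaming.

Record presentation (G : ok_ctx) (C : computad) := Presentation {
  naming :> all_gens C -> nat;
  presentationP : forall m, presents (@level_naming C naming m) (sval G) }.

Section Presentation.
Variables (G : ok_ctx) (C : computad) (p : presentation G C).

Lemma naming_inj : injective p.
Proof.
move=> v w; have [m [vm wm]] : exists m, projT1 v < m /\ projT1 w < m.
  by exists (maxn (projT1 v) (projT1 w)).+1; rewrite !ltnS leq_maxl leq_maxr.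
have [g <-] := gens_total_surj vm; have [g' <-] := gens_total_surj wm.
by have [h _ _] := presentationP p m => /h ->.
Qed.

Lemma naming_lt v : p v < len (sval G).
Proof.
have [g <-] := gens_total_surj (ltnSn (projT1 v)).
exact: (presents_lt g (presentationP p _)).
Qed.

Lemma naming_surj x : x < len (sval G) -> exists v, p v = x.
Proof.
have: exists B, ctx_at (sval G) x = Some B \/ len (sval G) <= x.
  elim: (sval G) => [|G' IH B] /=; first by exists Star; right.
  case: eqP => [_|/eqP nx]; first by exists B; left.
  have [D [hD|hD]] := IH; exists D; [by left|right].
  by rewrite ltn_neqAle eq_sym nx.
move=> [B [hx _|h1 h2]]; last by have := leq_trans h2 h1; rewrite ltnn.
have [_ _ h] := presentationP p (ty_dim1 B).+1.
by have [g <-] := h x B hx (ltnSn _); exists (gens_total C _ g).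
Qed.

Lemma presentation_sub_eq s t : slen s = len (sval G) -> slen t = len (sval G) ->
  (forall m (g : gens (trunc C m)), sub_at s (level_naming p g) = sub_at t (level_naming p g)) ->
  s = t.
Proof.
move=> hs ht st; apply: sub_eq; first by rewrite hs ht.
move=> i; rewrite hs => /naming_surj [v <-].
have [g <-] := gens_total_surj (ltnSn (projT1 v)); exact: st.
Qed.

End Presentation.

Section HomSub.
Variables (G H : ok_ctx) (C D : computad) (p : presentation G C) (q : presentation H D).

Definition hom_entry (f : computad_hom C D) (v : all_gens C) : tm :=
  cell_tm (projT1 v) (@level_naming D q (projT1 v).+1)
    (sval (ngen (hom_trunc f (projT1 v).+1) (projT2 v))).

Definition hom_sub (f : computad_hom C D) : sub :=
  assemble p (hom_entry f) (len (sval G)).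

Lemma slen_hom_sub f : slen (hom_sub f) = len (sval G).
Proof. exact: slen_assemble. Qed.

Lemma hom_tm_total (f : computad_hom C D) m g :
  hom_tm m (hom_trunc f m) (@level_naming D q m) g = hom_entry f (gens_total C m g).
Proof.
elim: m g => [|m IH]; first by case.
case=> [g|v] //; rewrite [gens_total _ _ _]/= -IH -(hom_trunc_base f m).
by rewrite hom_tm_cast.
Qed.

Lemma sub_at_hom_sub f m (g : gens (trunc C m)) :
  sub_at (hom_sub f) (level_naming p g) = Some (hom_tm m (hom_trunc f m) (@level_naming D q m) g).
Proof.
by rewrite sub_at_assemble_inj ?hom_tm_total //; [exact: naming_inj|exact: naming_lt].
Qed.

Lemma hom_sub_ok f : sub_ok (sval H) (hom_sub f) (sval G).
Proof.
apply: sub_ok_intro; [exact: svalP|exact: svalP|exact: slen_hom_sub|].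
move=> x A hx; have [_ h1 h2] := presentationP p (ty_dim1 A).+1.
have [g Eg] := h2 x A hx (ltnSn _); rewrite -Eg.
exists (hom_tm _ (hom_trunc f (ty_dim1 A).+1) (@level_naming D q _) g); first exact: sub_at_hom_sub.
move: hx; rewrite -Eg h1 => -[EA]; rewrite -[X in ty_sub X _]EA.
apply: ((soundness (ty_dim1 A).+1).2.1 _ _ _ _ _ _ _ _ (svalP H) (presentationP p _) (presentationP q _)).
exact: sub_at_hom_sub.
Qed.

Definition hom_ok_sub (f : computad_hom C D) : ok_sub H G := exist _ (hom_sub f) (hom_sub_ok f).

Lemma hom_ok_sub_inj : injective hom_ok_sub.
Proof.
move=> f f' /(congr1 sval) /= E; apply: computad_hom_eq => m.
have [q_inj _ _] := presentationP q m; apply: (translate_inj m).2 q_inj _ _ _ => g.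
by have := sub_at_hom_sub f g; rewrite E sub_at_hom_sub => -[].
Qed.

(** Each truncation is found separately; injectivity of the translation forces them to be
    compatible. *)
Lemma hom_ok_sub_surj (s : ok_sub H G) : exists f, hom_ok_sub f = s.
Proof.
case: s => s hs; have ex m := hom_of_sub (svalP H) (presentationP p m) (presentationP q m) hs
  (completeness.2.2.2 _ _ _ hs).
pose F m := projT1 (cid (ex m)).
have hF m : forall v, sub_at s (level_naming p v) = Some (hom_tm m (F m) (@level_naming D q m) v).
  exact: projT2 (cid (ex m)).
have hFb m : hom_cast (trunc_base C m) (trunc_base D m) (nbase (F m.+1)) = F m.
  have [q_inj _ _] := presentationP q m; apply: (translate_inj m).2 q_inj _ _ _ => g.
  have [g0 <-] := gens_cast_surj (trunc_base C m) g; rewrite hom_tm_cast.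
  have := hF m (gens_cast (trunc_base C m) g0); have := hF m.+1 (inl g0).
  by rewrite hom_tm_inl => -> [].
exists (ComputadHom hFb); apply: eq_exist; apply: (presentation_sub_eq (p := p)).
- exact: slen_hom_sub.
- exact: sub_ok_len hs.
- by move=> m g; rewrite sub_at_hom_sub hF.
Qed.

End HomSub.

Lemma sub_at_id G x : x < len G -> sub_at (sub_id G) x = Some (Var x).
Proof.
rewrite -(sub_id_len G) => /sub_at_lt [t ht].
by rewrite ht (sub_id_at ht).
Qed.

Lemma sub_at_comp g d x : sub_at (sub_comp g d) x = omap (fun t => tm_sub t d) (sub_at g x).
Proof. by elim: g => //= g IH t; rewrite sub_comp_len; case: eqP. Qed.

Lemma hom_ok_sub_id G C (p : presentation G C) : hom_ok_sub p p (computad_id C) = ok_sub_id G.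
Proof.
apply: eq_exist; apply: (presentation_sub_eq (p := p)).
- exact: slen_hom_sub.
- exact: sub_id_len.
- move=> m g; rewrite sub_at_hom_sub sub_at_id ?hom_tm_id //; exact: naming_lt.
Qed.

Lemma hom_ok_sub_comp G H K C D E (p : presentation G C) (q : presentation H D)
    (r : presentation K E) (g : computad_hom D E) (f : computad_hom C D) :
  hom_ok_sub p r (computad_comp g f) = ok_sub_comp (hom_ok_sub p q f) (hom_ok_sub q r g).
Proof.
apply: eq_exist; apply: (presentation_sub_eq (p := p)).
- exact: slen_hom_sub.
- by rewrite /= sub_comp_len; exact: slen_hom_sub.
- move=> m v; rewrite sub_at_hom_sub /= sub_at_comp sub_at_hom_sub /=; congr Some.
  by apply: (translate_natural _).2 => w; exact: sub_at_hom_sub.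
Qed.

(** * Presentations of contexts and of finite computads *)

(** Sorts by [d]. With [d] the dimension, lower-dimensional generators are listed first. *)
Lemma finite_numbering (T : Type) (d : T -> nat) : finite_set [set: T] ->
  exists (N : nat) (e : T -> nat), [/\ injective e, forall v, e v < N,
    forall i, i < N -> exists v, e v = i & forall v w, d v < d w -> e v < e w].
Proof.
move=> /(@finite_seqP {classic T}) [s0 hs0].
pose leT (v w : {classic T}) := d v <= d w.
pose s := sort leT (undup s0).
have us : uniq s by rewrite sort_uniq undup_uniq.
have ms (v : {classic T}) : v \in s.
  rewrite mem_sort mem_undup; have : [set: {classic T}] v by [].
  by rewrite hs0.
exists (size s), (fun v => index (v : {classic T}) s); split.
- by move=> v w; exact: index_inj.
- by move=> v; rewrite index_mem.
- move=> i hi; case E : (s) hi => [|v0 s'] // hi; rewrite -E in hi *.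
  by exists (nth v0 s i); rewrite index_uniq.
- move=> v w vw; rewrite ltnNge; apply/negP => h.
  have : leT w v.
    apply: (@sorted_leq_index _ leT _ _ s) => //; last first.
      by apply: sort_sorted => x y; exact: leq_total.
    - by move=> x; exact: leqnn.
    - by move=> y x z; exact: leq_trans.
  by rewrite /leT leqNgt vw.
Qed.

Section NumberedComputad.
Variables (C : computad) (nu : all_gens C -> nat) (N : nat).
Hypotheses (nu_inj : injective nu) (nu_surj : forall i, i < N -> exists v, nu v = i).
Hypothesis nu_mono : forall v w, projT1 v < projT1 w -> nu v < nu w.

Fixpoint gen_ctx (i : nat) : ctx :=
  if i is i'.+1 then
    CExt (gen_ctx i')
      (if pselect (exists v, nu v = i') is left e then total_ty nu (projT1 (cid e)) else Star)
  else CNil.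

Lemma len_gen_ctx i : len (gen_ctx i) = i.
Proof. by elim: i => //= i ->. Qed.

Lemma gen_ctx_at i v : nu v < i -> ctx_at (gen_ctx i) (nu v) = Some (total_ty nu v).
Proof.
elim: i => //= i IH; rewrite len_gen_ctx ltnS leq_eqVlt; case: eqP => [E _|_ /IH //].
case: pselect => [e|[]]; last by exists v.
by congr (Some (total_ty nu _)); apply: nu_inj; rewrite E; exact: projT2 (cid e).
Qed.

Lemma presents_gen_ctx i m : i <= N -> (forall v, projT1 v < m -> nu v < i) ->
  presents (@level_naming C nu m) (gen_ctx i).
Proof.
move=> iN mi; split.
- by move=> g g' /nu_inj /gens_total_inj.
- by move=> g; rewrite gen_ty_total gen_ctx_at //; apply/mi/gens_total_dim.
- move=> x A hx; have xi : x < i by rewrite -(len_gen_ctx i); exact: ctx_at_lt hx.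
  have [v Ev] := nu_surj (leq_trans xi iN).
  move: hx; rewrite -Ev gen_ctx_at ?Ev // => -[<-]; rewrite total_ty_dim => vm.
  by have [g Eg] := gens_total_surj vm; exists g; rewrite /level_naming Eg.
Qed.

(** The prefix before a generator already presents the computad below its dimension, so its
    attaching sphere translates to a valid type there. *)
Lemma gen_ctx_ok i : i <= N -> ctx_ok (gen_ctx i).
Proof.
elim: i => [|i IH] iN; first exact: ctx_ok_nil.
have {}IH := IH (ltnW iN); apply: ctx_ok_ext.
case: pselect => [e|ne]; last exact: ty_ok_star.
case: (cid e) => v /= Ev; case: v Ev => n v Ev.
have pn : presents (@level_naming C nu n) (gen_ctx i).
  by apply: presents_gen_ctx; [exact: ltnW|move=> w wn; rewrite -Ev; exact: nu_mono].
exact: ((soundness n).1 _ _ _ IH (presents_cast (trunc_base C n) pn)).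
Qed.

End NumberedComputad.

Lemma finite_computad_presentation C : finite_computad C ->
  exists G, inhabited (presentation G C).
Proof.
move=> /(finite_numbering (@projT1 _ _)) [N [nu [nu_inj nu_lt nu_surj nu_mono]]].
exists (exist _ (gen_ctx nu N) (gen_ctx_ok nu_inj nu_surj nu_mono (leqnn N))).
by constructor; exists nu => m /=; apply: (presents_gen_ctx nu_inj nu_surj).
Qed.

Section ContextComputad.
Variables (G : ctx) (hG : ctx_ok G).

(** Computad and naming are built together: to attach the variables of the next dimension by
    [sphere_of_ty], the computad built so far must be presented by [G]. *)
Definition partial_presentation m : Type :=
  {C : cpt (level m) & {nu : gens C -> nat | presents nu G}}.

Definition ctx_gen (m : nat) : Type := {x : nat | exists A, ctx_at G x = Some A /\ ty_dim1 A = m}.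

Lemma ctx_gen_sphere m (X : partial_presentation m) (x : ctx_gen m) :
  exists s, ctx_at G (sval x) = Some (sphere_ty m (sval (projT2 X)) s).
Proof.
case: X x => C [nu pG] [x [A [hx Em]]] /=; subst m.
by have [s Es] := sphere_of_ty (ctx_at_ok hG hx) pG; exists s; rewrite Es.
Qed.

Definition next_ncomp m (X : partial_presentation m) : ncomp (level m) :=
  @NComp m (level m) (projT1 X) (ctx_gen m) (fun x => projT1 (cid (ctx_gen_sphere X x))).

Definition next_naming m (X : partial_presentation m)
    (g : gens (next_ncomp X : cpt (level m.+1))) : nat :=
  match g with inl g => sval (projT2 X) g | inr x => sval x end.

Lemma next_presents m (X : partial_presentation m) : presents (@next_naming m X) G.
Proof.
have [nu_inj nu_at nu_surj] := svalP (projT2 X).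
have at_r (x : ctx_gen m) := projT2 (cid (ctx_gen_sphere X x)).
split.
- have neq g (x : ctx_gen m) : sval (projT2 X) g <> sval x.
    move=> E; have [A [hx Em]] := svalP x.
    have := gen_ty_dim (sval (projT2 X)) g.
    by move: hx; rewrite -E nu_at => -[->]; rewrite Em ltnn.
  move=> [g|x] [g'|x'] /=.
  + by move=> /nu_inj ->.
  + by move=> /neq.
  + by move=> /esym/neq.
  + by move=> E; congr inr; case: x x' E => x hx [x' hx'] /= E; exact: eq_exist.
- by move=> [g|x]; [exact: nu_at|exact: at_r].
- move=> x A hx; rewrite ltnS leq_eqVlt => /predU1P[Em|/(nu_surj x A hx) [g <-]]; last by exists (inl g).
  by unshelve eexists (inr (exist _ x _)) => //; exists A.
Qed.

Lemma presents0 : presents (m := 0) (C := tt) (of_void nat) G.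
Proof. by split=> [[]|[]|]. Qed.

Fixpoint ctx_tower m : partial_presentation m :=
  match m with
  | 0 => existT _ (tt : cpt (level 0)) (exist _ (of_void nat) presents0)
  | m'.+1 => existT _ (next_ncomp (ctx_tower m') : cpt (level m'.+1))
       (exist _ (@next_naming m' (ctx_tower m')) (@next_presents m' (ctx_tower m')))
  end.

Definition ctx_computad : computad :=
  @Computad (fun m => projT1 (ctx_tower m)) (fun m => erefl).

Definition ctx_naming (v : all_gens ctx_computad) : nat :=
  sval (projT2 v : ctx_gen (projT1 v)).

Lemma level_ctx_naming m g :
  @level_naming ctx_computad ctx_naming m g = sval (projT2 (ctx_tower m)) g.
Proof.
elim: m g => [|m IH]; first by case.
by case=> [g|v] //; rewrite [RHS]/= -IH.
Qed.

Lemma ctx_naming_presents m : presents (@level_naming ctx_computad ctx_naming m) G.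
Proof.
have -> : @level_naming ctx_computad ctx_naming m = sval (projT2 (ctx_tower m)).
  by apply/funext => g; exact: level_ctx_naming.
exact: (svalP (projT2 (ctx_tower m))).
Qed.

Lemma ctx_computad_finite : finite_computad ctx_computad.
Proof.
apply: (@sub_finite_set _ _ (ctx_naming @^-1` `I_(len G))).
  move=> v _ /=; have [A [hx _]] := svalP (projT2 v : ctx_gen (projT1 v)).
  exact: ctx_at_lt hx.
apply: finite_preimage; last exact: finite_II.
move=> [n v] [n' v'] _ _; rewrite /ctx_naming /= => E.
have [A [hA nA]] := svalP (v : ctx_gen n); have [A' [hA' nA']] := svalP (v' : ctx_gen n').
have En : n = n' by rewrite -nA -nA'; move: hA; rewrite E hA' => -[->].
clear hA hA' nA nA'; subst n'; suff -> : v = v' by []; move: v v' E => [x hx] [x' hx'] /= E.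
exact: eq_exist.
Qed.

End ContextComputad.

(** * The equivalence *)

Theorem corollary6p2 :
  equivalent_categories S_CaTT
    (opposite (full_subcategory Comp finite_computad)).
Proof.
(* A morphism of the opposite category is a homomorphism in the reverse direction, hence the
   exchanged presentations [p'] and [p]. *)
apply: (@equivalence_of_correspondence S_CaTT (opposite (full_subcategory Comp finite_computad))
  (fun G C => presentation G (sval C))
  (fun a b a' b' p p' f => hom_ok_sub p' p f)).
- move=> [G hG]; exists (exist _ (ctx_computad hG) (ctx_computad_finite hG)).
  by constructor; exists (ctx_naming (hG := hG)) => m; exact: ctx_naming_presents.
- by move=> [C fC]; exact: finite_computad_presentation.
- by move=> G C p; exact: hom_ok_sub_id.
- by move=> G C G' C' G'' C'' p p' p'' g f; exact: hom_ok_sub_comp.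
- by move=> G C G' C' p p'; exact: hom_ok_sub_inj.
- by move=> G C G' C' p p' f; exact: hom_ok_sub_surj.
Qed.
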